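(* The anti-canonical embedding of the weighted projective space $Y_1=\mathbf{P}(3,1,1,1)$, that is, $Y_1\subset\mathbf{P}^{38}$ embedded by the complete linear system $|-K_{Y_1}|=|\mathcal{O}_{Y_1}(6)|$, is not extendable.
   Context: Work over $\mathbf{C}$. A projective variety $X\subset\mathbf{P}^N$ is extendable if there exists, for some $r\geq 1$, a projective variety $Y\subset\mathbf{P}^{N+r}$ which is not a cone and has $X$ as a linear section, i.e. $X=Y\cap\Lambda$ for some linear subspace $\Lambda\cong\mathbf{P}^N$ of $\mathbf{P}^{N+r}$, with $\dim Y=\dim X+r$. *)

(* Defs.v *)
From HB Require Import structures.
From mathcomp Require Import all_boot all_order all_algebra.
From mathcomp Require Import boolp classical_sets reals.
From mathcomp Require Import complex mpoly zify.

Set Implicit Arguments.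
Unset Strict Implicit.
Unset Printing Implicit Defensive.

Import GRing.Theory.
Local Open Scope ring_scope.

(* A subset of P^N is given by the set of all homogeneous coordinate vectors
   of its points: a set of nonzero vectors of K^(N+1), stable by scaling. *)

Definition zero_locus (K : closedFieldType) (N : nat)
    (S : set {mpoly K[N.+1]}) : set 'rV[K]_N.+1 :=
  fun x => x != 0 /\ forall F, S F -> F.@[x 0] = 0.

Definition proj_closed (K : closedFieldType) (N : nat)
    (Z : set 'rV[K]_N.+1) : Prop :=
  exists2 S : set {mpoly K[N.+1]},
    (forall F, S F -> exists d : nat, F \is d.-homog) & Z = zero_locus S.

Definition proj_irreducible (K : closedFieldType) (N : nat)
    (Z : set 'rV[K]_N.+1) : Prop :=
  (exists x, Z x) /\
  forall Z1 Z2 : set 'rV[K]_N.+1, proj_closed Z1 -> proj_closed Z2 ->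
    (Z `<=` Z1 `|` Z2)%classic -> (Z `<=` Z1)%classic \/ (Z `<=` Z2)%classic.

Record projVariety (K : closedFieldType) (N : nat) := ProjVariety {
  pv_set :> set 'rV[K]_N.+1;
  pv_closed : proj_closed pv_set;
  pv_irreducible : proj_irreducible pv_set
}.

(* Krull dimension: Z_0 < ... < Z_d are irreducible closed subsets of X. *)
Definition irr_chain (K : closedFieldType) (N : nat)
    (X : set 'rV[K]_N.+1) (d : nat) (Z : nat -> set 'rV[K]_N.+1) : Prop :=
  (forall i, (i <= d)%N ->
     [/\ proj_closed (Z i), proj_irreducible (Z i) & (Z i `<=` X)%classic]) /\
  (forall i, (i < d)%N -> (Z i `<` Z i.+1)%classic).

Definition has_dim (K : closedFieldType) (N : nat)
    (X : projVariety K N) (d : nat) : Prop :=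
  (exists Z, irr_chain X d Z) /\ ~ (exists Z, irr_chain X d.+1 Z).

(* A cone with vertex v contains the line joining v to each of its points.
   In particular linear subspaces are cones. *)
Definition is_cone (K : closedFieldType) (N : nat)
    (Y : projVariety K N) : Prop :=
  exists2 v, pv_set Y v & forall y, pv_set Y y ->
    forall a b : K, a *: v + b *: y != 0 -> pv_set Y (a *: v + b *: y).

Definition vanishing_ideal (K : closedFieldType) (N : nat)
    (X : set 'rV[K]_N.+1) : set {mpoly K[N.+1]} :=
  fun F => forall x, X x -> F.@[x 0] = 0.

(* Saturation with respect to the irrelevant ideal. *)
Definition saturation (K : closedFieldType) (N : nat)
    (J : set {mpoly K[N.+1]}) : set {mpoly K[N.+1]} :=
  fun F => exists k : nat,
    forall m : 'X_{1..N.+1}, mdeg m = k -> J ('X_[m] * F).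

(* The restriction of a form on P^M to the linear subspace
   { [x *m A] | [x] in P^N }, in the coordinates x. *)
Definition linear_pullback (K : closedFieldType) (N M : nat)
    (A : 'M[K]_(N.+1, M.+1)) (F : {mpoly K[M.+1]}) : {mpoly K[N.+1]} :=
  F \mPo [tuple \sum_(j < N.+1) A j i *: 'X_j | i < M.+1].

(* X = Y \cap Lambda as subschemes of Lambda, where Lambda is the image of the
   linear embedding x |-> x *m A of P^N. Closed subschemes of P^N are equal when
   their ideals have the same saturation, and the ideal of X is saturated. *)
Definition is_linear_section (K : closedFieldType) (N M : nat)
    (A : 'M[K]_(N.+1, M.+1)) (X : projVariety K N) (Y : projVariety K M) :
    Prop :=
  row_free A /\
  saturation (linear_pullback A @` vanishing_ideal Y)%classic
    = vanishing_ideal X.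

Definition extendable (K : closedFieldType) (N : nat) (X : projVariety K N) :
    Prop :=
  exists (r : nat) (Y : projVariety K (N + r)) (A : 'M[K]_(N.+1, (N + r).+1)),
    [/\ (1 <= r)%N, ~ is_cone Y, is_linear_section A X Y
      & exists d : nat, has_dim X d /\ has_dim Y (d + r)].

(* Weighted projective spaces P(w_0, ..., w_n): points are nonzero vectors of
   K^(n+1) modulo t . (x_i)_i = (t^(w_i) x_i)_i, and H^0(O(d)) has as basis the
   monomials of weighted degree d. *)

Definition wdeg (n : nat) (w : 'I_n.+1 -> nat) (m : 'X_{1..n.+1}) : nat :=
  (\sum_(i < n.+1) m i * w i)%N.

(* For positive weights, mdeg m <= wdeg w m, so no monomial is missed. *)
Definition wmonomials (n : nat) (w : 'I_n.+1 -> nat) (d : nat) :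
    seq 'X_{1..n.+1} :=
  [seq bmnm m | m : 'X_{1..n.+1 < d.+1} <- enum {: 'X_{1..n.+1 < d.+1}}
     & wdeg w (bmnm m) == d].

Definition wscale (K : closedFieldType) (n : nat) (w : 'I_n.+1 -> nat)
    (t : K) (x : 'rV[K]_n.+1) : 'rV[K]_n.+1 :=
  \row_i (t ^+ w i * x 0 i).

Definition monomial_map (K : closedFieldType) (n N : nat)
    (s : N.+1.-tuple 'X_{1..n.+1}) (x : 'rV[K]_n.+1) : 'rV[K]_N.+1 :=
  \row_i ('X_[tnth s i] : {mpoly K[n.+1]}).@[x 0].

(* The image in P^N of the rational map from P(w_0, ..., w_n) to P^N defined by
   monomials of the same weighted degree, see monomial_map_wscale. *)
Definition monomial_image (K : closedFieldType) (n N : nat)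
    (s : N.+1.-tuple 'X_{1..n.+1}) : set 'rV[K]_N.+1 :=
  fun y => y != 0 /\
    exists (x : 'rV[K]_n.+1) (c : K), x != 0 /\ y = c *: monomial_map s x.

Lemma monomial_map_wscale (K : closedFieldType) (n N : nat)
    (w : 'I_n.+1 -> nat) (d : nat) (s : N.+1.-tuple 'X_{1..n.+1})
    (t : K) (x : 'rV[K]_n.+1) :
  (forall i, wdeg w (tnth s i) = d) ->
  monomial_map s (wscale w t x) = t ^+ d *: monomial_map s x.
Proof.
move=> hs; apply/rowP => i; rewrite !mxE !mevalX -(hs i) /wdeg -prodrXr.
rewrite -big_split /=; apply: eq_bigr => j _.
by rewrite mxE exprMn -exprM mulnC.
Qed.

Definition w3111 (i : 'I_4) : nat := if i == 0 then 3%N else 1%N.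

Lemma w3111_gt0 (i : 'I_4) : (0 < w3111 i)%N.
Proof. by rewrite /w3111; case: ifP. Qed.

Lemma mem_wmonomials (m : 'X_{1..4}) d :
  (m \in wmonomials w3111 d) = (wdeg w3111 m == d).
Proof.
apply/mapP/idP => [[b]|/eqP hm].
  by rewrite mem_filter => /andP[/eqP hb _] ->; apply/eqP.
have lt : (mdeg m < d.+1)%N.
  rewrite ltnS -hm mdegE; apply: leq_sum => i _.
  by rewrite leq_pmulr // w3111_gt0.
exists (BMultinom lt) => //.
by rewrite mem_filter /= hm eqxx mem_enum.
Qed.

Lemma uniq_wmonomials n (w : 'I_n.+1 -> nat) d : uniq (wmonomials w d).
Proof.
rewrite map_inj_uniq; first by apply: filter_uniq; exact: enum_uniq.
by move=> a b e; exact: val_inj.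
Qed.

Lemma size_wmonomials6 : size (wmonomials w3111 6) == 39%N.
Proof.
pose L := [seq t : seq nat <- [seq [:: a.1; a.2; b.1; b.2] | a <- [seq (i,j) | i <- iota 0 3, j <- iota 0 7],
   b <- [seq (i,j) | i <- iota 0 7, j <- iota 0 7]] | (nth 0 t 0 * 3 + nth 0 t 1 + nth 0 t 2 + nth 0 t 3)%N == 6%N].
have sL : size L = 39%N by vm_compute.
have uL : uniq L by vm_compute.
have uW := uniq_wmonomials w3111 6.
pose f (m : 'X_{1..4}) := [:: m 0%R; m 1%R; m 2%R; m 3%R].
have f_inj : injective f.
  move=> m m' [e0 e1 e2 e3]; apply/mnmP => k.
  rewrite -[k]inord_val; case: k => [[|[|[|[|//]]]] hi] /=.
  - by rewrite (_ : inord _ = 0%R) //; apply/val_inj; rewrite /= inordK.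
  - by rewrite (_ : inord _ = 1%R) //; apply/val_inj; rewrite /= inordK.
  - by rewrite (_ : inord _ = 2%R) //; apply/val_inj; rewrite /= inordK.
  - by rewrite (_ : inord _ = 3%R) //; apply/val_inj; rewrite /= inordK.
have wE m : wdeg w3111 m = (m 0%R * 3 + m 1%R + m 2%R + m 3%R)%N.
  rewrite /wdeg !big_ord_recl big_ord0 /w3111 /= !muln1 addn0 !addnA.
  by congr (_ + m _ + m _ + m _)%N; apply/val_inj.
rewrite -sL -(size_map f); apply/eqP/perm_size/uniq_perm => //.
  by rewrite map_inj_uniq.
move=> t; apply/mapP/idP => [[m]|].
  rewrite mem_wmonomials wE => /eqP hm ->.
  rewrite mem_filter; apply/andP; split; first exact/eqP.
  apply/allpairsP; exists ((m 0%R, m 1%R), (m 2%R, m 3%R)); split=> //.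
    by apply/allpairsP; exists (m 0%R, m 1%R); split => //; rewrite mem_iota /=; lia.
  by apply/allpairsP; exists (m 2%R, m 3%R); split => //; rewrite mem_iota /=; lia.
rewrite mem_filter => /andP[/eqP ht /allpairsP[[a b] [_ _ /= et]]].
exists [multinom nth 0%N t i | i < 4].
  by rewrite mem_wmonomials wE !mnmE /= ht.
by rewrite /f !mnmE et.
Qed.

Lemma meval_homogZ (K : closedFieldType) N (F : {mpoly K[N.+1]}) d c (y : 'rV[K]_N.+1) :
  F \is d.-homog -> F.@[(c *: y) 0] = c ^+ d * F.@[y 0].
Proof.
move=> /dhomogP hF; rewrite !mevalE big_distrr /=; apply: eq_big_seq => m hm.
have -> : d = mdeg m by rewrite -(hF m hm).
rewrite mulrCA; congr (_ * _); rewrite mdegE -prodrXr -big_split /=.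
by apply: eq_bigr => i _; rewrite mxE exprMn.
Qed.

(* A basis of H^0(P(3,1,1,1), O(6)); O(6) = O(3+1+1+1) is the anticanonical
   sheaf. *)
Definition wmon6 : 39.-tuple 'X_{1..4} := Tuple size_wmonomials6.

Section Image3111.

Context (K : closedFieldType).
Local Notation phi := (@monomial_map K 3 38 wmon6).
Local Notation Y1 := (@monomial_image K 3 38 wmon6).
Implicit Types (m : 'X_{1..4}) (x : 'rV[K]_4) (y : 'rV[K]_39).

Let pw6 (i : 'I_4) : 'X_{1..4} := (U_(i) *+ (6 %/ w3111 i))%MM.
Let idx m : 'I_39 := inord (index m wmon6).
Let xm x m : K := \prod_i x 0 i ^+ m i.

Let wdegD m m' : wdeg w3111 (m + m')%MM = (wdeg w3111 m + wdeg w3111 m')%N.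
Proof. by rewrite /wdeg -big_split; apply: eq_bigr => i _; rewrite mnmDE mulnDl. Qed.

Let wdegMn m k : wdeg w3111 (m *+ k)%MM = (k * wdeg w3111 m)%N.
Proof. by rewrite /wdeg big_distrr; apply: eq_bigr => i _ /=; rewrite mulmnE mulnAC mulnC. Qed.

Let wdegU i : wdeg w3111 U_(i)%MM = w3111 i.
Proof.
rewrite /wdeg (bigD1 i) //= mnm1E eqxx mul1n big1 ?addn0 // => j hj.
by rewrite mnm1E eq_sym (negbTE hj).
Qed.

Let mem6 m : (m \in wmon6) = (wdeg w3111 m == 6%N). Proof. exact: mem_wmonomials. Qed.

Let idxK m : wdeg w3111 m = 6%N -> tnth wmon6 (idx m) = m.
Proof.
move=> /eqP; rewrite -mem6 => h; rewrite (tnth_nth 0%MM) /idx inordK ?nth_index //.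
by move: h; rewrite -index_mem size_tuple.
Qed.

Let idxtK k : idx (tnth wmon6 k) = k.
Proof. by apply/val_inj; rewrite /idx (tnth_nth 0%MM) index_uniq ?size_tuple ?uniq_wmonomials ?inord_val. Qed.

Let wtnth i : wdeg w3111 (tnth wmon6 i) = 6%N.
Proof. by apply/eqP; rewrite -mem6 mem_tnth. Qed.

Let wpw6 i : wdeg w3111 (pw6 i) = 6%N.
Proof. by rewrite /pw6 wdegMn wdegU /w3111; case: ifP. Qed.

Let phiE x i : phi x 0 i = xm x (tnth wmon6 i).
Proof. by rewrite mxE mevalX. Qed.

Let xmD x m m' : xm x (m + m')%MM = xm x m * xm x m'.
Proof. by rewrite /xm -big_split; apply: eq_bigr => i _; rewrite mnmDE exprD. Qed.

Let xm_sum x (l : seq 'X_{1..4}) : \prod_(m <- l) xm x m = xm x (\sum_(m <- l) m)%MM.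
Proof.
elim: l => [|m l IH]; last by rewrite !big_cons xmD IH.
by rewrite !big_nil /xm big1 // => i _; rewrite mnm0E.
Qed.

Let phi_neq0 x : x != 0 -> phi x != 0.
Proof.
apply: contraNneq => h; apply/eqP/rowP => i; rewrite mxE.
have := phiE x (idx (pw6 i)); rewrite h mxE idxK // /xm (bigD1 i) //=.
rewrite big1 ?mulr1.
  by move/esym/eqP; rewrite expf_eq0 => /andP[_ /eqP].
by move=> j hj; rewrite mulmnE mnm1E eq_sym (negbTE hj) mul0n expr0.
Qed.

Let J : set {mpoly K[39]} := fun F => (exists d, F \is d.-homog) /\ vanishing_ideal Y1 F.

Let rel y (l1 l2 : seq 'X_{1..4}) : zero_locus J y ->
  all (fun m => wdeg w3111 m == 6%N) (l1 ++ l2) -> size l1 = size l2 ->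
  (\sum_(m <- l1) m = \sum_(m <- l2) m)%MM ->
  \prod_(m <- l1) y 0 (idx m) = \prod_(m <- l2) y 0 (idx m).
Proof.
move=> [_ hy]; rewrite all_cat => /andP[h1 h2] hs he.
pose P l : {mpoly K[39]} := \prod_(m <- l) 'X_(idx m).
have PE l (z : 'rV[K]_39) : (P l).@[z 0] = \prod_(m <- l) z 0 (idx m).
  by rewrite /P rmorph_prod; apply: eq_bigr => m _; rewrite /= mevalXU.
have Ph l : P l \is (size l).-homog.
  rewrite /P; elim: l => [|m l IH]; first by rewrite big_nil dhomog1.
  by rewrite big_cons -[size _]/(1 + size l)%N dhomogM // dhomogX /= mdeg1.
apply/eqP; rewrite -subr_eq0 -!PE -mevalB; apply/eqP/hy; split.
  by exists (size l1); rewrite rpredB // hs.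
move=> z [_ [x [c [_ ->]]]]; rewrite mevalB !PE; apply/eqP; rewrite subr_eq0; apply/eqP.
have aux l : all (fun m => wdeg w3111 m == 6%N) l ->
    \prod_(m <- l) (c *: phi x) 0 (idx m) = c ^+ size l * xm x (\sum_(m <- l) m)%MM.
  move=> hl; rewrite -xm_sum.
  elim: l hl => [|m l IH] /=; first by rewrite !big_nil mulr1.
  move=> /andP[/eqP hm /IH IHl]; rewrite !big_cons IHl exprS mxE phiE idxK //.
  by rewrite mulrACA.
by rewrite !aux // hs he.
Qed.

Let closedY1 : proj_closed Y1.
Proof.
exists J; first by move=> F [].
apply/predeqP => y; split=> [hy|hy].
  by split; [case: hy | move=> F [_ hF]; apply: hF].
split; first by case: hy.
case: (pselect (exists2 i : 'I_4, i != 0 & y 0 (idx (pw6 i)) != 0)) => [[i i0 hi]|hn].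
  set u := y 0 (idx (pw6 i)) in hi.
  have wi : w3111 i = 1%N by rewrite /w3111 (negbTE i0).
  pose q (j : 'I_4) : 'X_{1..4} := (U_(j) + U_(i) *+ (6 - w3111 j))%MM.
  have wq j : wdeg w3111 (q j) = 6%N.
    by rewrite /q wdegD wdegMn !wdegU wi /w3111; case: ifP.
  pose x : 'rV[K]_4 := \row_j (y 0 (idx (q j)) / u).
  exists x, u; split.
    apply/eqP => /rowP /(_ i); rewrite !mxE.
    have -> : q i = pw6 i.
      by apply/mnmP => j; rewrite /q /pw6 mnmDE !mulmnE wi divn1 subn1 /=; lia.
    by rewrite -/u divff // => /eqP; rewrite oner_eq0.
  apply/rowP => k; rewrite mxE phiE.
  set m := tnth wmon6 k; have hm : wdeg w3111 m = 6%N by exact: wtnth.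
  have -> : k = idx m by rewrite idxtK.
  pose l1 := flatten [seq nseq (m j) (q j) | j <- index_enum 'I_4].
  have sl1 : size l1 = mdeg m.
    rewrite /l1 size_flatten /shape -map_comp sumnE big_map mdegE /=.
    by apply: eq_bigr => j _; rewrite size_nseq.
  have m_gt0 : (0 < mdeg m)%N.
    rewrite lt0n mdeg_eq0; apply: contra_eq_neq hm => ->.
    by rewrite /wdeg big1 // => j _; rewrite mnm0E.
  have := @rel y l1 (m :: nseq (mdeg m).-1 (pw6 i)) hy.
  have -> : all (fun m => wdeg w3111 m == 6%N) (l1 ++ m :: nseq (mdeg m).-1 (pw6 i)).
    apply/allP => z; rewrite mem_cat inE => /orP[/flattenP[_ /mapP[j _ ->]]|].
      by rewrite mem_nseq => /andP[_ /eqP ->]; rewrite wq.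
    by case/predU1P => [->|]; rewrite ?hm // mem_nseq => /andP[_ /eqP ->]; rewrite wpw6.
  rewrite sl1 /= size_nseq prednK // => /(_ isT erefl).
  rewrite !big_cons /l1 !big_flatten !big_map /=.
  have -> : (\sum_(j < 4) \sum_(z <- nseq (m j) (q j)) z =
       m + \sum_(z <- nseq (mdeg m).-1 (pw6 i)) z)%MM.
    have sn k' (z : 'X_{1..4}) : (\sum_(z' <- nseq k' z) z' = z *+ k')%MM.
      by rewrite big_nseq; elim: k' => [|k' IH]; rewrite ?mulm0n // iterS IH mulmS.
    apply/mnmP => a; rewrite mnmDE sn mulmnE mnm_sumE.
    under eq_bigr do rewrite sn mulmnE /q mnmDE mulmnE mulnDl.
    rewrite big_split /=; congr (_ + _)%N.
      rewrite (bigD1 a) //= mnm1E eqxx mul1n big1 ?addn0 // => j hj.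
      by rewrite mnm1E (negbTE hj).
    rewrite /pw6 mulmnE wi divn1 mnm1E; case: eqP => _; last by rewrite !mul0n big1.
    under eq_bigr do rewrite mul1n mulnBl.
    rewrite mul1n; move: hm; rewrite /wdeg mdegE !big_ord_recl !big_ord0 /w3111 /=.
    lia.
  move=> /(_ erefl).
  have pn k' (z : 'X_{1..4}) : \prod_(z' <- nseq k' z) y 0 (idx z') = y 0 (idx z) ^+ k'.
    by rewrite big_nseq; elim: k' => [|k' IH] //; rewrite iterS IH exprS.
  under eq_bigr do rewrite pn.
  rewrite pn -/u => E.
  rewrite /xm; under eq_bigr do rewrite mxE exprMn exprVn.
  rewrite big_split /= E prodfV prodrXr -mdegE.
  rewrite -[in X in _ / X](prednK m_gt0) exprS invfM.
  by rewrite mulrACA divff ?expf_neq0 // mulr1 mulrCA divff // mulr1.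
have h0 m : wdeg w3111 m = 6%N -> (exists2 j : 'I_4, j != 0 & (0 < m j)%N) -> y 0 (idx m) = 0.
  move=> hm [j j0 mj].
  pose e i := if i == 0 then (m i * 3)%N else m i.
  pose l1 := flatten [seq nseq (e i) (pw6 i) | i <- index_enum 'I_4].
  have se : (\sum_i e i)%N = 6%N.
    rewrite -hm /wdeg; apply: eq_bigr => i _; rewrite /e /w3111.
    by case: ifP; rewrite ?muln1.
  have := @rel y (nseq 6 m) l1 hy.
  have -> : all (fun m => wdeg w3111 m == 6%N) (nseq 6 m ++ l1).
    apply/allP => z; rewrite mem_cat mem_nseq => /orP[/andP[_ /eqP ->]|/flattenP[_ /mapP[i _ ->]]].
      by rewrite hm.
    by rewrite mem_nseq => /andP[_ /eqP ->]; rewrite wpw6.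
  rewrite size_nseq /l1 size_flatten /shape -map_comp sumnE big_map.
  under eq_bigr do rewrite /= size_nseq.
  rewrite se => /(_ isT erefl).
  rewrite !big_flatten !big_map => H.
  apply/eqP; have : y 0 (idx m) ^+ 6 == 0.
    have -> : y 0 (idx m) ^+ 6 = \prod_(z <- nseq 6 m) y 0 (idx z) by rewrite big_nseq /= !exprS expr0.
    rewrite H.
      rewrite (bigD1 j) //= big_nseq.
      have -> : e j = (e j).-1.+1 by rewrite prednK // /e (negbTE j0).
      rewrite iterS.
      have -> : y 0 (idx (pw6 j)) = 0.
        by apply/eqP; apply: contrapT => /negP hj; apply: hn; exists j.
      by rewrite !mul0r.
    have sn k' (z : 'X_{1..4}) : (\sum_(z' <- nseq k' z) z' = z *+ k')%MM.
      by rewrite big_nseq; elim: k' => [|k' IH]; rewrite ?mulm0n // iterS IH mulmS.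
    rewrite sn; apply/mnmP => a; rewrite mulmnE mnm_sumE.
    under eq_bigr do rewrite sn mulmnE /pw6 mulmnE mnm1E.
    rewrite (bigD1 a) //= eqxx mul1n big1 ?addn0 /e /w3111; last first.
      by move=> i /negbTE ->.
    case: ifP => _; first by rewrite mulnCA; congr (_ * _)%N.
    by rewrite divn1 mulnC.
  by rewrite expf_eq0.
pose x : 'rV[K]_4 := delta_mx 0 0.
exists x, (y 0 (idx (pw6 0))); split.
  by apply/eqP => /rowP /(_ 0); rewrite !mxE eqxx => /eqP; rewrite oner_eq0.
apply/rowP => k; rewrite mxE phiE.
set m := tnth wmon6 k; have hm : wdeg w3111 m = 6%N by exact: wtnth.
have -> : k = idx m by rewrite idxtK.
case: (pselect (exists2 j : 'I_4, j != 0 & (0 < m j)%N)) => [hj|hj].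
  rewrite h0 //; case: hj => j j0 mj.
  by rewrite /xm (bigD1 j) //= mxE (negbTE j0) andbF expr0n eqn0Ngt mj mul0r mulr0.
have mz j : j != 0 -> m j = 0%N.
  by move=> j0; apply/eqP; rewrite -leqn0 leqNgt; apply/negP => mj; apply: hj; exists j.
have -> : m = pw6 0.
  apply/mnmP => j; rewrite /pw6 mulmnE mnm1E; case: eqP => [<-|/eqP j0]; last by rewrite mz // eq_sym.
  move: hm; rewrite /wdeg (bigD1 0) //= big1 => [|i /mz -> //].
  by rewrite /w3111 /= addn0 mul1n => /(congr1 (divn^~ 3)); rewrite mulnK.
rewrite /xm big1 ?mulr1 // => j _; rewrite /pw6 mxE mulmnE mnm1E eqxx /=.
by rewrite [0 == j]eq_sym; case: eqP; rewrite ?expr1n.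
Qed.

Let polyfun (h : K -> K) := exists f : {poly K}, forall t, f.[t] = h t.

Let polyfunM h k : polyfun h -> polyfun k -> polyfun (fun t => h t * k t).
Proof. by move=> [f hf] [g hg]; exists (f * g) => t; rewrite hornerM hf hg. Qed.

Let polyfun_prod n (h : 'I_n -> K -> K) (e : 'I_n -> nat) : (forall i, polyfun (h i)) ->
  polyfun (fun t => \prod_i h i t ^+ e i).
Proof.
move=> /fin_all_exists[f hf]; exists (\prod_i f i ^+ e i) => t.
by rewrite horner_prod; apply: eq_bigr => i _; rewrite horner_exp hf.
Qed.

Let polyfun_meval n (h : 'I_n -> K -> K) (F : {mpoly K[n]}) : (forall i, polyfun (h i)) ->
  polyfun (fun t => F.@[fun i => h i t]).
Proof.
move=> hh.
have /fin_all_exists[f hf] (i : 'I_n) : polyfun (h i) by [].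
exists (\sum_(m <- msupp F) F@_m *: \prod_i f i ^+ m i) => t.
rewrite mevalE horner_sum; apply: eq_bigr => m _; rewrite hornerZ horner_prod.
by congr (_ * _); apply: eq_bigr => i _; rewrite horner_exp hf.
Qed.

Let irrY1 : proj_irreducible Y1.
Proof.
split.
  have d0 : (delta_mx 0 0 : 'rV[K]_4) != 0.
    by apply/eqP => /rowP /(_ 0); rewrite !mxE eqxx => /eqP; rewrite oner_eq0.
  exists (phi (delta_mx 0 0)); split; first exact: phi_neq0.
  by exists (delta_mx 0 0), 1; rewrite scale1r.
move=> Z1 Z2 [S1 hS1 ->] [S2 hS2 ->] hcov.
apply: contrapT => /not_orP[/existsNP[p /not_implyP[Yp np]] /existsNP[q /not_implyP[Yq nq]]].
have pick S z : Y1 z -> (forall F, S F -> exists d : nat, F \is d.-homog) -> ~ zero_locus S z ->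
    exists F a, [/\ S F, a != 0 & F.@[phi a 0] != 0].
  move=> [z0 [a [c [a0 za]]]] hS nz.
  have [F /not_implyP[SF Fz]] : exists F, ~ (S F -> F.@[z 0] = 0).
    by apply/existsNP => h; apply: nz; split.
  exists F, a; split=> //; apply: contra_notN Fz => /eqP Fa.
  by have [d hd] := hS _ SF; rewrite za (meval_homogZ _ _ hd) Fa mulr0.
have [F [a [SF a0 Fa]]] := pick _ _ Yp hS1 np.
have [G [b [SG b0 Gb]]] := pick _ _ Yq hS2 nq.
pose x t := a + t *: (b - a).
have xp i : polyfun (fun t => x t 0 i).
  exists ((a 0 i)%:P + 'X * (b 0 i - a 0 i)%:P) => t.
  by rewrite !hornerE !mxE.
have php i : polyfun (fun t => phi (x t) 0 i).
  have [f hf] := polyfun_prod (tnth wmon6 i) xp.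
  by exists f => t; rewrite hf phiE.
have [f hf] := polyfun_meval F php.
have [g hg] := polyfun_meval G php.
have [j aj] : exists j, a 0 j != 0.
  apply: contrapT => /forallNP h; move/eqP: a0; apply; apply/rowP => j.
  by rewrite mxE; apply/eqP/negPn/negP/h.
have [l hl] := xp j.
have x0 : x 0 = a by rewrite /x scale0r addr0.
have x1 : x 1 = b by rewrite /x scale1r addrC subrK.
have f0 : f != 0 by apply: contraNneq Fa => f0; rewrite -x0 -[F.@[_]]hf f0 horner0.
have g0 : g != 0 by apply: contraNneq Gb => g0; rewrite -x1 -[G.@[_]]hg g0 horner0.
have l0 : l != 0 by apply: contraNneq aj => l0; rewrite -x0 -hl l0 horner0.
have /closed_nonrootP[t] : l * f * g != 0 by rewrite !mulf_neq0.
rewrite /root !hornerM !mulf_eq0 !negb_or hf hg hl => /andP[/andP[lt ft] gt].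
have Yt : Y1 (phi (x t)).
  have xt : x t != 0 by apply: contraNneq lt => ->; rewrite mxE.
  by split; [exact: phi_neq0 | exists (x t), 1; rewrite scale1r].
case: (hcov _ Yt) => -[_ /(_ _ _)] h.
  by move/eqP: ft; apply; apply: (h F).
by move/eqP: gt; apply; apply: (h G).
Qed.

Definition anticanonical_P3111 : projVariety K 38 :=
  ProjVariety closedY1 irrY1.

End Image3111.

(* Main.v *)
From HB Require Import structures.
From mathcomp Require Import all_boot all_order all_algebra.
From mathcomp Require Import boolp classical_sets reals complex.
From mathcomp Require Import mpoly zify ring.
Require Import Defs.

(** Choose coordinates [(y, t)] with [X = Y :&: {t = 0}], where [X] is the image of
    [P(3,1,1,1)]. The affine cone over [X] is the quotient of affine 4-space by the
    sixth roots of unity acting with weights [(3, 1, 1, 1)], a rigid singularity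
    (Schlessinger), so that [Y] should be a cone over [X]; the relevant part of this
    rigidity is done by hand. Comparing Hilbert functions, [dim Y = 3 + r] forces the
    initial forms in [t] of the ideal [I] of [Y] to lie in the toric ideal of [X].
    Suppose that [I] vanishes modulo [(t) ^ s] on the cone over [X] whose vertex is
    the graph of a linear map [c]. The terms of order [s] then give
    homomorphisms of degree [- s] from the toric ideal to [K[x_0, ..., x_3]].
    Such a homomorphism is computed, one torus weight at a time, in the charts
    [x_1 <> 0], [x_2 <> 0], [x_3 <> 0] of [X]: it comes from a
    translation of the [y_a] if [s = 1], which is absorbed in [c], and it is zero
    if [s > 1]. Hence [I] vanishes on this cone, which by dimension is [Y]. *)

Set Implicit Arguments.
Unset Strict Implicit.
Unset Printing Implicit Defensive.

Import Order.TTheory GRing.Theory Num.Theory.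
Local Open Scope ring_scope.

(** * Polynomials and orders *)

(** The equality of [X] with the section is one of saturations, so a binomial of the toric ideal is
    the restriction of an element of [I] only in large degree. Hence the uniform bound [n0], and the
    repeated multiplication by a power of a variable whose image has an initial form free of [T],
    cancelled afterwards. Flatness in [t] is not given either: an unexpected initial form would
    remove all its multiples and leave a growth of order [2 + r]. The chart of [x_0] is avoided
    because [x_0] has weight 3, whereas for [e] in 1, 2, 3 the four monomials [x_i x_e ^ (6 - w_i)]
    are coordinates, and a homomorphism is read off from the displacement of each [y_a] while these
    stay fixed. The only obstacle is a pole along [x_e]. It cannot occur if the torus weight is
    nonnegative at [x_e]. If the weight is negative at all three variables, the displacements of the
    pure powers vanish, by comparison with a third variable of weight one; since 6 is invertible,
    two charts then agree, and each excludes the pole of the other. *)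

Section Weights.

Context (n : nat).
Implicit Types (w : 'I_n -> nat) (m : 'X_{1..n}).

Definition wgt w m : nat := (\sum_i m i * w i)%N.

Lemma wgtD w m1 m2 : wgt w (m1 + m2)%MM = (wgt w m1 + wgt w m2)%N.
Proof. by rewrite /wgt -big_split; apply: eq_bigr => i _; rewrite mnmDE mulnDl. Qed.

Lemma wgt0 w : wgt w 0%MM = 0%N.
Proof. by rewrite /wgt big1 // => i _; rewrite mnm0E. Qed.

Lemma wgtU w i : wgt w U_(i)%MM = w i.
Proof.
rewrite /wgt (bigD1 i) //= mnm1E eqxx mul1n big1 ?addn0 // => j hj.
by rewrite mnm1E eq_sym (negbTE hj).
Qed.

Lemma wgtMn w m k : wgt w (m *+ k)%MM = (k * wgt w m)%N.
Proof. by elim: k => [|k IH]; rewrite ?mulm0n ?wgt0 // mulmS wgtD IH mulSn. Qed.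

Lemma wgt_le w m1 m2 : (m1 <= m2)%MM -> (wgt w m1 <= wgt w m2)%N.
Proof. by move=> /mnm_lepP h; apply: leq_sum => i _; rewrite leq_mul2r h orbT. Qed.

Lemma wgt_le0 w m1 m2 : (m1 <= m2)%MM -> wgt w m2 = 0%N -> wgt w m1 = 0%N.
Proof. by move=> /(@wgt_le w) h e; apply/eqP; rewrite -leqn0 (leq_trans h) // e. Qed.

(** As a [measure], a weight can be used with [pihomog] and [dhomog]. *)
HB.instance Definition _ w := isMeasure.Build n (wgt w) (wgt0 w) (wgtD w).

End Weights.

Section Order.

Context (n : nat) (K : idomainType) (w : 'I_n -> nat).
Implicit Types (m : 'X_{1..n}) (p q : {mpoly K[n]}) (s t : nat).

(** For the weights [tS] and [tQ] below, this is membership in the [s]-th power of the ideal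
    generated by the variables [t], respectively [T]. *)
Definition ordge s p := forall m, (wgt w m < s)%N -> p@_m = 0.

Lemma mcoeffM_neq0 p q m : (p * q)@_m != 0 ->
  exists m1 m2, [/\ m = (m1 + m2)%MM, p@_m1 != 0 & q@_m2 != 0].
Proof.
rewrite -mcoeff_msupp => /msuppM_le /allpairsP[[m1 m2] /= [h1 h2 ->]].
by exists m1, m2; rewrite -!mcoeff_msupp.
Qed.

Lemma ordge0 p : ordge 0 p. Proof. by []. Qed.

Lemma ordge_0 s : ordge s 0. Proof. by move=> m _; rewrite mcoeff0. Qed.

Lemma ordgeW s t p : (t <= s)%N -> ordge s p -> ordge t p.
Proof. by move=> h hp m hm; apply/hp/(leq_trans hm). Qed.

Lemma ordgeD s p q : ordge s p -> ordge s q -> ordge s (p + q).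
Proof. by move=> hp hq m hm; rewrite mcoeffD hp // hq // addr0. Qed.

Lemma ordgeN s p : ordge s p -> ordge s (- p).
Proof. by move=> hp m hm; rewrite mcoeffN hp // oppr0. Qed.

Lemma ordgeB s p q : ordge s p -> ordge s q -> ordge s (p - q).
Proof. by move=> hp hq; apply/ordgeD/ordgeN. Qed.

Lemma ordgeZ s c p : ordge s p -> ordge s (c *: p).
Proof. by move=> hp m hm; rewrite mcoeffZ hp // mulr0. Qed.

Lemma ordge_sum s (I : Type) (r : seq I) (P : pred I) (F : I -> {mpoly K[n]}) :
  (forall i, P i -> ordge s (F i)) -> ordge s (\sum_(i <- r | P i) F i).
Proof.
by move=> h; apply: (big_ind (ordge s)) => // *; [exact: ordge_0|exact: ordgeD].
Qed.

Lemma ordgeX m : ordge (wgt w m) 'X_[m].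
Proof. by move=> m' hm; rewrite mcoeffX; case: eqP hm => // ->; rewrite ltnn. Qed.

Lemma ordgeM s t p q : ordge s p -> ordge t q -> ordge (s + t) (p * q).
Proof.
move=> hp hq m hm; apply/eqP; case: eqP => // /eqP /mcoeffM_neq0[m1 [m2 [e h1 h2]]].
have : (s <= wgt w m1)%N by rewrite leqNgt; apply: contraNN h1 => /hp/eqP.
have : (t <= wgt w m2)%N by rewrite leqNgt; apply: contraNN h2 => /hq/eqP.
by rewrite e wgtD in hm; lia.
Qed.

Lemma ordgeMl t p q : ordge t q -> ordge t (p * q).
Proof. exact: (@ordgeM 0). Qed.

Lemma ordgeMr t p q : ordge t p -> ordge t (p * q).
Proof. by move=> h; rewrite mulrC; exact: ordgeMl. Qed.

Lemma ordge_mulX s m p : ordge s p -> ordge (wgt w m + s) ('X_[m] * p).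
Proof. by apply: ordgeM; exact: ordgeX. Qed.

(* [p] has the initial form ['X_[h]], which is of weight zero. *)
Lemma ordge_cancel h s p q : wgt w h = 0%N -> ordge 1 (p - 'X_[h]) ->
  ordge s (p * q) -> ordge s q.
Proof.
move=> h0 hp hpq; elim: s hpq => // s IH hpq m.
have hs : ordge s q by apply: IH; apply: ordgeW hpq.
rewrite ltnS leq_eqVlt => /orP[/eqP hm|]; last exact: hs.
rewrite -(mcoeffMX q h m).
have -> : q * 'X_[h] = p * q - (p - 'X_[h]) * q by rewrite mulrBl [in RHS]mulrC; ring.
rewrite mcoeffB hpq ?wgtD ?h0 ?add0n ?hm //.
by rewrite (ordgeM hp hs) ?subr0 // wgtD h0 hm add0n add1n.
Qed.

End Order.

Lemma digits_inj (b n : nat) (f g : 'I_n -> nat) :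
  (forall i, f i < b)%N -> (forall i, g i < b)%N ->
  (\sum_(i < n) f i * b ^ i = \sum_(i < n) g i * b ^ i)%N -> f =1 g.
Proof.
elim: n f g => [|n IH] f g hf hg; first by move=> _ [].
have b0 : (0 < b)%N by apply: leq_ltn_trans (hf ord0).
have E (h : 'I_n.+1 -> nat) : (\sum_(i < n.+1) h i * b ^ i =
    (\sum_(i < n) h (lift ord0 i) * b ^ i) * b + h ord0)%N.
  rewrite big_ord_recl muln1 addnC big_distrl /=; congr (_ + _)%N.
  by apply: eq_bigr => i _; rewrite expnSr mulnA.
rewrite !E => e.
have e0 : f ord0 = g ord0.
  by have := congr1 (modn^~ b) e; rewrite /= !modnMDl !modn_small.
move: e; rewrite e0 => /addIn /eqP; rewrite eqn_pmul2r // => /eqP e.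
move=> i; case: (unliftP ord0 i) => [j ->|-> //].
by apply: (IH (f \o lift ord0) (g \o lift ord0)) => // k; [exact: hf|exact: hg].
Qed.

Section Evaluation.

Context (K : closedFieldType).

Lemma closed_poly_fun0 (p : {poly K}) : (forall t, p.[t] = 0) -> p = 0.
Proof.
move=> h; apply/eqP; case: eqP => // /eqP /closed_nonrootP[t].
by rewrite /root h eqxx.
Qed.

(** A closed field is infinite, which settles one variable. As [b] exceeds every exponent of [p],
    distinct monomials go to distinct powers of [t]. *)
Lemma mpoly_fun0 n (p : {mpoly K[n]}) : (forall v : 'I_n -> K, p.@[v] = 0) -> p = 0.
Proof.
move=> hp; pose b := (msize p).+1.
(* Kronecker substitution ['X_i := t ^+ (b ^ i)]. *)
pose kr (m : 'X_{1..n}) := (\sum_(i < n) m i * b ^ i)%N.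
have kr_inj : {in msupp p &, injective kr}.
  have lt m i : m \in msupp p -> (m i < b)%N.
    move=> /msize_mdeg_lt h; apply: ltnW; rewrite ltnS; apply: leq_ltn_trans h.
    by rewrite mdegE (bigD1 i) //= leq_addr.
  by move=> m1 m2 h1 h2 e; apply/mnmP; apply: (digits_inj _ _ e) => i; exact: lt.
pose f : {poly K} := \sum_(m <- msupp p) p@_m *: 'X^(kr m).
have f0 : f = 0.
  apply: closed_poly_fun0 => t; rewrite -[RHS](hp (fun i => t ^+ (b ^ i))).
  rewrite mevalE horner_sum; apply: eq_bigr => m _; rewrite !hornerE; congr (_ * _).
  rewrite -prodrXr; apply: eq_bigr => i _; by rewrite -exprM mulnC.
apply/mpolyP => m; rewrite mcoeff0; apply/eqP; case: eqP => // /eqP.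
rewrite -mcoeff_msupp => hm.
have : f`_(kr m) = 0 by rewrite f0 coef0.
rewrite coef_sum (bigD1_seq m) //= coefZ coefXn eqxx mulr1 big_seq_cond big1.
  by move/eqP; rewrite addr0 mcoeff_eq0 hm.
move=> m' /andP[h1 h2]; rewrite coefZ coefXn; case: eqP => [e|]; last by rewrite mulr0.
by rewrite (kr_inj _ _ hm h1 e) eqxx in h2.
Qed.

End Evaluation.

(** * Homogeneous ideals and Hilbert functions *)

Section Ideals.

Context (n : nat) (K : fieldType).
Local Notation S := {mpoly K[n]}.
Implicit Types (I J : S -> Prop) (f g : S) (s t B : seq S).

(** Primality is tested on forms only, which is what irreducibility of a projective set yields. The
    unit ideal is allowed, so properness appears separately as [~ I 1]. *)
Record hprime I : Prop := HPrime {
  hprime0 : I 0;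
  hprimeD : forall f g, I f -> I g -> I (f + g);
  hprimeM : forall f g, I g -> I (f * g);
  hprimeP : forall d e f g, f \is d.-homog -> g \is e.-homog ->
    I (f * g) -> I f \/ I g
}.

Lemma hprimeZ I c f : hprime I -> I f -> I (c *: f).
Proof. by move=> hI hf; rewrite -mul_mpolyC; apply: hprimeM. Qed.

Lemma hprimeN I f : hprime I -> I f -> I (- f).
Proof. by move=> hI hf; rewrite -scaleN1r; apply: hprimeZ. Qed.

Lemma hprimeB I f g : hprime I -> I f -> I g -> I (f - g).
Proof. by move=> hI hf hg; apply: hprimeD => //; apply: hprimeN. Qed.

Lemma hprime_sum I (T : Type) (r : seq T) (P : pred T) (F : T -> S) : hprime I ->
  (forall i, P i -> I (F i)) -> I (\sum_(i <- r | P i) F i).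
Proof.
by move=> hI h; apply: (big_ind I) => // *; [exact: hprime0|exact: hprimeD].
Qed.

Lemma hprime_exp I d k f : hprime I -> f \is d.-homog -> ~ I 1 -> I (f ^+ k) -> I f.
Proof.
move=> hI hf h1; elim: k => [|k IH]; first by rewrite expr0.
by rewrite exprS => /(hprimeP hI hf (dhomogMn k hf)) [].
Qed.

(** With [spans], this replaces the Hilbert function of [I]: independent families bound it from
    below, spanning lists from above. *)
Definition indep I s := forall c : nat -> K,
  I (\sum_(k < size s) c k *: s`_k) -> forall k, (k < size s)%N -> c k = 0.

Definition spans I B f := exists c : nat -> K, I (f - \sum_(k < size B) c k *: B`_k).

Lemma spansD I B f g : hprime I -> spans I B f -> spans I B g -> spans I B (f + g).
Proof.
move=> hI [c hc] [d hd]; exists (fun k => c k + d k).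
under eq_bigr do rewrite scalerDl.
by rewrite big_split /= opprD addrACA; apply: hprimeD.
Qed.

Lemma spansZ I B a f : hprime I -> spans I B f -> spans I B (a *: f).
Proof.
move=> hI [c hc]; exists (fun k => a * c k).
under eq_bigr do rewrite -scalerA.
by rewrite -scaler_sumr -scalerBr; apply: hprimeZ.
Qed.

Lemma spans0 I B f : hprime I -> I f -> spans I B f.
Proof.
move=> hI hf; exists (fun=> 0); under eq_bigr do rewrite scale0r.
by rewrite sumr_const mul0rn subr0.
Qed.

Lemma spansB I B f g : hprime I -> spans I B f -> spans I B g -> spans I B (f - g).
Proof. by move=> hI hf hg; apply: spansD => //; rewrite -scaleN1r; apply: spansZ. Qed.

Lemma spans_mem I B f : hprime I -> f \in B -> spans I B f.
Proof.
move=> hI hf; exists (fun k => (k == index f B)%:R).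
have hi : (index f B < size B)%N by rewrite index_mem.
rewrite (bigD1 (Ordinal hi)) //= eqxx scale1r nth_index // big1 ?addr0 ?subrr; first exact: hprime0.
by move=> i hi'; rewrite (_ : (_ == _) = false) ?scale0r //; apply: contra_neqF hi' => /eqP e; exact: val_inj.
Qed.

Lemma spans_sum I B (T : Type) (r : seq T) (P : pred T) (F : T -> S) : hprime I ->
  (forall i, P i -> spans I B (F i)) -> spans I B (\sum_(i <- r | P i) F i).
Proof.
move=> hI h; apply: (big_ind (spans I B)) => // [|*]; last exact: spansD.
by apply: spans0 => //; apply: hprime0.
Qed.

Lemma spans_sum_seq I B (T : eqType) (r : seq T) (F : T -> S) : hprime I ->
  {in r, forall i, spans I B (F i)} -> spans I B (\sum_(i <- r) F i).
Proof. by move=> hI h; rewrite big_seq; apply: spans_sum. Qed.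

(** Otherwise the matrix of coefficients of [s] on [B] has more rows than columns, and a vector of
    its left kernel is a relation modulo [I]. *)
Lemma indep_span I s B : hprime I -> indep I s ->
  (forall f, f \in s -> spans I B f) -> (size s <= size B)%N.
Proof.
move=> hI hs hB; rewrite leqNgt; apply/negP => lt.
have hB' (k : 'I_(size s)) : spans I B s`_k by apply/hB/mem_nth.
have [c hc] := fin_all_exists hB'.
pose M := \matrix_(k < size s, j < size B) c k j.
have [v v0 vM] : exists2 v : 'rV[K]_(size s), v != 0 & v *m M = 0.
  have : kermx M != 0.
    rewrite -mxrank_eq0 mxrank_ker subn_eq0 -ltnNge.
    by apply: leq_ltn_trans lt; exact: rank_leq_col.
  by move=> /rowV0Pn[v /sub_kermxP hv v0]; exists v.
case/eqP: v0; apply/rowP => k; rewrite mxE.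
pose a j := if insub j is Some k then v 0 k else 0.
have aE (j : 'I_(size s)) : a j = v 0 j by rewrite /a valK.
rewrite -aE; apply: hs => //.
have -> : \sum_(k < size s) a k *: s`_k =
   \sum_(k < size s) v 0 k *: (s`_k - \sum_(j < size B) c k j *: B`_j).
  under [RHS]eq_bigr do rewrite scalerBr.
  rewrite sumrB; under eq_bigr do rewrite aE.
  rewrite [X in _ - X](_ : _ = 0) ?subr0 //.
  under eq_bigr do rewrite scaler_sumr.
  rewrite exchange_big big1 //= => j _.
  under eq_bigr do rewrite scalerA.
  rewrite -scaler_suml (_ : \sum_i _ = 0) ?scale0r //.
  by move/rowP: vM => /(_ j); rewrite !mxE => vM; rewrite -[RHS]vM; apply: eq_bigr => i _; rewrite mxE.
by apply: hprime_sum => // i _; apply: hprimeZ.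
Qed.

(** Modulo [J] the multiples of [F] disappear, so the first coefficients vanish; then [F], a form
    outside the prime [I], can be cancelled. *)
Lemma indep_cat I J d e F s t : hprime I -> (forall f, I f -> J f) -> J F -> ~ I F ->
  (forall f g, J f -> J g -> J (f - g)) ->  (forall f g, J g -> J (f * g)) -> 
  F \is e.-homog -> {in t, forall f, f \is d.-homog} ->
  indep J s -> indep I t -> indep I (s ++ map ( *%R F) t).
Proof.
move=> hI sIJ JF nIF JB JM hF ht hs hit c; rewrite size_cat size_map => h.
have E : \sum_(k < size s + size t) c k *: (s ++ map ( *%R F) t)`_k =
   \sum_(k < size s) c k *: s`_k + F * (\sum_(k < size t) c (size s + k)%N *: t`_k).
  rewrite big_split_ord /= big_distrr /=; congr (_ + _); apply: eq_bigr => i _.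
    by rewrite nth_cat ltn_ord.
  by rewrite nth_cat ltnNge leq_addr /= addKn (nth_map 0) // scalerAr.
rewrite E in h.
have c1 k : (k < size s)%N -> c k = 0.
  apply: hs; have := JB _ _ (sIJ _ h) (JM (\sum_(k < size t) c (size s + k)%N *: t`_k) _ JF).
  by rewrite [_ * F]mulrC addrK.
have {}h : I (F * (\sum_(k < size t) c (size s + k)%N *: t`_k)).
  by move: h; rewrite big1 ?add0r // => i _; rewrite c1 ?scale0r.
have c2 k : (k < size t)%N -> c (size s + k)%N = 0.
  apply: (hit (fun k => c (size s + k)%N)).
  suff hT : \sum_(k < size t) c (size s + k)%N *: t`_k \is d.-homog.
    by case: (hprimeP hI hF hT h).
  by apply: rpred_sum => i _; apply/rpredZ/ht/mem_nth.
move=> k hk; case: (ltnP k (size s)) => [|le]; first exact: c1.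
by rewrite -(subnKC le) c2 // ltn_subLR.
Qed.

End Ideals.

Lemma leq_exp_ffact N d : (N.+1 ^ d <= (N + d) ^_ d)%N.
Proof.
elim: d => // d IH; rewrite addnS ffactnS /= expnS leq_mul //; lia.
Qed.

Lemma bin_growth d q C : (forall N, 'C(N + d, d) <= C * N.+1 ^ q)%N -> (d <= q)%N.
Proof.
move=> h; rewrite leqNgt; apply/negP => lt.
(* With this choice [q < d] would give [N.+1 ^ q.+1 <= N * N.+1 ^ q]. *)
pose N := (C * d`!)%N; have := h N.
rewrite -(leq_pmul2r (fact_gt0 d)) bin_ffact => /(leq_trans (leq_exp_ffact N d)).
move=> /(leq_trans (leq_pexp2l (ltn0Sn N) lt)).
by rewrite expnS mulnAC leq_pmul2r ?expn_gt0 // -/N ltnn.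
Qed.

(** * Chains of homogeneous primes and growth of the Hilbert function *)

Section Chain.

Context (n : nat) (K : fieldType) (d E : nat).
Local Notation S := {mpoly K[n]}.
Context (p : nat -> S -> Prop) (F : nat -> S).
Context (p_prime : forall i, (i <= d)%N -> hprime (p i)).
Context (p_sub : forall i, (i < d)%N -> forall f, p i.+1 f -> p i f).
Context (F_homog : forall i, (i <= d)%N -> F i \is E.-homog).
Context (F0 : ~ p 0 (F 0)).
Context (F_in : forall i, (i < d)%N -> p i (F i.+1)).
Context (F_notin : forall i, (i < d)%N -> ~ p i.+1 (F i.+1)).

(** The monomials of degree [N] in the forms [F 0], ..., [F i], listed according to Pascal's
    rule. *)
Fixpoint chain_family (i N : nat) : seq S :=
  if i isn't i'.+1 then [:: F 0 ^+ N] else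
  (fix fam N := if N isn't N'.+1 then chain_family i' 0 else
     chain_family i' N ++ map ( *%R (F i)) (fam N')) N.

Lemma size_chain_family i N : size (chain_family i N) = 'C(N + i, i).
Proof.
elim: i N => [|i IH] N; first by rewrite bin0.
elim: N => [|N IHN]; first by rewrite /= IH add0n !binn.
rewrite -[chain_family _ _]/(chain_family i N.+1 ++ map ( *%R (F i.+1)) (chain_family i.+1 N)).
by rewrite size_cat size_map IH IHN [in RHS]addSn binS addnC addSnnS.
Qed.

Lemma chain_family_homog i N : (i <= d)%N ->
  {in chain_family i N, forall f, f \is (E * N).-homog}.
Proof.
elim: i N => [|i IH] N hi f; first by rewrite inE => /eqP ->; apply/dhomogMn/F_homog.
elim: N f => [|N IHN] f; first by move=> h; apply: IH h; apply: ltnW.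
rewrite -[chain_family _ _]/(chain_family i N.+1 ++ map ( *%R (F i.+1)) (chain_family i.+1 N)).
rewrite mem_cat => /orP[h|/mapP[g /IHN hg ->]]; first by apply: IH h; apply: ltnW.
by rewrite mulnS; apply: dhomogM => //; apply: F_homog.
Qed.

(** Modulo [p i] the form [F i.+1] vanishes, while modulo [p i.+1] it can be cancelled from forms:
    this is the situation of [indep_cat]. *)
Lemma chain_family_indep i N : (i <= d)%N -> indep (p i) (chain_family i N).
Proof.
have p1 : ~ p 0 1.
  by move=> h; apply: F0; rewrite -[F 0]mulr1; apply: hprimeM => //; apply: p_prime.
elim: i N => [|i IH] N hi.
  move=> c /=; rewrite big_ord1 /= => h [|//] _; apply: contrapT => c0; apply: F0.
  apply: (hprime_exp (p_prime hi) (F_homog hi) p1 (k := N)).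
  have := hprimeZ (c 0)^-1 (p_prime hi) h.
  by rewrite scalerA mulVf ?scale1r //; apply/eqP.
elim: N => [|N IHN].
  move=> c h; apply: (IH 0 (ltnW hi)); exact: p_sub h.
have pi := p_prime (ltnW hi).
apply: (indep_cat (J := p i) (d := (E * N)%N) (e := E)) => //.
- exact: p_prime.
- exact: p_sub.
- exact: F_in.
- exact: F_notin.
- by move=> f g; apply: hprimeB.
- exact: hprimeM.
- exact: F_homog.
- exact: (chain_family_homog (i := i.+1)).
- exact/IH/ltnW.
Qed.

End Chain.

(* Krull dimension is bounded by the growth of the Hilbert function. *)
Lemma chain_bound (n : nat) (K : fieldType) (d q C : nat)
    (p : nat -> {mpoly K[n]} -> Prop) (F : nat -> {mpoly K[n]}) (e : nat -> nat) :
  (forall i, (i <= d)%N -> hprime (p i)) ->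
  (forall i, (i < d)%N -> forall f, p i.+1 f -> p i f) ->
  (forall i, (i <= d)%N -> F i \is (e i).-homog) ->
  (forall i, (i <= d)%N -> (0 < e i)%N) ->
  ~ p 0 (F 0) -> (forall i, (i < d)%N -> p i (F i.+1)) ->
  (forall i, (i < d)%N -> ~ p i.+1 (F i.+1)) ->
  (forall N, exists2 B : seq {mpoly K[n]}, (size B <= C * N.+1 ^ q)%N &
     forall f, f \is N.-homog -> spans (p d) B f) ->
  (d <= q)%N.
Proof.
move=> pp ps Fh e0 F0 Fi Fn hB.
(* The separating forms have various degrees; powers bring them all to degree [E], and primality
   keeps these powers outside the primes. *)
pose E := (\prod_(i < d.+1) e i)%N.
have edvd i : (i <= d)%N -> (e i %| E)%N.
  by move=> hi; rewrite /E (bigD1 (Ordinal (hi : (i < d.+1)%N))) //= dvdn_mulr.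
have E0 : (0 < E)%N by rewrite /E prodn_cond_gt0 // => i _; apply: e0; rewrite -ltnS.
pose G i := F i ^+ (E %/ e i).
have q0 i : (i <= d)%N -> (0 < E %/ e i)%N.
  by move=> hi; rewrite divn_gt0 ?e0 // dvdn_leq // edvd.
have Gh i : (i <= d)%N -> G i \is E.-homog.
  by move=> hi; rewrite -[X in X.-homog](divnK (edvd i hi)) mulnC; apply/dhomogMn/Fh.
have p1 i : (i <= d)%N -> ~ p i 1.
  elim: i => [|i IH] hi h; last by apply: IH (ltnW hi) (ps _ hi _ h).
  by apply: F0; rewrite -[F 0]mulr1; apply: hprimeM => //; apply: pp.
have nG i : (i <= d)%N -> ~ p i (F i) -> ~ p i (G i).
  by move=> hi h /(hprime_exp (pp _ hi) (Fh _ hi) (p1 _ hi)).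
have iG i : (i < d)%N -> p i (G i.+1).
  move=> hi; rewrite /G -(prednK (q0 _ hi)) exprSr; apply: hprimeM; first exact/pp/ltnW.
  exact: Fi.
(* The family lives in degree [E * N], and [(E * N).+1 <= E.+1 * N.+1] produces the factor
   [E.+1 ^ q]. *)
apply: (@bin_growth _ _ (C * E.+1 ^ q)) => N.
have [B sB hBs] := hB (E * N)%N.
rewrite -(size_chain_family G).
have := indep_span (pp d (leqnn d)) (B := B) (s := chain_family G d N).
move=> /(_ _ _)/leq_trans; apply.
- apply: (@chain_family_indep n K d E p G pp ps Gh _ iG _ d N (leqnn d)).
    exact: nG.
  by move=> i hi; apply: nG => //; apply: Fn.
- by move=> f hf; apply: hBs; apply: (chain_family_homog Gh (leqnn d) hf).
rewrite (leq_trans sB) // -mulnA -expnMn leq_mul2l; apply/orP; right.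
by case: (q) => // q'; rewrite leq_exp2r //; nia.
Qed.

Lemma submnm_deg n (m : 'X_{1..n}) k : (k <= mdeg m)%N ->
  exists2 m' : 'X_{1..n}, (m' <= m)%MM & mdeg m' = k.
Proof.
elim: k => [|k IH] hk; first by exists 0%MM; rewrite ?mdeg0 //; apply/mnm_lepP => i; rewrite mnm0E.
have [m' le e] := IH (ltnW hk).
have [i hi] : exists i, (m' i < m i)%N.
  apply: contrapT => /forallNP h.
  have /eqP : mdeg m = mdeg m'.
    rewrite !mdegE; apply: eq_bigr => i _; apply/eqP; rewrite eqn_leq.
    by rewrite (mnm_lepP le) andbT leqNgt; apply/negP.
  by rewrite e gtn_eqF.
exists (m' + U_(i))%MM; last by rewrite mdegD mdeg1 e addn1.
apply/mnm_lepP => j; rewrite mnmDE mnm1E; case: eqP => [<-|_]; first by rewrite addn1.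
by rewrite addn0 (mnm_lepP le).
Qed.

(* Few factors of a product already have [k] of their total weight. *)
Lemma submnm_wgt n (w : 'I_n -> nat) (m : 'X_{1..n}) k : (k <= wgt w m)%N ->
  exists m' : 'X_{1..n}, [/\ (m' <= m)%MM, (mdeg m' <= k)%N & (k <= wgt w m')%N].
Proof.
elim: k => [|k IH] hk; first by exists 0%MM; rewrite ?mdeg0 //; split=> //; apply/mnm_lepP => i; rewrite mnm0E.
have [m' [le e ge]] := IH (ltnW hk).
case: (ltnP k (wgt w m')) => [lt|ge']; first by exists m'; split => //; apply: leqW.
have [i hi w0] : exists2 i, (m' i < m i)%N & (0 < w i)%N.
  apply: contrapT => h.
  suff /eqP : wgt w m = wgt w m' by rewrite gtn_eqF // (leq_ltn_trans ge').
  apply: eq_bigr => i _; case: (posnP (w i)) => [->|wi]; first by rewrite !muln0.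
  congr (_ * _)%N; apply/eqP; rewrite eqn_leq (mnm_lepP le) andbT leqNgt.
  by apply/negP => hi; apply: h; exists i.
exists (m' + U_(i))%MM; split.
- apply/mnm_lepP => j; rewrite mnmDE mnm1E; case: eqP => [<-|_]; first by rewrite addn1.
  by rewrite addn0 (mnm_lepP le).
- by rewrite mdegD mdeg1 addn1.
- by rewrite wgtD wgtU -addn1 leq_add.
Qed.

Lemma mcoeff_pihomog n (K : idomainType) (mf : measure n) d (p : {mpoly K[n]}) m :
  (pihomog mf d p)@_m = if mf m == d then p@_m else 0.
Proof.
elim/mpolyind: p => [|c m' p _ _ IH]; first by rewrite linear0 mcoeff0 if_same.
rewrite linearP /= !mcoeffD !mcoeffZ IH pihomogX.
case: (eqVneq m' m) => [->|ne]; first by case: ifP; rewrite ?mcoeff0 ?mulr0 ?addr0.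
rewrite (_ : (if _ then 'X_[m'] else 0)@_m = 0) ?mcoeffX ?(negbTE ne) ?mulr0 ?add0r //.
by case: ifP; rewrite ?mcoeff0 // mcoeffX (negbTE ne).
Qed.

Local Notation o0 := (@Ordinal 4 0 isT).
Local Notation o1 := (@Ordinal 4 1 isT).
Local Notation o2 := (@Ordinal 4 2 isT).
Local Notation o3 := (@Ordinal 4 3 isT).

Lemma big_ord4 (f : 'I_4 -> nat) : (\sum_(i < 4) f i = f o0 + f o1 + f o2 + f o3)%N.
Proof.
rewrite !big_ord_recl big_ord0 addn0 !addnA.
by congr (f _ + f _ + f _ + f _)%N; apply/val_inj.
Qed.

Lemma ord4_case (i : 'I_4) : [\/ i = o0, i = o1, i = o2 | i = o3].
Proof.
case: i => [[|[|[|[|//]]]] h]; [apply: Or41|apply: Or42|apply: Or43|apply: Or44]; exact/val_inj.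
Qed.

Lemma split_lshift m n (i : 'I_m) : split (lshift n i) = inl i.
Proof. exact: (unsplitK (inl _ i)). Qed.

Lemma split_rshift m n (i : 'I_n) : split (rshift m i) = inr i.
Proof. exact: (unsplitK (inr _ i)). Qed.

(** * The toric ideal *)

Section Veronese.

Context (r : nat).
Local Notation MS := 'X_{1..39 + r}.
Local Notation MQ := 'X_{1..4 + r}.
Implicit Types (u v : MS) (m : MQ).

Definition xq (i : 'I_4) : 'I_(4 + r) := lshift r i.
Definition tq (k : 'I_r) : 'I_(4 + r) := rshift 4 k.

Definition lift4 (m : 'X_{1..4}) : MQ :=
  [multinom if split i is inl j then m j else 0%N | i < 4 + r].

(* The monomials of weighted degree 6 in [x_0, ..., x_3, T_1, ..., T_r], where
   the [T_k] have weight 6. *)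
Definition gen (i : 'I_(39 + r)) : MQ :=
  match split i with inl a => lift4 (tnth wmon6 a) | inr k => U_(tq k)%MM end.

(** The effect on exponents of the monomial parametrization: two exponents with the same image form
    a binomial of the toric ideal. *)
Definition pim (u : MS) : MQ := (\sum_i gen i *+ u i)%MM.

Definition tS (i : 'I_(39 + r)) : nat := if split i is inr _ then 1%N else 0%N.
Definition tQ (i : 'I_(4 + r)) : nat := if split i is inr _ then 1%N else 0%N.
Definition w6 (i : 'I_(4 + r)) : nat := if split i is inl j then w3111 j else 6%N.

Lemma lift4_x (m : 'X_{1..4}) i : lift4 m (xq i) = m i.
Proof. by rewrite mnmE split_lshift. Qed.

Lemma lift4_t (m : 'X_{1..4}) k : lift4 m (tq k) = 0%N.
Proof. by rewrite mnmE split_rshift. Qed.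

Lemma tQ_x i : tQ (xq i) = 0%N. Proof. by rewrite /tQ split_lshift. Qed.
Lemma tQ_t k : tQ (tq k) = 1%N. Proof. by rewrite /tQ split_rshift. Qed.
Lemma w6_x i : w6 (xq i) = w3111 i. Proof. by rewrite /w6 split_lshift. Qed.
Lemma w6_t k : w6 (tq k) = 6%N. Proof. by rewrite /w6 split_rshift. Qed.

Lemma mnmQP m m' : (forall i, m (xq i) = m' (xq i)) -> (forall k, m (tq k) = m' (tq k)) -> m = m'.
Proof.
move=> hx ht; apply/mnmP => i; case: (split_ordP i) => j ->; [exact: hx|exact: ht].
Qed.

Lemma tQE m : wgt tQ m = (\sum_k m (tq k))%N.
Proof.
rewrite /wgt big_split_ord /= big1 ?add0n => [|i _]; last by rewrite tQ_x muln0.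
by apply: eq_bigr => k _; rewrite tQ_t muln1.
Qed.

Lemma w6E m : wgt w6 m =
  (3 * m (xq o0) + m (xq o1) + m (xq o2) + m (xq o3) + 6 * wgt tQ m)%N.
Proof.
rewrite /wgt !big_split_ord /= -/(wgt tQ m) big_ord4 ![(\sum_(i < 4) _)%N]big_ord4.
rewrite !w6_x !tQ_x !muln0 !add0n /w3111 /= !muln1 mulnC; congr (_ + _)%N.
by rewrite big_distrr; apply: eq_bigr => k _; rewrite w6_t tQ_t muln1 mulnC.
Qed.

Lemma wdeg_wmon6 a : wdeg w3111 (tnth wmon6 a) = 6%N.
Proof. by apply/eqP; rewrite -mem_wmonomials (mem_tnth a wmon6). Qed.

Lemma wgt_lift4 (m : 'X_{1..4}) : wgt w6 (lift4 m) = wdeg w3111 m.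
Proof.
rewrite /wgt /wdeg big_split_ord /= [X in (_ + X)%N]big1 ?addn0.
  by apply: eq_bigr => i _; rewrite lift4_x w6_x.
by move=> k _; rewrite lift4_t.
Qed.

Lemma wgt_gen i : wgt w6 (gen i) = 6%N.
Proof.
rewrite /gen; case: split => [a|k]; first by rewrite wgt_lift4 wdeg_wmon6.
by rewrite wgtU w6_t.
Qed.

Lemma tS_gen i : wgt tQ (gen i) = tS i.
Proof.
rewrite /gen /tS; case: split => [a|k]; last by rewrite wgtU tQ_t.
by rewrite tQE big1 // => k _; rewrite lift4_t.
Qed.

Lemma w6_gt0 i : (0 < w6 i)%N.
Proof. by rewrite /w6; case: split => // j; exact: w3111_gt0. Qed.

Lemma w6_eq0 m : wgt w6 m = 0%N -> m = 0%MM.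
Proof.
move=> h; apply/mnmP => i; apply/eqP; rewrite mnm0E -leqn0; apply: leq_trans (eq_leq h).
rewrite /wgt (bigD1 i) //=; apply: leq_trans (leq_addr _ _); by rewrite leq_pmulr ?w6_gt0.
Qed.

Lemma gen_surj m : wgt w6 m = 6%N -> exists i, gen i = m.
Proof.
move=> hm; case: (posnP (wgt tQ m)) => [m0|m_gt0].
  have mt k : m (tq k) = 0%N.
    by move/eqP: m0; rewrite tQE sum_nat_eq0 => /forallP /(_ k) /eqP.
  pose m4 : 'X_{1..4} := [multinom m (xq i) | i < 4].
  have em : lift4 m4 = m.
    by apply: mnmQP => j; rewrite ?lift4_x ?lift4_t ?mnmE // mt.
  have : m4 \in wmon6 by rewrite mem_wmonomials -wgt_lift4 em hm.
  move=> /tnthP[a ea]; exists (lshift r a).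
  by rewrite /gen split_lshift -ea em.
have [k hk] : exists k, (0 < m (tq k))%N.
  apply: contrapT => /forallNP h; move: m_gt0; rewrite tQE big1 // => k _.
  by apply/eqP; rewrite -leqn0 leqNgt; apply/negP.
exists (rshift 39 k); rewrite /gen split_rshift.
have le : (U_(tq k) <= m)%MM by rewrite lep1mP -lt0n.
have := hm; rewrite -(submK le) wgtD wgtU w6_t => /(canRL (addnK _)); rewrite subnn.
by move=> /w6_eq0 ->; rewrite add0m.
Qed.

Lemma pimD u v : pim (u + v)%MM = (pim u + pim v)%MM.
Proof.
apply/mnmP => i; rewrite mnmDE !mnm_sumE -big_split /=.
by apply: eq_bigr => j _; rewrite !mulmnE mnmDE mulnDr.
Qed.

Lemma pim0 : pim 0%MM = 0%MM.
Proof. by apply/mnmP => i; rewrite mnm_sumE mnm0E big1 // => j _; rewrite mulmnE mnm0E muln0. Qed.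

Lemma pimU i : pim U_(i)%MM = gen i.
Proof.
apply/mnmP => j; rewrite mnm_sumE (bigD1 i) //= mulmnE mnm1E eqxx muln1.
by rewrite big1 ?addn0 // => k hk; rewrite mulmnE mnm1E eq_sym (negbTE hk) muln0.
Qed.

Lemma pimMn u k : pim (u *+ k)%MM = (pim u *+ k)%MM.
Proof. by elim: k => [|k IH]; rewrite ?mulm0n ?pim0 // !mulmS pimD IH. Qed.

Lemma pim_sum (T : Type) (s : seq T) (F : T -> MS) :
  pim (\sum_(i <- s) F i)%MM = (\sum_(i <- s) pim (F i))%MM.
Proof. by apply: (big_morph pim); [exact: pimD|exact: pim0]. Qed.

Lemma pimE u i : pim u i = wgt (fun j => gen j i) u.
Proof. by rewrite mnm_sumE; apply: eq_bigr => j _; rewrite mulmnE mulnC. Qed.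

Lemma wgt_pim w u : wgt w (pim u) = wgt (fun i => wgt w (gen i)) u.
Proof.
rewrite /wgt; under eq_bigr do rewrite pimE /wgt big_distrl.
rewrite exchange_big; apply: eq_bigr => j _; rewrite big_distrr /=.
by apply: eq_bigr => i _; rewrite mulnA.
Qed.

Lemma w6_pim u : wgt w6 (pim u) = (6 * mdeg u)%N.
Proof.
rewrite wgt_pim mdegE big_distrr; apply: eq_bigr => i _ /=.
by rewrite wgt_gen mulnC.
Qed.

Lemma tQ_pim u : wgt tQ (pim u) = wgt tS u.
Proof. by rewrite wgt_pim; apply: eq_bigr => i _; rewrite tS_gen. Qed.

Lemma pim_mdeg u v : pim u = pim v -> mdeg u = mdeg v.
Proof. by move=> /(congr1 (wgt w6)); rewrite !w6_pim => /eqP; rewrite eqn_pmul2l // => /eqP. Qed.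

Lemma pim_tS u v : pim u = pim v -> wgt tS u = wgt tS v.
Proof. by rewrite -!tQ_pim => ->. Qed.

(** A [T_k] dividing [m] will do. Otherwise the exponent of [x_0] decides between [x_0 ^ 2], [x_0]
    times a cubic monomial, and a sextic monomial in [x_1, x_2, x_3]. *)
Lemma subgen m n : wgt w6 m = (6 * n.+1)%N -> exists i, (gen i <= m)%MM.
Proof.
move=> hm; suff [m' le h6] : exists2 m' : MQ, (m' <= m)%MM & wgt w6 m' = 6%N.
  by have [i e] := gen_surj h6; exists i; rewrite e.
case: (posnP (wgt tQ m)) => [m0|m_gt0]; last first.
  have [k hk] : exists k, (0 < m (tq k))%N.
    apply: contrapT => /forallNP h; move: m_gt0; rewrite tQE big1 // => k _.
    by apply/eqP; rewrite -leqn0 leqNgt; apply/negP.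
  by exists U_(tq k)%MM; rewrite ?wgtU ?w6_t // lep1mP -lt0n.
move: hm; rewrite w6E m0 muln0 addn0 => hm.
have fill k : (k <= m (xq o1) + m (xq o2) + m (xq o3))%N ->
   exists m' : MQ, [/\ (m' <= m)%MM, m' (xq o0) = 0%N & wgt w6 m' = k].
  pose mm : MQ := lift4 [multinom if i == o0 then 0%N else m (xq i) | i < 4].
  have dE : mdeg mm = (m (xq o1) + m (xq o2) + m (xq o3))%N.
    rewrite mdegE big_split_ord /= [X in (_ + X)%N]big1 ?addn0.
      by rewrite big_ord4 -![lshift _ _]/(xq _) !lift4_x !mnmE.
    by move=> k' _; rewrite lift4_t.
  rewrite -dE => /submnm_deg[m' le e].
  have m'0 : m' (xq o0) = 0%N.
    by apply/eqP; rewrite -leqn0 (leq_trans (mnm_lepP le _)) // lift4_x mnmE.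
  have m't k' : m' (tq k') = 0%N.
    by apply/eqP; rewrite -leqn0 (leq_trans (mnm_lepP le _)) // lift4_t.
  exists m'; split=> //.
    apply/mnm_lepP => i; apply: leq_trans (mnm_lepP le i) _.
    case: (split_ordP i) => j ->; last by rewrite lift4_t.
    by rewrite lift4_x mnmE; case: eqP.
  rewrite w6E m'0 add0n tQE [(\sum_k _)%N]big1 // muln0 addn0 -e mdegE big_split_ord /=.
  rewrite [X in _ = (_ + X)%N]big1 // addn0 big_ord4 -![lshift _ _]/(xq _).
  by rewrite m'0.
case: (leqP 2 (m (xq o0))) => h0.
  exists (U_(xq o0) *+ 2)%MM; last by rewrite wgtMn wgtU w6_x.
  apply/mnm_lepP => i; rewrite mulmnE mnm1E; case: eqP => [<-|_]; rewrite ?mul0n //.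
case: (posnP (m (xq o0))) => h1.
  have [|m' [le _ e]] := fill 6%N; first by lia.
  by exists m'.
have [|m' [le z e]] := fill 3%N; first by lia.
exists (m' + U_(xq o0))%MM; last by rewrite wgtD wgtU w6_x e.
apply/mnm_lepP => i; rewrite mnmDE mnm1E; case: eqP => [<-|_]; first by rewrite z.
by rewrite addn0 (mnm_lepP le).
Qed.

(** Projective normality of the anticanonical embedding, at the level of monomials. *)
Lemma pim_surj m n : wgt w6 m = (6 * n)%N -> exists2 u, pim u = m & mdeg u = n.
Proof.
elim: n m => [|n IH] m hm.
  exists 0%MM; last by rewrite mdeg0.
  by rewrite pim0 (w6_eq0 (m := m)) // hm muln0.
have [i le] := subgen hm.
have [|u eu du] := IH (m - gen i)%MM.
  apply/eqP; rewrite -(eqn_add2r 6) -{1}(wgt_gen i) -wgtD submK // hm; apply/eqP; lia.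
by exists (u + U_(i))%MM; rewrite ?pimD ?eu ?pimU ?submK // mdegD mdeg1 du addn1.
Qed.

Definition pw6 (i : 'I_4) : MQ := (U_(xq i) *+ (6 %/ w3111 i))%MM.

Lemma w6_pw6 i : wgt w6 (pw6 i) = 6%N.
Proof. by rewrite /pw6 wgtMn wgtU w6_x /w3111; case: ifP. Qed.

Lemma tQ_pw6 i : wgt tQ (pw6 i) = 0%N.
Proof. by rewrite /pw6 wgtMn wgtU tQ_x muln0. Qed.

Lemma pw6_le i m : (pw6 i <= m)%MM = (6 %/ w3111 i <= m (xq i))%N.
Proof.
apply/mnm_lepP/idP => [/(_ (xq i))|h j]; first by rewrite /pw6 mulmnE mnm1E eqxx mul1n.
by rewrite /pw6 mulmnE mnm1E; case: eqP => [<-|_]; rewrite ?mul1n ?mul0n.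
Qed.

(** Without such a divisor the exponents are at most 1, 5, 5, 5, so that the weight is at most
    [3 + 5 + 5 + 5]. *)
Lemma pw6_pigeon m : wgt tQ m = 0%N -> (18 < wgt w6 m)%N -> exists i, (pw6 i <= m)%MM.
Proof.
move=> m0; rewrite w6E m0 muln0 addn0 => h; apply: contrapT => /forallNP hn.
have := hn o0; have := hn o1; have := hn o2; have := hn o3; rewrite !pw6_le /w3111 /=.
rewrite !divn1 -[(6 %/ 3)%N]/2%N; lia.
Qed.

End Veronese.

Lemma mnm_ind n (P : 'X_{1..n} -> Prop) : P 0%MM -> (forall i, P U_(i)%MM) ->
  (forall u v, P u -> P v -> P (u + v)%MM) -> forall u, P u.
Proof.
move=> P0 P1 PD u; rewrite [u]multinomUE_id; apply: (big_ind P) => // i _.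
by elim: (u i) => [|k IH]; rewrite ?mulm0n // mulmS; apply: PD.
Qed.

(** * Parametrized cones, and binomials that lift to the ideal of [Y] *)

Section Extension.

Context (r : nat) (K : closedFieldType).
Local Notation S := {mpoly K[39 + r]}.
Local Notation Q := {mpoly K[4 + r]}.
Local Notation MS := 'X_{1..39 + r}.
Local Notation MQ := 'X_{1..4 + r}.
Implicit Types (u v k : MS) (m : MQ) (f g G H : S) (p q : Q) (c : 'I_39 -> 'I_r -> K).
Local Notation tS := (@tS r).
Local Notation tQ := (@tQ r).
Local Notation w6 := (@w6 r).
Local Notation gen := (@gen r).

Definition ell c (i : 'I_(39 + r)) : Q :=
  if split i is inl a then \sum_k c a k *: 'X_(tq k) else 0.

(* Parametrizes the cone over [X] with vertex the graph of [c]. *)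
Definition Phi c : S -> Q := comp_mpoly [tuple 'X_[gen i] + ell c i | i < 39 + r].

Definition mono : S -> Q := Phi (fun _ _ => 0).

HB.instance Definition _ c := GRing.RMorphism.copy (Phi c)
  (comp_mpoly [tuple 'X_[gen i] + ell c i | i < 39 + r]).
HB.instance Definition _ c := GRing.Linear.copy (Phi c)
  (comp_mpoly [tuple 'X_[gen i] + ell c i | i < 39 + r]).
HB.instance Definition _ := GRing.RMorphism.copy mono (Phi (fun _ _ => 0)).
HB.instance Definition _ := GRing.Linear.copy mono (Phi (fun _ _ => 0)).

Lemma PhiZ c a f : Phi c (a *: f) = a *: Phi c f.
Proof. exact: comp_mpolyZ. Qed.

Lemma monoZ a f : mono (a *: f) = a *: mono f.
Proof. exact: comp_mpolyZ. Qed.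

Lemma PhiXU c i : Phi c 'X_i = 'X_[gen i] + ell c i.
Proof. by rewrite /Phi comp_mpolyXU -tnth_nth tnth_mktuple. Qed.

Lemma ell0 i : ell (fun _ _ => 0) i = 0.
Proof.
rewrite /ell; case: split => // a; rewrite big1 // => k _; exact: scale0r.
Qed.

Lemma ordge_ell c i : ordge tQ 1 (ell c i).
Proof.
rewrite /ell; case: split => [a|k]; last exact: ordge_0.
by apply: ordge_sum => k _; apply: ordgeZ; have := @ordgeX _ K tQ U_(tq k)%MM; rewrite wgtU tQ_t.
Qed.

Lemma monoX u : mono 'X_[u] = 'X_[pim u].
Proof.
elim/mnm_ind: u => [|i|u v IHu IHv]; first by rewrite pim0 !mpolyX0 rmorph1.
  by rewrite /mono PhiXU ell0 addr0 pimU.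
by rewrite pimD !mpolyXD rmorphM /= IHu IHv.
Qed.

Lemma PhiE c f : Phi c f = \sum_(u <- msupp f) f@_u *: Phi c 'X_[u].
Proof.
rewrite {1}[f]mpolyE (linear_sum (Phi c)); apply: eq_bigr => u _.
exact: (linearZ_LR (Phi c)).
Qed.

Lemma monoE f : mono f = \sum_(u <- msupp f) f@_u *: 'X_[pim u].
Proof. by rewrite /mono PhiE; apply: eq_bigr => u _; rewrite -/mono monoX. Qed.

(** Each factor ['X_[gen i]] is perturbed only by terms with one more [T]; thus [mono] gives the
    initial form for every [c]. *)
Lemma PhiX_ord c u : ordge tQ (wgt tS u).+1 (Phi c 'X_[u] - 'X_[pim u]).
Proof.
elim/mnm_ind: u => [|i|u v IHu IHv].
- by rewrite pim0 !mpolyX0 rmorph1 subrr; apply: ordge_0.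
- rewrite PhiXU pimU wgtU addrC addKr; rewrite /ell /tS; case: split => [a|k]; last exact: ordge_0.
  apply: ordge_sum => k _; apply: ordgeZ.
  by have := @ordgeX _ K tQ U_(tq k)%MM; rewrite wgtU tQ_t.
rewrite pimD !mpolyXD rmorphM /= wgtD.
have -> : Phi c 'X_[u] * Phi c 'X_[v] - 'X_[pim u] * 'X_[pim v] =
  (Phi c 'X_[u] - 'X_[pim u] + 'X_[pim u]) * (Phi c 'X_[v] - 'X_[pim v]) +
  (Phi c 'X_[u] - 'X_[pim u]) * 'X_[pim v] by ring.
have hX w : ordge tQ (wgt tS w) ('X_[pim w] : Q) by rewrite -tQ_pim; apply: ordgeX.
apply: ordgeD; last by rewrite -addSn; apply: ordgeM.
rewrite -addnS; apply: ordgeM => //; apply: ordgeD => //; exact: ordgeW IHu.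
Qed.

Lemma Phi_ord1 c s f : ordge tS s f -> ordge tQ s.+1 (Phi c f - mono f).
Proof.
move=> hf; rewrite PhiE monoE -sumrB big_seq.
apply: ordge_sum => u; rewrite mcoeff_msupp => hu.
rewrite -scalerBr /=; apply: ordgeZ.
apply: (@ordgeW _ _ _ (wgt tS u).+1); last exact: PhiX_ord.
by rewrite ltnS leqNgt; apply: contraNN hu => /hf/eqP.
Qed.

Lemma mono_ord s f : ordge tS s f -> ordge tQ s (mono f).
Proof.
move=> hf; rewrite monoE big_seq.
apply: ordge_sum => u; rewrite mcoeff_msupp => hu; apply: ordgeZ.
apply: (@ordgeW _ _ _ (wgt tS u)); last by rewrite -tQ_pim; apply: ordgeX.
by rewrite leqNgt; apply: contraNN hu => /hf/eqP.
Qed.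

Lemma Phi_ord c s f : ordge tS s f -> ordge tQ s (Phi c f).
Proof.
move=> hf; rewrite -(subrK (mono f) (Phi c f)); apply: ordgeD (mono_ord hf).
exact: ordgeW (Phi_ord1 c hf).
Qed.

Lemma Phi_homog c d f : f \is d.-homog -> Phi c f \is (6 * d).-homog for (wgt w6).
Proof.
move=> /dhomogP hf; rewrite PhiE big_seq.
apply: rpred_sum => u /hf hu; have <- : mdeg u = d := hu; apply: rpredZ => {hu}.
elim/mnm_ind: u => [|i|u v IHu IHv].
- by rewrite mpolyX0 rmorph1 mdeg0; apply: dhomog1.
- rewrite PhiXU mdeg1; apply: rpredD; first by rewrite dhomogX /= wgt_gen.
  rewrite /ell; case: split => [a|k]; last exact: rpred0.
  by apply: rpred_sum => k _; apply: rpredZ; rewrite dhomogX /= wgtU w6_t.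
by rewrite mpolyXD rmorphM mdegD mulnDr; apply: dhomogM.
Qed.

Lemma mcoeff_mono f m : (mono f)@_m = \sum_(u <- msupp f | pim u == m) f@_u.
Proof.
rewrite monoE raddf_sum [RHS]big_mkcond /=; apply: eq_bigr => u _.
rewrite mcoeffZ mcoeffX.
by case: eqP; rewrite ?mulr1 ?mulr0.
Qed.

(* [I] is the ideal of [Y] in coordinates where [X = Y :&: {t = 0}]; [si_spec]
   and [si_sat] express this equality, [si_dim] that [dim Y = 3 + r]. *)
Record section_ideal (I : S -> Prop) : Prop := SectionIdeal {
  si_prime :> hprime I;
  si_homog : forall d f, I f -> I (pihomog mdeg d f);
  si_spec : forall f, I f -> ordge tQ 1 (mono f);
  si_sat : forall u v, wgt tS u = 0%N -> pim u = pim v ->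
    exists n, forall k, wgt tS k = 0%N -> mdeg k = n ->
      exists2 H, I H & ordge tS 1 (H - 'X_[k] * ('X_[u] - 'X_[v]));
  si_dim : forall (q C : nat), (forall N, exists2 B : seq S, (size B <= C * N.+1 ^ q)%N &
     forall f, f \is N.-homog -> spans I B f) -> (3 + r <= q)%N
}.

Section Ideal.

Context (I : S -> Prop) (hI : section_ideal I).

(** The equality with [X] being one of saturations, this can be expected only in large degree. *)
Definition liftable u v : Prop :=
  exists H, [/\ I H, H \is (mdeg u).-homog & ordge tS 1 (H - ('X_[u] - 'X_[v]))].

Lemma liftable_trans v u w : pim u = pim v -> liftable u v -> liftable v w -> liftable u w.
Proof.
move=> e [H [h1 h2 h3]] [H' [h1' h2' h3']]; exists (H + H'); split.
- exact: hprimeD hI _ _ h1 h1'.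
- by apply: rpredD => //; rewrite (pim_mdeg e).
- have -> : H + H' - ('X_[u] - 'X_[w]) =
     (H - ('X_[u] - 'X_[v])) + (H' - ('X_[v] - 'X_[w])) by ring.
  exact: ordgeD.
Qed.

Lemma liftable_sym u v : pim u = pim v -> liftable u v -> liftable v u.
Proof.
move=> e [H [h1 h2 h3]]; exists (- H); split.
- exact: (hprimeN hI).
- by rewrite rpredN -(pim_mdeg e).
- by rewrite (_ : - H - _ = - (H - ('X_[u] - 'X_[v]))); [exact: ordgeN|ring].
Qed.

Lemma liftable_shift k u v : liftable u v -> liftable (k + u)%MM (k + v)%MM.
Proof.
move=> [H [h1 h2 h3]]; exists ('X_[k] * H); split.
- exact: (hprimeM hI).
- by rewrite mdegD; apply: dhomogM; rewrite ?dhomogX.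
- by rewrite !mpolyXD -!mulrBr; apply: ordgeMl.
Qed.

(** A monomial of degree at least [n] has a divisor of degree [n], and the component of the right
    degree of a lift is again a lift. *)
Lemma si_liftable u v : wgt tS u = 0%N -> pim u = pim v ->
  exists n, forall k, wgt tS k = 0%N -> (n <= mdeg k)%N -> liftable (k + u)%MM (k + v)%MM.
Proof.
move=> hu e; have [n hn] := si_sat hI hu e; exists n => k hk /submnm_deg[k' le dk'].
have hk' : wgt tS k' = 0%N by exact: wgt_le0 le hk.
rewrite -(submK le) -!addmA; apply: liftable_shift.
have [H hH ho] := hn k' hk' dk'; exists (pihomog mdeg (mdeg (k' + u)) H).
split; [exact: si_homog|exact: pihomogP|].
move=> m hm; have := ho m hm; rewrite !mpolyXD -!mulrBr !mcoeffB mcoeff_pihomog.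
case: eqP => // ne _; rewrite sub0r (_ : _@_m = 0) ?oppr0 //.
apply: (dhomog_nemf_coeff (d := mdeg (k' + u)%MM) (mf := mdeg)); last by apply/eqP.
rewrite mulrBr -!mpolyXD; apply: rpredB; rewrite dhomogX //=.
by rewrite !mdegD (pim_mdeg e).
Qed.

Lemma pw6_gen i : exists2 z : 'I_(39 + r), gen z = pw6 r i & tS z = 0%N.
Proof.
have [z ez] := gen_surj (w6_pw6 r i); exists z => //.
by rewrite -tS_gen ez tQ_pw6.
Qed.

(* Uniform in [u] and [v] because the toric ideal of [X] is generated by binomials
   of degree at most 6. *)
Lemma lift_large : exists n, forall u v,
  wgt tS u = 0%N -> pim u = pim v -> (n <= mdeg u)%N -> liftable u v.
Proof.
(* Only finitely many binomials have degree at most 6, so their bounds have a maximum. *)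
have /fin_all_exists[n0 hn0] (uv : bmultinom (39 + r) 7 * bmultinom (39 + r) 7) : exists n, wgt tS (bmnm uv.1) = 0%N -> pim (bmnm uv.1) = pim (bmnm uv.2) ->
    forall k, wgt tS k = 0%N -> (n <= mdeg k)%N -> liftable (k + (bmnm uv.1))%MM (k + (bmnm uv.2))%MM.
  case: (pselect (wgt tS (bmnm uv.1) = 0%N /\ pim (bmnm uv.1) = pim (bmnm uv.2))) => [[h1 h2]|hn].
    by have [n hn] := si_liftable h1 h2; exists n.
  by exists 0%N => h1 h2; case: hn.
pose n := (\max_uv n0 uv)%N.
have small k u v : wgt tS u = 0%N -> pim u = pim v -> (mdeg u <= 6)%N -> wgt tS k = 0%N ->
    (n <= mdeg k)%N -> liftable (k + u)%MM (k + v)%MM.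
  move=> hu e du hk dk.
  have lu : (mdeg u < 7)%N by [].
  have lv : (mdeg v < 7)%N by rewrite -(pim_mdeg e).
  apply: (hn0 (BMultinom lu, BMultinom lv)) => //; apply: leq_trans dk.
  exact: (leq_bigmax (F := n0)).
(* At most six factors of [u] already account for the pure power [pw6 r i]; a binomial of degree at
   most 6 exchanges them for a monomial containing [z]. *)
have reduce k u i z : wgt tS u = 0%N -> wgt tS k = 0%N -> (n + 6 <= mdeg k + mdeg u)%N ->
    gen z = pw6 r i -> tS z = 0%N -> (pw6 r i <= pim u)%MM ->
    exists u', [/\ wgt tS u' = 0%N, pim (U_(z) + u')%MM = pim u & liftable (k + u)%MM (k + (U_(z) + u'))%MM].
  move=> hu hk hd ez tz; rewrite pw6_le pimE => /submnm_wgt[u1 [le d1 g1]].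
  have d1' : (mdeg u1 <= 6)%N by apply: leq_trans d1 _; exact: leq_div.
  have t1 : wgt tS u1 = 0%N by exact: wgt_le0 le hu.
  rewrite -pimE -pw6_le in g1.
  have [|u2 e2 d2] := @pim_surj r (pim u1 - pw6 r i)%MM (mdeg u1).-1.
    have := congr1 (wgt w6) (submK g1); rewrite wgtD w6_pw6 w6_pim; lia.
  have e12 : pim u1 = pim (U_(z) + u2)%MM by rewrite pimD pimU ez e2 addmC submK.
  have t2 : wgt tS u2 = 0%N.
    by have := pim_tS e12; rewrite t1 wgtD wgtU tz add0n => <-.
  exists (u2 + (u - u1))%MM; split.
  - by rewrite wgtD t2; exact: wgt_le0 (lem_subr _ _) hu.
  - by rewrite addmA pimD -e12 -pimD addmC submK.
  - have -> : (k + u)%MM = (k + (u - u1) + u1)%MM by rewrite -addmA submK.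
    have -> : (k + (U_(z) + (u2 + (u - u1))) = k + (u - u1) + (U_(z) + u2))%MM.
      by apply/mnmP => j; rewrite !mnmDE; lia.
    apply: small => //.
      by rewrite wgtD hk; exact: wgt_le0 (lem_subr _ _) hu.
    by have := congr1 mdeg (submK le); rewrite !mdegD; lia.
(* Above degree 6 the weight is at least 42, so [pw6_pigeon] applies. Once both sides contain the
   same [z], it moves into [k] and the degree drops. *)
have large N k u v : (mdeg u <= N)%N -> wgt tS u = 0%N -> wgt tS k = 0%N -> pim u = pim v ->
    (n + 6 <= mdeg k + mdeg u)%N -> liftable (k + u)%MM (k + v)%MM.
  elim: N k u v => [|N IH] k u v dN hu hk e hd; first by apply: small => //; lia.
  case: (leqP (mdeg u) 6) => du; first by apply: small => //; lia.
  have [i hi] : exists i, (pw6 r i <= pim u)%MM.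
    by apply: pw6_pigeon; rewrite ?tQ_pim ?w6_pim //; lia.
  have [z ez tz] := pw6_gen i.
  have [u' [tu' eu' lu']] := reduce k u i z hu hk hd ez tz hi.
  have hv : wgt tS v = 0%N by rewrite -(pim_tS e).
  have [||v' [tv' ev' lv']] := reduce k v i z hv hk _ ez tz; [by rewrite -(pim_mdeg e)|by rewrite -e|].
  have addk a b : pim a = pim b -> pim (k + a)%MM = pim (k + b)%MM by rewrite !pimD => ->.
  apply: (liftable_trans _ lu'); first exact/addk.
  have euv : pim (U_(z) + u')%MM = pim (U_(z) + v')%MM by rewrite eu' ev' e.
  apply: (liftable_trans _ _ (liftable_sym _ lv')); first exact/addk.
    rewrite !addmA; apply: IH => //.
    - by have := pim_mdeg eu'; rewrite mdegD mdeg1; lia.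
    - by rewrite wgtD wgtU tz hk.
    - by move: euv; rewrite !pimD => /addmI.
    - by have := pim_mdeg eu'; rewrite !mdegD mdeg1; lia.
  exact/addk.
exists (n + 6)%N => u v hu e du.
have := @large (mdeg u) 0%MM u v (leqnn _) hu (wgt0 _) e.
by rewrite !add0m mdeg0; apply.
Qed.

End Ideal.
End Extension.

Section Parts.

Context (r : nat).
Local Notation MS := 'X_{1..39 + r}.
Implicit Types (u v : MS).
Local Notation tS := (@tS r).

Lemma tS_y a : tS (lshift r a) = 0%N. Proof. by rewrite /tS split_lshift. Qed.
Lemma tS_t k : tS (rshift 39 k) = 1%N. Proof. by rewrite /tS split_rshift. Qed.

Definition tpart u : MS := [multinom (tS i * u i)%N | i < 39 + r].
Definition ypart u : MS := [multinom ((1 - tS i) * u i)%N | i < 39 + r].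

Lemma tS_le1 i : (tS i <= 1)%N.
Proof. by rewrite /tS; case: split. Qed.

Lemma partK u : (tpart u + ypart u)%MM = u.
Proof. by apply/mnmP => i; rewrite mnmDE !mnmE -mulnDl subnKC ?tS_le1 // mul1n. Qed.

Lemma mdeg_tpart u : mdeg (tpart u) = wgt tS u.
Proof. by rewrite mdegE; apply: eq_bigr => i _; rewrite mnmE mulnC. Qed.

Lemma tS_ypart u : wgt tS (ypart u) = 0%N.
Proof.
rewrite /wgt big1 // => i _; rewrite mnmE mulnAC /tS; by case: split.
Qed.

Lemma tS_tpart u : wgt tS (tpart u) = wgt tS u.
Proof. by have := congr1 (wgt tS) (partK u); rewrite wgtD tS_ypart addn0. Qed.

Lemma tS_mdeg u : (wgt tS u <= mdeg u)%N.
Proof. by rewrite mdegE; apply: leq_sum => i _; rewrite -[X in (_ <= X)%N]muln1 leq_mul2l tS_le1 orbT. Qed.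

Lemma pim_t u k : pim u (tq k) = u (rshift 39 k).
Proof.
rewrite pimE /wgt (bigD1 (rshift 39 k)) //= /gen split_rshift mnm1E eqxx muln1.
rewrite big1 ?addn0 // => i; case: (split_ordP i) => [a ->|k' ->] hi.
  by rewrite lift4_t muln0.
rewrite mnm1E; case: eqP => [/rshift_inj e|]; last by rewrite muln0.
by rewrite e eqxx in hi.
Qed.

Lemma pim_tpart u v : pim u = pim v -> tpart u = tpart v.
Proof.
move=> e; apply/mnmP => i; rewrite !mnmE; case: (split_ordP i) => j ->.
  by rewrite tS_y.
by rewrite -!pim_t e.
Qed.

(** One monomial in each fibre of [pim], so that the toric ideal is spanned by the binomials ['X_[u]
    - 'X_[rho (pim u)]]. *)
Definition rho (m : 'X_{1..4 + r}) : MS := xget 0%MM [set u | pim u = m]%classic.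

Lemma rhoK u : pim (rho (pim u)) = pim u.
Proof. by rewrite /rho; apply: (xgetPex 0%MM (P := [set v | pim v = pim u]%classic)); exists u. Qed.

End Parts.

(** * Flatness *)

Section Initial.

Context (r : nat) (K : closedFieldType).
Local Notation S := {mpoly K[39 + r]}.
Local Notation Q := {mpoly K[4 + r]}.
Local Notation MS := 'X_{1..39 + r}.
Local Notation MQ := 'X_{1..4 + r}.
Implicit Types (u v k : MS) (m : MQ) (f g G H : S) (p q : Q) (c : 'I_39 -> 'I_r -> K).
Local Notation tS := (@tS r).
Local Notation tQ := (@tQ r).
Local Notation w6 := (@w6 r).
Local Notation gen := (@gen r).
Local Notation mono := (@mono r K).

(** A sum that depends on [u] through [pim u] sees only the coefficients of [mono G], and vanishes
    when those involved do. *)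
Lemma regroup (V : lmodType K) (h : MQ -> V) G :
  \sum_(u <- msupp G) G@_u *: h (pim u) =
  \sum_(m <- undup [seq pim u | u <- msupp G]) (mono G)@_m *: h m.
Proof.
under [RHS]eq_bigr do rewrite mcoeff_mono scaler_suml.
rewrite (exchange_big_dep xpredT) //= big_seq [RHS]big_seq; apply: eq_bigr => u hu.
have hm : pim u \in undup [seq pim u | u <- msupp G] by rewrite mem_undup map_f.
rewrite -big_filter (perm_big [:: pim u]) ?big_seq1 //.
apply: uniq_perm; rewrite ?filter_uniq ?undup_uniq // => m.
by rewrite mem_filter inE eq_sym; case: eqP => // ->.
Qed.

Context (I : S -> Prop) (hI : section_ideal I) (n0 : nat).
Context (hn0 : forall u v, wgt tS u = 0%N -> pim u = pim v -> (n0 <= mdeg u)%N -> liftable I u v).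

(* The last clause says that [H] lies in [(t) ^ s * I]. *)
Definition deep_lift d s f H : Prop :=
  [/\ I H, H \is d.-homog, ordge tS s.+1 (f - H)
   & forall c e, (forall G, I G -> ordge tQ e (Phi c G)) -> ordge tQ (s + e) (Phi c H)].

(** [pim] keeps the exponents of [t], so both monomials have the same [t]-part. It multiplies a lift
    of the [y]-parts, whose degree is at least [n0]. *)
Lemma deep_lift_binomial u v : pim u = pim v -> (wgt tS u + n0 <= mdeg u)%N ->
  exists H, deep_lift (mdeg u) (wgt tS u) ('X_[u] - 'X_[v]) H.
Proof.
move=> e hd; have et := pim_tpart e.
have ey : pim (ypart u) = pim (ypart v).
  by move: e; rewrite -{1}(partK u) -{1}(partK v) et !pimD => /addmI.
have dE : mdeg u = (wgt tS u + mdeg (ypart u))%N by rewrite -{1}(partK u) mdegD mdeg_tpart.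
have [|H [h1 h2 h3]] := hn0 (tS_ypart u) ey; first by rewrite dE leq_add2l in hd.
exists ('X_[tpart u] * H); split.
- exact: (hprimeM hI).
- by rewrite dE; apply: dhomogM => //; rewrite dhomogX /= mdeg_tpart.
- rewrite -{2}(partK u) -(partK v) -et !mpolyXD -mulrBr -mulrBr -tS_tpart.
  have : ordge tS 1 ('X_[ypart u] - 'X_[ypart v] - H) by rewrite -opprB; apply: ordgeN.
  by move/(@ordge_mulX _ _ _ _ (tpart u)); rewrite addn1.
- move=> c n hc; rewrite rmorphM; apply: ordgeM; last exact: hc.
  by rewrite -tS_tpart; apply: Phi_ord; apply: ordgeX.
Qed.

Lemma deep_lift_sum d s (T : eqType) (l : seq T) (a : T -> K) (F : T -> S) :
  (forall i, i \in l -> exists H, deep_lift d s (F i) H) ->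
  exists H, deep_lift d s (\sum_(i <- l) a i *: F i) H.
Proof.
elim: l => [|i l IH] h.
  exists 0; rewrite big_nil; split; [exact: hprime0 hI|exact: rpred0| |].
    by rewrite subrr; apply: ordge_0.
  by move=> c e _; rewrite rmorph0; apply: ordge_0.
have [|H [h1 h2 h3 h4]] := IH; first by move=> j hj; apply: h; rewrite inE hj orbT.
have [H' [h1' h2' h3' h4']] := h i (mem_head _ _).
exists (a i *: H' + H); rewrite big_cons; split.
- by apply: (hprimeD hI) => //; apply: (hprimeZ _ hI).
- by apply: rpredD => //; apply: rpredZ.
- have -> : a i *: F i + \sum_(j <- l) a j *: F j - (a i *: H' + H) =
      a i *: (F i - H') + (\sum_(j <- l) a j *: F j - H) by rewrite scalerBr; ring.
  by apply: ordgeD => //; apply: ordgeZ.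
- move=> c e hc; rewrite rmorphD /= linearZ /=; apply: ordgeD; last exact: h4.
  by apply: ordgeZ; apply: h4'.
Qed.

Definition initial s G : S := \sum_(u <- msupp G) G@_u *: (if wgt tS u == s then 'X_[u] else 0).

Lemma ordge_homog0 d s G : G \is d.-homog -> ordge tS s G -> (d < s)%N -> G = 0.
Proof.
move=> hd ho lt; apply/mpolyP => u; rewrite mcoeff0.
case: (eqVneq (mdeg u) d) => [e|]; last exact: dhomog_nemf_coeff hd.
by apply: ho; apply: leq_ltn_trans lt; rewrite -e tS_mdeg.
Qed.

Lemma initial_ord s G : ordge tS s G -> ordge tS s.+1 (G - initial s G).
Proof.
move=> hG; rewrite {1}[G]mpolyE -sumrB big_seq; apply: ordge_sum => u hu.
rewrite -scalerBr; apply: ordgeZ; case: eqP => e; first by rewrite subrr; apply: ordge_0.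
rewrite subr0; apply: (@ordgeW _ _ _ (wgt tS u)); last exact: ordgeX.
rewrite ltn_neqAle eq_sym; apply/andP; split; first by apply/eqP.
by rewrite leqNgt; apply: contraTN hu => /hG; rewrite mcoeff_msupp => ->; rewrite eqxx.
Qed.

(** The part of degree [s] in [t] is killed by [mono]; hence it is a combination of binomials
    ['X_[u] - 'X_[rho (pim u)]], which have deep lifts. *)
Lemma deep_lift_initial d s G : G \is d.-homog -> (s + n0 <= d)%N ->
  ordge tS s G -> ordge tQ s.+1 (mono G) -> exists H, deep_lift d s G H.
Proof.
move=> /dhomogP hd le hG hm.
have [H [h1 h2 h3 h4]] : exists H, deep_lift d s (\sum_(u <- msupp G)
    (if wgt tS u == s then G@_u else 0) *:
    (if wgt tS u == s then 'X_[u] - 'X_[rho (pim u)] else 0)) H.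
  apply: deep_lift_sum => u hu; have du : mdeg u = d := hd u hu.
  case: eqP => [e|_]; last first.
    exists 0; split; [exact: hprime0 hI|exact: rpred0| |].
      by rewrite subrr; apply: ordge_0.
    by move=> c e _; rewrite rmorph0; apply: ordge_0.
  by have := @deep_lift_binomial u (rho (pim u)); rewrite e du rhoK; apply.
exists H; split => //.
have E : \sum_(u <- msupp G) (if wgt tS u == s then G@_u else 0) *:
    (if wgt tS u == s then 'X_[u] - 'X_[rho (pim u)] else 0) =
   initial s G - \sum_(u <- msupp G) G@_u *: (if wgt tQ (pim u) == s then 'X_[rho (pim u)] else 0).
  rewrite -sumrB; apply: eq_bigr => u _; rewrite tQ_pim; case: eqP => _; first by rewrite scalerBr.
  by rewrite !scaler0 subr0.
rewrite E (regroup (fun m => if wgt tQ m == s then 'X_[rho m] else 0 : S)) in h3.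
rewrite [\sum_(m <- undup _) _]big1 ?subr0 in h3.
  rewrite -(subrK (initial s G) G) -addrA; apply: ordgeD => //; exact: initial_ord.
move=> m _; case: eqP => e; last by rewrite scaler0.
by rewrite hm ?scale0r // e.
Qed.

(* If [Phi c] maps [I] into [(T) ^ e] then it maps [I :&: (t)] into [(T) ^ e.+1],
   provided [mono] raises the order of elements of [I]. *)
Lemma initial_flat :
  (forall d s G, I G -> G \is d.-homog -> ordge tS s G -> ordge tQ s.+1 (mono G)) ->
  forall c e, (forall G, I G -> ordge tQ e (Phi c G)) ->
  forall d G, I G -> G \is d.-homog -> ordge tS 1 G -> ordge tQ e.+1 (Phi c G).
Proof.
move=> flat c e hc.
(* The induction raises the order [s] of [G] in [t]; above [e], [Phi_ord] concludes. *)
suff main j s d G : I G -> G \is d.-homog -> (0 < s)%N -> (e < s + j)%N -> ordge tS s G -> ordge tQ e.+1 (Phi c G).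
  by move=> d G hG hd ho; apply: (main e.+1 1%N d G).
elim: j s d G => [|j IH] s d G hG hd s0 lt ho.
  by apply: Phi_ord; apply: ordgeW ho; rewrite addn0 in lt.
case: (leqP s d) => sd; last first.
  by rewrite (ordge_homog0 hd ho sd) rmorph0; apply: ordge_0.
have [z ez tz] := pw6_gen r o1.
(* This factor makes the degree large enough for lifting. Its image has an initial form free of [T],
   so [ordge_cancel] removes it again. *)
pose Z : S := 'X_[U_(z) *+ n0].
have [||||H [h1 h2 h3 h4]] := @deep_lift_initial (n0 + d)%N s (Z * G).
- by apply: dhomogM => //; rewrite dhomogX /= mdegMn mdeg1 mul1n.
- by rewrite addnC leq_add2l.
- exact: ordgeMl.
- rewrite rmorphM; apply: ordgeMl; exact: flat hd ho.
have hZ : ordge tQ 1 (Phi c Z - 'X_[pim (U_(z) *+ n0)%MM]).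
  by have := @PhiX_ord _ K c (U_(z) *+ n0)%MM; rewrite wgtMn wgtU tz muln0.
apply: (ordge_cancel (h := pim (U_(z) *+ n0)%MM) _ hZ).
  by rewrite tQ_pim wgtMn wgtU tz muln0.
(* The difference [Z * G - H] has larger order in [t], and [H] lies in [(t) ^ s * I] with [s > 0],
   which gains the missing order. *)
rewrite -rmorphM -(subrK H (Z * G)) rmorphD; apply: ordgeD.
  apply: (IH s.+1 (n0 + d)%N) => //; last by rewrite addSnnS.
    by apply: (hprimeB hI) => //; apply: (hprimeM hI).
  apply: rpredB => //; by apply: dhomogM => //; rewrite dhomogX /= mdegMn mdeg1 mul1n.
by apply: ordgeW (h4 c e hc); rewrite -add1n leq_add2r.
Qed.

End Initial.

(** * Counting monomials of fixed weight *)

Section Count.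

Context (n b : nat) (w : 'I_n -> nat) (w_gt0 : forall i, (0 < w i)%N).
Local Notation BM := (bmultinom n b.+1).

(** The coordinates in [Z] other than [j] are constant on [A], and the weight recovers the one at
    [j] because [w j] is positive. *)
Lemma card_wgt_fixed (A : {set BM}) (Z : {set 'I_n}) (j : 'I_n) :
  j \in Z -> {in A &, forall m m' : BM, wgt w (bmnm m) = wgt w (bmnm m')} ->
  {in A &, forall m m' : BM, forall i, i \in Z -> i != j -> bmnm m i = bmnm m' i} ->
  (#|A| <= b.+1 ^ (n - #|Z|))%N.
Proof.
move=> jZ hw hZ.
pose f (m : BM) : {ffun 'I_n -> 'I_b.+1} :=
  [ffun i => if i \in Z then ord0 else inord (bmnm m i)].
have f_inj : {in A &, injective f}.
  move=> m m' hm hm' /ffunP e.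
  have lt (x : BM) i : (bmnm x i < b.+1)%N.
    by apply: leq_ltn_trans (bmdeg x); rewrite mdegE (bigD1 i) //= leq_addr.
  have e1 i : i != j -> bmnm m i = bmnm m' i.
    move=> ij; have := e i; rewrite !ffunE; case: ifP => iZ; first by move=> _; apply: hZ.
    by move=> /(congr1 val); rewrite /= !inordK.
  apply/val_inj/mnmP => i; case: (eqVneq i j) => [->|]; last exact: e1.
  have := hw m m' hm hm'; rewrite /wgt (bigD1 j) //= [in RHS](bigD1 j) //=.
  rewrite (eq_bigr (fun i => bmnm m' i * w i)%N); last by move=> k hk; rewrite e1.
  by move=> /addIn /eqP; rewrite eqn_pmul2r ?w_gt0 // => /eqP.
rewrite -(card_in_imset f_inj).
have -> : (b.+1 ^ (n - #|Z|) = #|pffun_on (@ord0 b) (mem (~: Z)%SET) (mem (finset.setT : {set 'I_b.+1}))|)%N.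
  have eZ : #|(~: Z)%SET| = (n - #|Z|)%N by rewrite cardsCs finset.setCK card_ord.
  by rewrite card_pffun_on cardsT card_ord eZ.
apply/subset_leq_card/fintype.subsetP => _ /finset.imsetP[m _ ->]; apply/pffun_onP; split.
  apply/fintype.subsetP => i; rewrite finset.inE finset.inE ffunE.
  by case: ifP => //; rewrite eqxx.
by move=> i _; rewrite finset.inE.
Qed.

End Count.

Section Hilbert.

Context (r : nat) (K : closedFieldType).
Local Notation S := {mpoly K[39 + r]}.
Local Notation Q := {mpoly K[4 + r]}.
Local Notation MS := 'X_{1..39 + r}.
Local Notation MQ := 'X_{1..4 + r}.
Implicit Types (u v k : MS) (m : MQ) (f g G H : S) (p q : Q).
Local Notation tS := (@tS r).
Local Notation tQ := (@tQ r).
Local Notation w6 := (@w6 r).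
Local Notation mono := (@mono r K).

Context (I : S -> Prop) (hI : section_ideal I) (n0 : nat).
Context (hn0 : forall u v, wgt tS u = 0%N -> pim u = pim v -> (n0 <= mdeg u)%N -> liftable I u v).

(* [E] is a set of leading exponents of initial forms of elements of [I]. *)
Lemma spans_standard (E : MQ -> Prop) (N : nat) (B : seq S) :
  (forall m, wgt w6 m = (6 * N)%N -> E m -> exists G, [/\ I G, G \is N.-homog,
     ordge tS (wgt tQ m) G, (mono G)@_m != 0 &
     forall m', wgt tQ m' = wgt tQ m -> (mono G)@_m' != 0 -> (m' <= m)%O]) ->
  (forall m, wgt w6 m = (6 * N)%N -> ~ E m -> 'X_[rho m] \in B) ->
  (forall u, mdeg u = N -> (N < wgt tS u + n0)%N -> 'X_[u] \in B) ->
  forall f, f \is N.-homog -> spans I B f.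
Proof.
move=> hE hB1 hB2; have pI : hprime I := hI.
suff main j s f : f \is N.-homog -> ordge tS s f -> (N < s + j)%N -> spans I B f.
  by move=> f hf; apply: (main N.+1 0%N f).
elim: j s f => [|j IH] s f hf ho lt.
  have -> : f = 0 by apply: (ordge_homog0 hf ho); rewrite addn0 in lt.
  by apply: spans0 => //; exact: hprime0 hI.
have IHs g : g \is N.-homog -> ordge tS s.+1 g -> spans I B g.
  by move=> h1 h2; apply: (IH s.+1 g); rewrite ?addSnnS.
have rep u : mdeg u = N -> wgt tS u = s -> (s + n0 <= N)%N ->
    spans I B ('X_[u] - 'X_[rho (pim u)]).
  move=> du su sN; have [||H [h1 h2 h3 _]] := deep_lift_binomial hI hn0 (u := u) (v := rho (pim u)).
  - by rewrite rhoK.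
  - by rewrite su du.
  rewrite -(subrK H (_ - _)); apply: spansD => //; last exact: spans0.
  rewrite su in h3; apply: IHs => //; rewrite du in h2.
  apply: rpredB => //; apply: rpredB; rewrite dhomogX //= ?du //.
  by rewrite (pim_mdeg (rhoK u)) du.
have init G : G \is N.-homog -> ordge tS s G -> (s + n0 <= N)%N ->
   spans I B (G - \sum_(m <- undup [seq pim u | u <- msupp G])
      (mono G)@_m *: (if wgt tQ m == s then 'X_[rho m] else 0)).
  move=> /dhomogP hG hoG sN; rewrite -regroup.
  set X := \sum_(u <- msupp G) _.
  have -> : G - X = (G - initial s G) + (initial s G - X) by rewrite addrA subrK.
  rewrite {}/X; apply: spansD => //.
    apply: IHs; last exact: initial_ord.
    apply: rpredB; first exact/dhomogP.
    rewrite /initial big_seq; apply: rpred_sum => u /hG du; apply: rpredZ.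
    by case: ifP => _; rewrite ?rpred0 // dhomogX; apply/eqP.
  rewrite /initial -sumrB; apply: spans_sum_seq => // u hu.
  rewrite -scalerBr; apply: spansZ => //; rewrite tQ_pim; case: eqP => [e|_].
    by apply: rep => //; exact: hG.
  by rewrite subrr; apply: spans0 => //; exact: hprime0 hI.
(* Groebner reduction within one degree in [T]: a leading exponent in [E] is rewritten through
   smaller ones, and the monomial order is well founded. *)
have repm m : wgt w6 m = (6 * N)%N -> wgt tQ m = s -> (s + n0 <= N)%N -> spans I B 'X_[rho m].
  elim/(well_founded_ind (@ltom_wf (4 + r))): m => m IHm hm tm sN.
  case: (pselect (E m)) => [Em|nE]; last by apply: spans_mem => //; exact: hB1.
  have [G [IG hG oG Gm0 Gle]] := hE m hm Em.
  rewrite tm in oG Gle.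
  have := init G hG oG sN; set R := \sum_(m' <- _) _ => hR.
  have {hR} : spans I B R.
    by rewrite -(subKr G R); apply: spansB => //; exact: spans0.
  have mM : m \in undup [seq pim u | u <- msupp G].
    rewrite mem_undup; apply: contraNT Gm0 => hn; rewrite mcoeff_mono big_seq_cond big1 //.
    by move=> u /andP[hu /eqP e]; rewrite -e map_f in hn.
  rewrite /R (bigD1_seq m) ?undup_uniq //= tm eqxx => hR.
  rewrite -[X in spans I B X](scalerK Gm0); apply: spansZ => //.
  rewrite -[X in spans I B X](addrK (\sum_(i <- undup [seq pim u | u <- msupp G] | i != m)
     (mono G)@_i *: (if wgt tQ i == s then 'X_[rho i] else 0))).
  apply: spansB => //; rewrite big_seq_cond; apply: spans_sum => // m' /andP[hm' ne].
  case: (eqVneq (mono G)@_m' 0) => [->|ne0].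
    by rewrite scale0r; apply: spans0 => //; exact: hprime0 hI.
  apply: spansZ => //; case: eqP => [tm'|_]; last by apply: spans0 => //; exact: hprime0 hI.
  apply: IHm => //; first by rewrite lt_neqAle ne Gle // tm tm'.
  have /dhomogP := Phi_homog (fun _ _ => 0) hG.
  by move=> /(_ m'); rewrite mcoeff_msupp => /(_ ne0).
have hfi : initial s f \is N.-homog.
  rewrite /initial big_seq; apply: rpred_sum => u hu; apply: rpredZ.
  by case: ifP => _; rewrite ?rpred0 // dhomogX; apply/eqP; move/dhomogP: hf => /(_ u hu).
rewrite -(subrK (initial s f) f); apply: spansD => //.
  by apply: IHs; [exact: rpredB|exact: initial_ord].
apply: spans_sum_seq => // u hu; apply: spansZ => //; case: eqP => [e|_]; last by apply: spans0 => //; exact: hprime0 hI.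
have du : mdeg u = N by move/dhomogP: hf => /(_ u hu).
case: (leqP (s + n0) N) => sN; last by apply: spans_mem => //; apply: hB2; rewrite ?du ?e.
rewrite -(subrK 'X_[rho (pim u)] 'X_[u]); apply: spansD => //; first exact: rep.
by apply: repm; rewrite ?w6_pim ?tQ_pim ?du.
Qed.

(** These monomials have fewer than [n0] factors [y_a], too few for lifting. Their number grows at
    most like [N ^ r], which does not affect the orders [2 + r] and [3 + r]. *)
Definition low_set N : {set bmultinom (39 + r) N.+1} :=
  [set u | (mdeg (bmnm u) == N) && (N < wgt tS (bmnm u) + n0)%N]%SET.

Lemma card_low_set N : (#|low_set N| <= n0.+1 ^ 39 * N.+1 ^ r)%N.
Proof.
pose f (u : bmultinom (39 + r) N.+1) :
    {ffun 'I_39 -> 'I_n0.+1} * {ffun 'I_r -> 'I_N.+1} :=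
  ([ffun a => inord (bmnm u (lshift r a))], [ffun k => inord (bmnm u (rshift 39 k))]).
have dE u : mdeg u = (\sum_(a < 39) u (lshift r a) + wgt tS u)%N.
  rewrite mdegE /wgt !big_split_ord /= [(\sum_(i < 39) u _ * _)%N]big1 => [|a _].
    by congr (_ + _)%N; rewrite add0n; apply: eq_bigr => k _; rewrite tS_t muln1.
  by rewrite tS_y muln0.
have f_inj : {in low_set N &, injective f}.
  move=> u v; rewrite !finset.inE => /andP[/eqP du lu] /andP[/eqP dv lv] [/ffunP e1 /ffunP e2].
  have ub (x : bmultinom (39 + r) N.+1) i : (bmnm x i < N.+1)%N.
    by apply: leq_ltn_trans (bmdeg x); rewrite mdegE (bigD1 i) //= leq_addr.
  have yb (x : MS) a : mdeg x = N -> (N < wgt tS x + n0)%N -> (x (lshift r a) < n0.+1)%N.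
    by rewrite dE (bigD1 a) //=; lia.
  apply/val_inj/mnmP => i; case: (split_ordP i) => j ->.
    by have := e1 j; rewrite !ffunE => /(congr1 val); rewrite /= !inordK ?yb.
  by have := e2 j; rewrite !ffunE => /(congr1 val); rewrite /= !inordK ?ub.
rewrite -(card_in_imset f_inj); apply: (leq_trans (max_card _)).
by rewrite card_prod !card_ffun !card_ord.
Qed.

Lemma mdeg_w6 m : (mdeg m <= wgt w6 m)%N.
Proof. by rewrite mdegE; apply: leq_sum => i _; rewrite leq_pmulr ?w6_gt0. Qed.

Lemma spans_card (E : MQ -> Prop) N (A : {set bmultinom (4 + r) (6 * N).+1}) :
  (forall m, wgt w6 m = (6 * N)%N -> E m -> exists G, [/\ I G, G \is N.-homog,
     ordge tS (wgt tQ m) G, (mono G)@_m != 0 &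
     forall m', wgt tQ m' = wgt tQ m -> (mono G)@_m' != 0 -> (m' <= m)%O]) ->
  (forall m : bmultinom (4 + r) (6 * N).+1, wgt w6 (bmnm m) = (6 * N)%N -> ~ E (bmnm m) -> m \in A) ->
  exists2 B : seq S, (size B <= #|A| + n0.+1 ^ 39 * N.+1 ^ r)%N &
    forall f, f \is N.-homog -> spans I B f.
Proof.
move=> hE hA.
exists ([seq 'X_[rho (bmnm x)] | x <- enum A] ++ [seq 'X_[bmnm x] | x <- enum (low_set N)]).
  by rewrite size_cat !size_map -!cardE leq_add2l card_low_set.
apply: spans_standard hE _ _ => [m hm nE|u du hu]; rewrite mem_cat; apply/orP.
  have lt : (mdeg m < (6 * N).+1)%N by rewrite ltnS -hm mdeg_w6.
  by left; apply/mapP; exists (BMultinom lt) => //; rewrite mem_enum; apply: hA.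
have lt : (mdeg u < N.+1)%N by rewrite du.
by right; apply/mapP; exists (BMultinom lt) => //; rewrite mem_enum finset.inE /= du eqxx.
Qed.

(** All exponents of weight [6 * N] in [4 + r] variables are counted, the weight determining one of
    them; [(6 * N).+1 <= 6 * N.+1] yields the constant. *)
Lemma hilbert_dim : exists C, forall N, exists2 B : seq S, (size B <= C * N.+1 ^ (3 + r))%N &
    forall f, f \is N.-homog -> spans I B f.
Proof.
exists (6 ^ (3 + r) + n0.+1 ^ 39)%N => N.
pose A := [set m : bmultinom (4 + r) (6 * N).+1 | wgt w6 (bmnm m) == (6 * N)%N]%SET.
have [||B sB hB] := @spans_card (fun _ => False) N A.
- by [].
- by move=> m hm _; rewrite finset.inE hm.
exists B => //; apply: leq_trans sB _; rewrite mulnDl leq_add //.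
  have := @card_wgt_fixed (4 + r) (6 * N) w6 (@w6_gt0 r) A [set lshift r o0]%SET (lshift r o0).
  have -> : (4 + r - #|[set lshift r o0]%SET| = 3 + r)%N by rewrite cards1; lia.
  rewrite finset.set11 => h.
  apply: leq_trans (h isT _ _) _.
  - by move=> m m'; rewrite !finset.inE => /eqP -> /eqP ->.
  - by move=> m m' _ _ i; rewrite finset.inE => /eqP ->; rewrite eqxx.
  by rewrite -expnMn leq_exp2r //; lia.
by rewrite leq_mul2l leq_pexp2l ?orbT // leq_addl.
Qed.

(* [I] has no more initial forms than the ideal of [X]: otherwise the Hilbert
   function of [Y] would grow too slowly for its dimension. *)
Lemma section_flat d s G : I G -> G \is d.-homog -> ordge tS s G -> ordge tQ s.+1 (mono G).
Proof.
move=> IG hG oG; apply: contrapT => nflat.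
have pI : hprime I := hI.
pose g := pihomog (wgt tQ) s (mono G).
have g0 : g != 0.
  apply/eqP => g0; apply: nflat => m; rewrite ltnS leq_eqVlt => /orP[/eqP e|]; last first.
    exact: mono_ord oG m.
  by have := mcoeff_pihomog (wgt tQ) s (mono G) m; rewrite -/g g0 mcoeff0 /= e eqxx.
(* The leading exponent of the part of [mono G] that violates the claim. By [pim_surj], its
   multiples of weight [6 * N] are leading exponents too. *)
pose m0 := mlead g.
have [tm0 cm0] : wgt tQ m0 = s /\ (mono G)@_m0 != 0.
  have := mlead_supp g0; rewrite mcoeff_msupp mcoeff_pihomog /=.
  by rewrite -/m0; case: (eqVneq (wgt tQ m0) s) => // _; rewrite eqxx.
have max m : wgt tQ m = s -> (mono G)@_m != 0 -> (m <= m0)%O.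
  move=> e h; apply: msupp_le_mlead; rewrite mcoeff_msupp mcoeff_pihomog /=.
  by rewrite e eqxx.
have w6m0 : wgt w6 m0 = (6 * d)%N.
  by have /dhomogP := Phi_homog (fun _ _ => 0) hG; move=> /(_ m0); rewrite mcoeff_msupp => /(_ cm0).
have hE N m : wgt w6 m = (6 * N)%N -> (m0 <= m)%MM -> exists G, [/\ I G, G \is N.-homog,
     ordge tS (wgt tQ m) G, (mono G)@_m != 0 &
     forall m', wgt tQ m' = wgt tQ m -> (mono G)@_m' != 0 -> (m' <= m)%O].
  move=> hm le.
  have [|k ek dk] := @pim_surj r (m - m0)%MM (N - d)%N.
    by have := congr1 (wgt w6) (submK le); rewrite wgtD hm w6m0; lia.
  have em : m = (pim k + m0)%MM by rewrite ek submK.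
  exists ('X_[k] * G); split.
  - exact: hprimeM.
  - have -> : N = (mdeg k + d)%N.
      by have := hm; rewrite em wgtD w6_pim w6m0; lia.
    by apply: dhomogM => //; rewrite dhomogX.
  - by rewrite em wgtD tQ_pim tm0; apply: ordge_mulX.
  - by rewrite rmorphM /= monoX mulrC em mcoeffMX.
  move=> m' tm'; rewrite rmorphM /= monoX => /mcoeffM_neq0[m1 [m2 [em' h1 h2]]].
  have e1 : pim k = m1.
    by move: h1; rewrite mcoeffX; case: (eqVneq (pim k) m1) => // _; rewrite eqxx.
  rewrite em' em e1 lemc_add2r; apply: max => //.
  by move: tm'; rewrite em' em e1 !wgtD tm0 => /addnI.
(* An exponent that [m0] does not divide has, at some [i], one of only [m0 i] values. This
   coordinate and the weight save two powers of [N]. *)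
suff : (3 + r <= 2 + r)%N by rewrite leq_add2r.
apply: (si_dim hI (C := mdeg m0 * 6 ^ (2 + r) + n0.+1 ^ 39)) => N.
pose A := [set m : bmultinom (4 + r) (6 * N).+1 |
  (wgt w6 (bmnm m) == 6 * N)%N && ~~ (m0 <= bmnm m)%MM]%SET.
have [||B sB hB] := @spans_card (fun m => (m0 <= m)%MM) N A.
- exact: hE.
- by move=> m hm /negP; rewrite finset.inE hm eqxx.
exists B => //; apply: leq_trans sB _; rewrite mulnDl leq_add //; last first.
  by rewrite leq_mul2l leq_pexp2l ?orbT // leq_addl.
pose Ai (i : 'I_(4 + r)) (a : nat) := [set x in A | bmnm x i == a]%SET.
have cAi i a : (#|Ai i a| <= (6 * N).+1 ^ (2 + r))%N.
  pose j := if i == lshift r o0 then lshift r o1 else lshift r o0 : 'I_(4 + r).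
  have ij : i != j.
    by rewrite /j; case: (eqVneq i (lshift r o0)) => [->|].
  have := @card_wgt_fixed (4 + r) (6 * N) w6 (@w6_gt0 r) (Ai i a) [set i; j]%SET j.
  have -> : (4 + r - #|[set i; j]%SET| = 2 + r)%N by rewrite cards2 ij; lia.
  rewrite finset.set22 => h; apply: h => //.
  - by move=> m m'; rewrite !finset.inE => /andP[/andP[/eqP -> _] _] /andP[/andP[/eqP -> _] _].
  - move=> m m'; rewrite !finset.inE => /andP[_ /eqP e] /andP[_ /eqP e'] k.
    by rewrite finset.in_set2 => /orP[/eqP ->|/eqP ->]; rewrite ?eqxx // e e'.
apply: (@leq_trans (\sum_(i < 4 + r) \sum_(a < m0 i) #|Ai i a|)).
  have sub : A \subset (\bigcup_(i < 4 + r) \bigcup_(a < m0 i) Ai i a)%SET.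
    apply/fintype.subsetP => x hx; have := hx; rewrite finset.inE => /andP[_ nle].
    have [i hi] : exists i, (bmnm x i < m0 i)%N.
      apply: contrapT => /forallNP h; case/mnm_lepP: nle => i.
      by rewrite leqNgt; apply/negP.
    apply/finset.bigcupP; exists i => //; apply/finset.bigcupP; exists (Ordinal hi) => //.
    by rewrite finset.inE hx /=.
  apply: leq_trans (subset_leq_card sub) _.
  elim/big_ind2 : _ => [|X n1 Y n2 h1 h2|i _]; first by rewrite cards0.
    by apply: leq_trans (leq_card_setU _ _) _; apply: leq_add.
  elim/big_ind2 : _ => [|X n1 Y n2 h1 h2|a _]; rewrite ?cards0 //.
  by apply: leq_trans (leq_card_setU _ _) _; apply: leq_add.
apply: (@leq_trans (\sum_(i < 4 + r) m0 i * (6 * N).+1 ^ (2 + r))).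
  apply: leq_sum => i _; rewrite -[X in (_ <= X * _)%N](card_ord (m0 i)) -sum_nat_const.
  exact: leq_sum.
rewrite -big_distrl -mdegE /= -mulnA leq_mul2l -expnMn; apply/orP; right.
by rewrite leq_exp2r //; lia.
Qed.

End Hilbert.

(** * Rigidity *)

Section LinearExtension.

Context (n : nat) (K : idomainType) (f : 'I_n -> K).
Implicit Types (u v : 'X_{1..n}).

(** A vector field sending each [y_a] to [f a] times the monomial of exponent [gen a + w] sends
    ['X_[u]] to [lin u] times the monomial of exponent [pim u + w]. *)
Definition lin u : K := \sum_a (u a)%:R * f a.

Lemma linD u v : lin (u + v)%MM = lin u + lin v.
Proof. by rewrite /lin -big_split; apply: eq_bigr => a _; rewrite mnmDE natrD mulrDl. Qed.

Lemma lin0 : lin 0%MM = 0.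
Proof. by rewrite /lin big1 // => a _; rewrite mnm0E mul0r. Qed.

Lemma linU a : lin U_(a)%MM = f a.
Proof.
rewrite /lin (bigD1 a) //= mnm1E eqxx mul1r big1 ?addr0 // => b hb.
by rewrite mnm1E eq_sym (negbTE hb) mul0r.
Qed.

Lemma linMn u k : lin (u *+ k)%MM = k%:R * lin u.
Proof.
by rewrite /lin big_distrr; apply: eq_bigr => a _ /=; rewrite mulmnE mulnC natrM -mulrA.
Qed.

End LinearExtension.

Section ShiftedCoefficient.

Context (n : nat) (K : idomainType).
Implicit Types (p q : {mpoly K[n]}) (m h : 'X_{1..n}) (w : 'I_n -> int).

(* The coefficient of the exponent [m + w], where [w] may have negative entries. *)
Definition cf p m w : K :=
  if `[< forall i, 0 <= (m i)%:Z + w i >]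
  then p@_[multinom absz ((m i)%:Z + w i)%R | i < n] else 0.

Lemma cfD p q m w : cf (p + q) m w = cf p m w + cf q m w.
Proof. by rewrite /cf; case: asboolP => _; rewrite ?mcoeffD ?addr0. Qed.

Lemma cfB p q m w : cf (p - q) m w = cf p m w - cf q m w.
Proof. by rewrite /cf; case: asboolP => _; rewrite ?mcoeffB ?subr0. Qed.

Lemma cfE p m w m' : (forall i, (m' i)%:Z = (m i)%:Z + w i) -> cf p m w = p@_m'.
Proof.
move=> h; rewrite /cf; case: asboolP => [_|[]]; last by move=> i; rewrite -h.
by congr (_@__); apply/mnmP => i; rewrite mnmE -h.
Qed.

Lemma cf_neg p m w i : (m i)%:Z + w i < 0 -> cf p m w = 0.
Proof. by move=> h; rewrite /cf; case: asboolP => // /(_ i); rewrite leNgt h. Qed.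

(** If [m + w] has a negative entry, ['X_[h]] does not divide the monomial of exponent [h + m + w],
    and both sides vanish. *)
Lemma cf_shift h p m w : cf ('X_[h] * p) (h + m)%MM w = cf p m w.
Proof.
case: (pselect (forall i, 0 <= (m i)%:Z + w i)) => hm.
  pose m' := [multinom absz ((m i)%:Z + w i)%R | i < n].
  have hm' i : (m' i)%:Z = (m i)%:Z + w i by rewrite mnmE gez0_abs.
  rewrite (cfE _ hm') (@cfE _ _ _ (h + m')%MM); first by rewrite mulrC mcoeffMX.
  by move=> i; rewrite !mnmDE !PoszD hm' addrA.
rewrite [RHS]/cf; case: asboolP => // _; rewrite /cf; case: asboolP => // hhm.
set m' := [multinom _ | _ < n]; case: (eqVneq ('X_[h] * p)@_m' 0) => // /mcoeffM_neq0.
move=> [m1 [m2 [e h1 _]]]; case: hm => i.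
have e1 : h = m1 by move: h1; rewrite mcoeffX; case: (eqVneq h m1) => // _; rewrite eqxx.
have : (m' i)%:Z = (h i)%:Z + (m i)%:Z + w i.
  by rewrite mnmE gez0_abs ?hhm // mnmDE PoszD.
by rewrite e e1 mnmDE; lia.
Qed.

End ShiftedCoefficient.

Section Variables.

Context (r : nat).
Local Notation MQ := 'X_{1..4 + r}.

Definition var (m : MQ) : 'I_(39 + r) :=
  xget (lshift r ord0) [set i | gen i = m]%classic.

Lemma varK m : wgt (@w6 r) m = 6%N -> gen (var m) = m.
Proof. by move=> /gen_surj h; apply: (xgetPex _ (P := [set i | gen i = m]%classic) h). Qed.

Definition pvar i := var (pw6 r i).
(* The coordinates of the chart [x_e <> 0] of [X]. *)
Definition bvar e i := var (U_(xq r i) + U_(xq r e) *+ (6 - w3111 i))%MM.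

Lemma pvarK i : gen (pvar i) = pw6 r i.
Proof. exact/varK/w6_pw6. Qed.

Lemma eq_xq i j : (xq r i == xq r j) = (i == j).
Proof. by rewrite (inj_eq (@lshift_inj _ _)). Qed.

Lemma w3111_1 e : e != o0 -> w3111 e = 1%N.
Proof. by case: (ord4_case e) => ->. Qed.

Lemma bvarK e i : e != o0 -> gen (bvar e i) = (U_(xq r i) + U_(xq r e) *+ (6 - w3111 i))%MM.
Proof.
move=> e0; apply: varK; rewrite wgtD wgtMn !wgtU !w6_x (w3111_1 e0) muln1.
by rewrite /w3111; case: ifP.
Qed.

Lemma tS_pvar i : tS (pvar i) = 0%N.
Proof. by rewrite -tS_gen pvarK tQ_pw6. Qed.

Lemma tS_bvar e i : e != o0 -> tS (bvar e i) = 0%N.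
Proof. by move=> e0; rewrite -tS_gen bvarK // wgtD wgtMn !wgtU !tQ_x muln0. Qed.

Lemma pvar_neq i j : j != xq r i -> gen (pvar i) j = 0%N.
Proof. by move=> h; rewrite pvarK /pw6 mulmnE mnm1E eq_sym (negbTE h). Qed.

Lemma gen_xsum a : tS a = 0%N ->
  (\sum_(i < 4) w3111 i * gen a (xq r i) = 6)%N.
Proof.
move=> ta; rewrite -(wgt_gen a) w6E tS_gen ta muln0 addn0 big_ord4 /w3111 /=.
by rewrite !mul1n.
Qed.

End Variables.

Section Step.

Context (r : nat) (K : closedFieldType).
Local Notation S := {mpoly K[39 + r]}.
Local Notation Q := {mpoly K[4 + r]}.
Local Notation MS := 'X_{1..39 + r}.
Local Notation MQ := 'X_{1..4 + r}.
Implicit Types (u v k h : MS) (m : MQ) (f g G H : S) (p q : Q) (c : 'I_39 -> 'I_r -> K).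
Local Notation tS := (@tS r).
Local Notation tQ := (@tQ r).
Local Notation w6 := (@w6 r).
Local Notation gen := (@gen r).
Local Notation mono := (@mono r K).

Lemma tQ_eq0 m : wgt tQ m = 0%N -> forall j, m (tq j) = 0%N.
Proof. by move/eqP; rewrite tQE sum_nat_eq0 => /forallP h j; apply/eqP; exact: (h j). Qed.

Context (I : S -> Prop) (hI : section_ideal I) (n0 : nat).
Context (hn0 : forall u v, wgt tS u = 0%N -> pim u = pim v -> (n0 <= mdeg u)%N -> liftable I u v).

Let pI : hprime I := hI.

Definition lift_of u v : S :=
  xget 0 [set H | [/\ I H, H \is (mdeg u).-homog & ordge tS 1 (H - ('X_[u] - 'X_[v]))]]%classic.

Lemma lift_ofP u v : wgt tS u = 0%N -> pim u = pim v -> (n0 <= mdeg u)%N ->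
  [/\ I (lift_of u v), lift_of u v \is (mdeg u).-homog &
      ordge tS 1 (lift_of u v - ('X_[u] - 'X_[v]))].
Proof. by move=> h1 h2 h3; apply: (xgetPex 0 (hn0 h1 h2 h3)). Qed.

Context (c : 'I_39 -> 'I_r -> K) (s : nat).
Context (hc : forall G, I G -> ordge tQ s (Phi c G)).

(** Two lifts of one binomial differ by such a [G], so the choice of a lift is invisible at order
    [s]. *)
Lemma Phi_flat d G : I G -> G \is d.-homog -> ordge tS 1 G -> ordge tQ s.+1 (Phi c G).
Proof. by apply: (initial_flat hI hn0 (section_flat hI hn0)). Qed.

Section Weight.

Context (w : 'I_(4 + r) -> int) (hw : \sum_j w (tq j) = s%:Z).

(** The shift by [w] brings the degree in [T] from 0 to exactly [s]. *)
Lemma cf_ord p m : wgt tQ m = 0%N -> ordge tQ s.+1 p -> cf p m w = 0.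
Proof.
move=> /tQ_eq0 m0 hp; rewrite /cf; case: asboolP => // hm; apply: hp.
rewrite ltnS tQE -lez_nat -hw (rmorph_sum Posz) /=; apply: ler_sum => j _.
have := hm (tq j); rewrite mnmE m0 add0r => h0; by rewrite gez0_abs.
Qed.

Lemma lift_of_shift k u v : wgt tS k = 0%N -> wgt tS u = 0%N -> pim u = pim v -> (n0 <= mdeg u)%N ->
  cf (Phi c (lift_of (k + u)%MM (k + v)%MM)) (pim (k + u)%MM) w = cf (Phi c (lift_of u v)) (pim u) w.
Proof.
move=> hk hu e du.
have [h1 h2 h3] := lift_ofP hu e du.
have [|||h1' h2' h3'] := @lift_ofP (k + u)%MM (k + v)%MM.
- by rewrite wgtD hk hu.
- by rewrite !pimD e.
- by rewrite mdegD (leq_trans du) ?leq_addl.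
set L := lift_of u v in h1 h2 h3 *; set L' := lift_of (k + u)%MM _ in h1' h2' h3' *.
have t0 : wgt tQ (pim (k + u)%MM) = 0%N by rewrite tQ_pim wgtD hk hu.
have hLL : ordge tQ s.+1 (Phi c (L' - 'X_[k] * L)).
  apply: (@Phi_flat (mdeg (k + u)%MM)).
  - by apply: hprimeB => //; apply: hprimeM.
  - apply: rpredB => //; rewrite mdegD; apply: dhomogM => //; by rewrite dhomogX.
  - have -> : L' - 'X_[k] * L = (L' - ('X_[k + u] - 'X_[k + v])) - 'X_[k] * (L - ('X_[u] - 'X_[v])).
      by rewrite !mpolyXD; ring.
    by apply: ordgeB => //; apply: ordgeMl.
(* The first term has order [s.+1] by flatness, and so has the second, a product of orders 1 and
   [s]. *)
have -> : Phi c L' = Phi c (L' - 'X_[k] * L) + (Phi c 'X_[k] - 'X_[pim k]) * Phi c L + 'X_[pim k] * Phi c L.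
  by rewrite rmorphB /= rmorphM /=; ring.
rewrite !cfD (cf_ord t0 hLL) (cf_ord t0) ?addr0 ?add0r.
  by rewrite pimD cf_shift.
apply: (@ordgeM _ _ _ 1 s); last exact: hc.
by have := @PhiX_ord r K c k; rewrite hk.
Qed.

(* A shift by some [h] of large degree makes the binomial liftable; the choice
   of [h] does not matter. *)
Lemma lift_of_indep h h' u v : wgt tS h = 0%N -> wgt tS h' = 0%N -> wgt tS u = 0%N ->
  pim u = pim v -> (n0 <= mdeg h)%N -> (n0 <= mdeg h')%N ->
  cf (Phi c (lift_of (h + u)%MM (h + v)%MM)) (pim (h + u)%MM) w =
  cf (Phi c (lift_of (h' + u)%MM (h' + v)%MM)) (pim (h' + u)%MM) w.
Proof.
move=> hh hh' hu e dh dh'.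
have e' k : pim (k + u)%MM = pim (k + v)%MM by rewrite !pimD e.
have th k : wgt tS k = 0%N -> wgt tS (k + u)%MM = 0%N by rewrite wgtD hu => ->.
have dk k : (n0 <= mdeg k)%N -> (n0 <= mdeg (k + u)%MM)%N.
  by move=> le; rewrite mdegD (leq_trans le) ?leq_addr.
rewrite -(lift_of_shift hh' (th _ hh) (e' h) (dk _ dh)).
rewrite -[RHS](lift_of_shift hh (th _ hh') (e' h') (dk _ dh')).
by rewrite !addmA [(h' + h)%MM]addmC.
Qed.

Let h0 : MS := (U_(pvar r o1) *+ n0)%MM.

Let tS_pow i : wgt tS (U_(pvar r i) *+ n0)%MM = 0%N.
Proof. by rewrite wgtMn wgtU tS_pvar muln0. Qed.

Let mdeg_pow i : (n0 <= mdeg (U_(pvar r i) *+ n0)%MM)%N.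
Proof. by rewrite mdegMn mdeg1 mul1n. Qed.

(* The value on [Y ^ u - Y ^ v] of the homomorphism from the ideal of [X] to its
   coordinate ring given by the extension [Y], in the torus weight [w]. *)
Definition cw u v : K :=
  cf (Phi c (lift_of (h0 + u)%MM (h0 + v)%MM)) (pim (h0 + u)%MM) w.

Lemma cwD u v v' : wgt tS u = 0%N -> pim u = pim v -> pim v = pim v' ->
  cw u v' = cw u v + cw v v'.
Proof.
move=> hu e e'; have hv : wgt tS v = 0%N by rewrite -(pim_tS e).
have addh a b : pim a = pim b -> pim (h0 + a)%MM = pim (h0 + b)%MM by rewrite !pimD => ->.
have th a : wgt tS a = 0%N -> wgt tS (h0 + a)%MM = 0%N by rewrite wgtD tS_pow => ->.
have dh a : (n0 <= mdeg (h0 + a)%MM)%N by rewrite mdegD (leq_trans (mdeg_pow o1)) ?leq_addr.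
have [h1 h2 h3] := lift_ofP (th _ hu) (addh _ _ e) (dh u).
have [h1' h2' h3'] := lift_ofP (th _ hv) (addh _ _ e') (dh v).
have [h1'' h2'' h3''] := lift_ofP (th _ hu) (addh _ _ (etrans e e')) (dh u).
rewrite /cw -(addh _ _ e) -cfD; apply/eqP; rewrite -subr_eq0 -cfB -rmorphD -rmorphB.
apply/eqP/cf_ord; first by rewrite tQ_pim th.
apply: (@Phi_flat (mdeg (h0 + u)%MM)).
- by apply: hprimeB => //; apply: hprimeD.
- by apply: rpredB => //; apply: rpredD => //; rewrite (pim_mdeg (addh _ _ e)).
set L := lift_of _ _ in h3'' *; set L1 := lift_of _ _ in h3 *; set L2 := lift_of _ _ in h3' *.
have -> : L - (L1 + L2) = (L - ('X_[h0 + u] - 'X_[h0 + v'])) -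
   (L1 - ('X_[h0 + u] - 'X_[h0 + v])) - (L2 - ('X_[h0 + v] - 'X_[h0 + v'])) by ring.
by apply: ordgeB => //; apply: ordgeB.
Qed.

Lemma cwE h u v : wgt tS h = 0%N -> (n0 <= mdeg h)%N -> wgt tS u = 0%N -> pim u = pim v ->
  cw u v = cf (Phi c (lift_of (h + u)%MM (h + v)%MM)) (pim (h + u)%MM) w.
Proof. by move=> *; apply: lift_of_indep; rewrite ?tS_pow ?mdeg_pow. Qed.

(** Linearity over the coordinate ring: multiplication by ['X_[k]] moves the exponents of the
    binomial and of its value alike, leaving [w] unchanged. *)
Lemma cw_shift k u v : wgt tS k = 0%N -> wgt tS u = 0%N -> pim u = pim v ->
  cw (k + u)%MM (k + v)%MM = cw u v.
Proof.
move=> hk hu e; rewrite [RHS](@cwE (h0 + k)%MM) ?wgtD ?tS_pow ?hk //.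
  by rewrite /cw !addmA.
by rewrite mdegD (leq_trans (mdeg_pow o1)) ?leq_addr.
Qed.

(** The two binomials are multiplied by ['X_[u']] and ['X_[v]] respectively, and added. *)
Lemma cw_cat u v u' v' : wgt tS u = 0%N -> pim u = pim v -> wgt tS u' = 0%N -> pim u' = pim v' ->
  cw (u + u')%MM (v + v')%MM = cw u v + cw u' v'.
Proof.
move=> hu e hu' e'; have hv : wgt tS v = 0%N by rewrite -(pim_tS e).
have huu' : wgt tS (u + u')%MM = 0%N by rewrite wgtD hu hu'.
have e1 : pim (u + u')%MM = pim (v + u')%MM by rewrite !pimD e.
have e2 : pim (v + u')%MM = pim (v + v')%MM by rewrite !pimD e'.
rewrite (cwD huu' e1 e2) [X in X + _](_ : _ = cw u v); last first.
  by rewrite [(u + u')%MM]addmC [(v + u')%MM]addmC; apply: cw_shift.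
by congr (_ + _); apply: cw_shift.
Qed.

Lemma cw0 u : wgt tS u = 0%N -> cw u u = 0.
Proof.
by move=> hu; have := cwD hu erefl (erefl (pim u)); rewrite -{1}[cw u u]addr0 => /addrI.
Qed.

Lemma cw_supp u v i : wgt tS u = 0%N -> pim u = pim v -> (pim u i)%:Z + w i < 0 -> cw u v = 0.
Proof.
move=> hu e neg.
(* The shift by [h0] in [cw] could hide the negative exponent; a power of [pvar r j] with [x_j]
   distinct from the variable [i] leaves it as it is. *)
have [j hj] : exists j, i != xq r j.
  case: (eqVneq i (xq r o1)) => [->|]; last by exists o1.
  by exists o2.
rewrite (@cwE (U_(pvar r j) *+ n0)%MM) ?tS_pow ?mdeg_pow //.
apply: (@cf_neg _ _ _ _ _ i); rewrite pimD pimMn pimU mnmDE mulmnE.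
by rewrite pvar_neq.
Qed.

Section Chart.

Context (e : 'I_4) (e0 : e != o0).
Local Notation zz := (bvar r e e).

Let zzE : gen zz = (U_(xq r e) *+ 6)%MM.
Proof. by rewrite bvarK // w3111_1 // -mulmS. Qed.

Let chart m : MS := (\sum_(i < 4) U_(bvar r e i) *+ m (xq r i))%MM.

Let chartD m m' : chart (m + m')%MM = (chart m + chart m')%MM.
Proof.
rewrite /chart -big_split; apply: eq_bigr => i _ /=.
by apply/mnmP => j; rewrite !(mnmDE, mulmnE) mulnDr.
Qed.

(** The displacement of [y_a] when the chart coordinates [bvar r e i] are held fixed: the relation
    expresses [y_a] through them, and the powers of [x_e] balance because [gen a] has weight 6. *)
Definition theta (a : 'I_(39 + r)) : K :=
  cw (U_(a) + U_(zz) *+ mdeg (gen a))%MM (chart (gen a) + U_(zz))%MM.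

Let pim_theta a : tS a = 0%N ->
  pim (U_(a) + U_(zz) *+ mdeg (gen a))%MM = pim (chart (gen a) + U_(zz))%MM.
Proof.
move=> ta; rewrite !pimD pimMn !pimU zzE pim_sum; apply/mnmP => j.
have gat := tQ_eq0 (etrans (tS_gen a) ta).
have gx := gen_xsum ta.
have gd : mdeg (gen a) = (\sum_(i < 4) gen a (xq r i))%N.
  rewrite mdegE big_split_ord /= [X in (_ + X)%N]big1 ?addn0 // => k _; exact: gat.
rewrite !mnmDE mnm_sumE.
under eq_bigr do rewrite pimMn pimU bvarK // mulmnE mnmDE mulmnE.
rewrite !mulmnE !mnm1E; case: (split_ordP j) => l ->; last first.
  rewrite big1 => [|i _]; last by rewrite !mnm1E /xq !eq_lrshift.
  by rewrite /xq eq_lrshift !mul0n !addn0 gat.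
under eq_bigr do rewrite !mnm1E !(inj_eq (@lshift_inj _ _)).
rewrite (inj_eq (@lshift_inj _ _)) gd !big_ord4.
move: gx; rewrite big_ord4 /w3111 /=.
move: (e0); case: (ord4_case e) => -> // _; case: (ord4_case l) => -> /=; rewrite -?[lshift r _]/(xq r _); lia.
Qed.

(** The factor [zz] added to [y_a] involves [x_e] only, so at any other variable the exponent is
    still that of [gen a]. *)
Lemma theta_supp a i : tS a = 0%N -> i != xq r e -> (gen a i)%:Z + w i < 0 -> theta a = 0.
Proof.
move=> ta ie neg; apply: (cw_supp (i := i)).
- by rewrite wgtD wgtMn !wgtU ta tS_bvar // muln0.
- exact: pim_theta.
by rewrite pimD pimMn !pimU zzE mnmDE !mulmnE mnm1E eq_sym (negbTE ie) !mul0n addn0.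
Qed.

(** Up to powers of [zz], both monomials are related to the same monomial in the chart coordinates,
    and the values of the relations used add up to [lin theta]. *)
Lemma cw_theta u v : wgt tS u = 0%N -> pim u = pim v ->
  cw u v = lin theta u - lin theta v.
Proof.
have zt (k : nat) : wgt tS (U_(zz) *+ k)%MM = 0%N by rewrite wgtMn wgtU tS_bvar ?muln0.
suff main x : wgt tS x = 0%N ->
   pim (x + U_(zz) *+ mdeg (pim x))%MM = pim (chart (pim x) + U_(zz) *+ mdeg x)%MM /\
   cw (x + U_(zz) *+ mdeg (pim x))%MM (chart (pim x) + U_(zz) *+ mdeg x)%MM =
      lin theta x.
  move=> hu euv; have hv : wgt tS v = 0%N by rewrite -(pim_tS euv).
  have [eu <-] := main u hu; have [ev] := main v hv.
  rewrite -euv -(pim_mdeg euv) in ev * => <-.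
  have tu : wgt tS (u + U_(zz) *+ mdeg (pim u))%MM = 0%N by rewrite wgtD hu zt.
  have e1 : pim (u + U_(zz) *+ mdeg (pim u))%MM = pim (v + U_(zz) *+ mdeg (pim u))%MM.
    by rewrite !pimD euv.
  rewrite (cwD tu e1 ev) addrK ![(_ + U_(zz) *+ _)%MM]addmC.
  by rewrite cw_shift.
elim/mnm_ind: x => [|a|x y IHx IHy].
- move=> _; rewrite pim0 !mdeg0 !mulm0n !addm0 /chart; split.
    by congr pim; rewrite big1 // => i _; rewrite mnm0E mulm0n.
  rewrite (_ : (\sum_(i < 4) _)%MM = 0%MM); last by rewrite big1 // => i _; rewrite mnm0E mulm0n.
  by rewrite cw0 ?wgt0 // lin0.
- rewrite wgtU => ta; rewrite pimU mdeg1 mulm1n; split; first exact: pim_theta.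
  by rewrite linU.
rewrite wgtD => /eqP; rewrite addn_eq0 => /andP[/eqP hx /eqP hy].
have [ex cx] := IHx hx; have [ey cy] := IHy hy.
have E1 : (x + y + U_(zz) *+ mdeg (pim (x + y)))%MM =
    (x + U_(zz) *+ mdeg (pim x) + (y + U_(zz) *+ mdeg (pim y)))%MM.
  by rewrite pimD mdegD; apply/mnmP => i; rewrite !(mnmDE, mulmnE); lia.
have E2 : (chart (pim (x + y)) + U_(zz) *+ mdeg (x + y))%MM =
    (chart (pim x) + U_(zz) *+ mdeg x + (chart (pim y) + U_(zz) *+ mdeg y))%MM.
  by rewrite pimD chartD mdegD; apply/mnmP => i; rewrite !(mnmDE, mulmnE); lia.
rewrite E1 E2; split; first by rewrite pimD ex ey -pimD.
by rewrite cw_cat ?wgtD ?zt ?hx ?hy // cx cy linD.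
Qed.

End Chart.

(* If [w] is negative at [x_1], [x_2] and [x_3], the charts agree because
   [6 a] is a combination of the exponents [pw6 i]. *)
Lemma theta_exists : 6%:R != 0 :> K -> exists th : 'I_(39 + r) -> K,
  (forall u v, wgt tS u = 0%N -> pim u = pim v -> cw u v = lin th u - lin th v) /\
  (forall a i, tS a = 0%N -> (gen a i)%:Z + w i < 0 -> th a = 0).
Proof.
move=> six0; case: (pselect (exists2 e, e != o0 & 0 <= w (xq r e))) => [[e e0 we]|hn].
  (* With [w] nonnegative at [x_e], the condition that [theta_supp] leaves out is void. *)
  exists (theta e); split=> [u v|a i ta neg]; first exact: cw_theta.
  case: (eqVneq i (xq r e)) => [ie|ie]; last exact: theta_supp neg.
  by move: neg; rewrite ie ltNge addr_ge0.
have wneg e : e != o0 -> w (xq r e) < 0.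
  by move=> e0; rewrite ltNge; apply/negP => we; apply: hn; exists e.
(* Some variable of weight one other than [x_e] and [x_i] is absent from the pure power, and [w] is
   negative there. *)
have th_pvar e i : e != o0 -> theta e (pvar r i) = 0.
  move=> e0; have [j [j0 je ji]] : exists j, [/\ j != o0, j != e & j != i].
    case: (ord4_case e) e0 => -> // _; case: (ord4_case i) => ->;
      by [exists o1|exists o2|exists o3].
  apply: (theta_supp e0 (i := xq r j)); rewrite ?tS_pvar //.
  by rewrite pvar_neq ?eq_xq // add0r wneg.
have th12 a : tS a = 0%N -> theta o1 a = theta o2 a.
  move=> ta; have [u [v [tu euv linu linv]]] : exists u v, [/\ wgt tS u = 0%N, pim u = pim v,
      forall e, lin (theta e) u = 6%:R * theta e a &
      forall e, e != o0 -> lin (theta e) v = 0].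
    exists (U_(a) *+ 6)%MM, (\sum_(i < 4) U_(pvar r i) *+ (w3111 i * gen a (xq r i)))%MM; split.
    - by rewrite wgtMn wgtU ta.
    - rewrite pimMn pimU pim_sum; apply/mnmP => j; rewrite mulmnE mnm_sumE.
      under eq_bigr do rewrite pimMn pimU pvarK /pw6 !mulmnE mnm1E.
      case: (split_ordP j) => l ->; last first.
        rewrite big1 => [|i _]; last by rewrite /xq eq_lrshift.
        by rewrite (tQ_eq0 (etrans (tS_gen a) ta)).
      rewrite (bigD1 l) //= eqxx mul1n big1 ?addn0 => [|i hi]; last first.
        by rewrite eq_xq (negbTE hi).
      by rewrite mulnA mulnC; congr (_ * _)%N; rewrite /w3111; case: ifP.
    - by move=> e; rewrite linMn linU.
    - move=> e e0; rewrite (big_morph (lin (theta e)) (linD _) (lin0 _)) big1 // => i _.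
      by rewrite linMn linU th_pvar ?mulr0.
  have key (t1 t2 : 'I_(39 + r) -> K) : cw u v = lin t1 u - lin t1 v ->
      cw u v = lin t2 u - lin t2 v -> lin t1 u = 6%:R * t1 a -> lin t2 u = 6%:R * t2 a ->
      lin t1 v = 0 -> lin t2 v = 0 -> t1 a = t2 a.
    by move=> e1 e2 l1 l2 z1 z2; move: e2; rewrite e1 l1 l2 z1 z2 !subr0 => /(mulfI six0).
  exact: key (cw_theta _ tu euv) (cw_theta _ tu euv) (linu o1) (linu o2) (linv o1 _) (linv o2 _).
exists (theta o1); split=> [u v|a i ta neg]; first exact: cw_theta.
case: (eqVneq i (xq r o1)) => [ie|ie]; last exact: theta_supp neg.
(* The pole along [x_1] is excluded in the chart of [x_2]. *)
rewrite th12 //; apply: theta_supp neg => //; rewrite ie eq_xq //.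
Qed.

End Weight.

Definition wdiff (n m : MQ) (i : 'I_(4 + r)) : int := (n i)%:Z - (m i)%:Z.

Lemma sum_wdiff n m : wgt tQ n = s -> wgt tQ m = 0%N -> \sum_j wdiff n m (tq j) = s%:Z.
Proof.
move=> hn /tQ_eq0 hm; rewrite -hn tQE (rmorph_sum Posz); apply: eq_bigr => j _.
by rewrite /wdiff hm subr0.
Qed.

Context (th : ('I_(4 + r) -> int) -> 'I_(39 + r) -> K).
Context (thE : forall w, \sum_j w (tq j) = s%:Z -> forall u v, wgt tS u = 0%N -> pim u = pim v ->
  cw w u v = lin (th w) u - lin (th w) v).
Context (th_supp : forall w, \sum_j w (tq j) = s%:Z ->
  forall a i, tS a = 0%N -> (gen a i)%:Z + w i < 0 -> th w a = 0).

(** Up to an element of [I] in [(t)], invisible at order [s], ['X_[h] * G] is a combination of the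
    lifts [LL u], whose coefficients are values of [cw]. *)
Lemma Phi_coeff d G n : I G -> G \is d.-homog -> wgt tQ n = s ->
  (Phi c G)@_n = \sum_(u <- msupp G)
     G@_u * (if wgt tS u == 0%N then lin (th (wdiff n (pim u))) u else 0).
Proof.
move=> IG hG hn; pose h : MS := (U_(pvar r o1) *+ n0)%MM.
have hh : wgt tS h = 0%N by rewrite wgtMn wgtU tS_pvar muln0.
have dh : (n0 <= mdeg h)%N by rewrite mdegMn mdeg1 mul1n.
pose LL u := lift_of (h + u)%MM (h + rho (pim u))%MM.
have LLP u : wgt tS u = 0%N -> [/\ I (LL u), LL u \is (mdeg h + mdeg u).-homog &
      ordge tS 1 (LL u - ('X_[h + u] - 'X_[h + rho (pim u)]))].
  move=> hu; rewrite -mdegD; apply: lift_ofP.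
  - by rewrite wgtD hh hu.
  - by rewrite !pimD rhoK.
  - by rewrite mdegD (leq_trans dh) ?leq_addr.
pose W := \sum_(u <- msupp G) G@_u *: (if wgt tS u == 0%N then LL u else 0).
pose D := 'X_[h] * G - W.
have ID : I D.
  apply: hprimeB => //; first exact: hprimeM.
  apply: hprime_sum => // u _; apply: hprimeZ => //; case: eqP => [hu|_]; last exact: hprime0.
  by have [] := LLP u hu.
have hD : D \is (mdeg h + d).-homog.
  apply: rpredB; first by apply: dhomogM => //; rewrite dhomogX.
  rewrite /W big_seq; apply: rpred_sum => u hu; apply: rpredZ; case: eqP => [tu|_]; last exact: rpred0.
  have [_ hL _] := LLP u tu.
  by have du : mdeg u = d := dhomog_mf hG hu; rewrite -du.
(* As [mono G] vanishes modulo [T], this removes the contributions of the representatives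
   [rho (pim u)]. *)
have zero (V : lmodType K) (F : MQ -> V) :
    \sum_(u <- msupp G) G@_u *: (if wgt tS u == 0%N then F (pim u) else 0) = 0.
  under eq_bigr do rewrite -tQ_pim.
  rewrite (regroup (fun m => if wgt tQ m == 0%N then F m else 0)) big1 // => m _.
  case: eqP => e; last by rewrite scaler0.
  by rewrite (si_spec hI IG) ?scale0r // e.
have oD : ordge tS 1 D.
  pose W1 : S := \sum_(u <- msupp G) G@_u *:
    (if wgt tS u == 0%N then LL u - ('X_[h + u] - 'X_[h + rho (pim u)]) else 0).
  pose W2 : S := \sum_(u <- msupp G) G@_u *: (if wgt tS u == 0%N then 'X_[h + rho (pim u)] else 0).
  have E : 'X_[h] * initial 0 G = W - W1 + W2.
    rewrite /initial mulr_sumr -sumrB -big_split; apply: eq_bigr => u _ /=.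
    case: eqP => _; last by rewrite !scaler0 mulr0 subr0 addr0.
    by rewrite -scalerAr -mpolyXD -scalerBr -scalerDr; congr (_ *: _); ring.
  have W20 : W2 = 0 by exact: (zero _ (fun m => 'X_[h + rho m])).
  have -> : D = 'X_[h] * (G - initial 0 G) - W1 by rewrite mulrBr E W20 /D; ring.
  apply: ordgeB.
    by apply: ordgeMl; apply: initial_ord.
  apply: ordge_sum => u _; apply: ordgeZ; case: eqP => [tu|_]; last exact: ordge_0.
  by have [] := LLP u tu.
have tn : wgt tQ (pim h + n)%MM = s by rewrite wgtD tQ_pim hh hn.
have := Phi_flat ID hD oD; move/(_ (pim h + n)%MM); rewrite tn => /(_ (leqnn _)).
rewrite rmorphB rmorphM mcoeffB /=.
have -> : Phi c 'X_[h] * Phi c G = (Phi c 'X_[h] - 'X_[pim h]) * Phi c G + Phi c G * 'X_[pim h] by ring.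
rewrite mcoeffD mcoeffMX (@ordgeM _ _ tQ 1 s _ _ _ (hc IG)) ?add0r ?tn //; last first.
  by have := @PhiX_ord r K c h; rewrite hh.
move/eqP; rewrite subr_eq0 => /eqP ->.
have -> : (Phi c W)@_(pim h + n) = \sum_(u <- msupp G)
    G@_u * (Phi c (if wgt tS u == 0%N then LL u else 0))@_(pim h + n).
  rewrite /W (linear_sum (Phi c)) raddf_sum; apply: eq_bigr => u _.
  by rewrite -mcoeffZ; congr (_@__); apply: (linearZ_LR (Phi c)).
have zeroK := zero K^o (fun m => lin (th (wdiff n m)) (rho m)).
rewrite -[RHS]subr0 -[X in _ = _ - X]zeroK -sumrB; apply: eq_bigr => u _.
rewrite -[_ *: _]/(_ * _) -mulrBr; congr (_ * _).
case: eqP => [tu|_]; last by rewrite rmorph0 mcoeff0 subr0.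
have tpu : wgt tQ (pim u) = 0%N by rewrite tQ_pim.
rewrite -(thE (sum_wdiff hn tpu)) ?rhoK // /cw; apply/esym/cfE => i.
rewrite -/h pimD !mnmDE /wdiff; lia.
Qed.

(* The only torus weights that contribute are those of translations. *)
Lemma th_translation d u a n : mdeg u = d -> wgt tS u = 0%N -> tS a = 0%N ->
  wgt tQ n = s -> wgt w6 n = (6 * d)%N -> th (wdiff n (pim u)) a != 0 ->
  exists m, [/\ (gen a + n = pim u + m)%MM, wgt w6 m = 6%N & wgt tQ m = s].
Proof.
move=> du tu ta tn wn hth.
have tpu : wgt tQ (pim u) = 0%N by rewrite tQ_pim.
have le : (pim u <= gen a + n)%MM.
  apply/mnm_lepP => i; rewrite mnmDE leqNgt; apply: contraNN hth => lt.
  by apply/eqP/(th_supp (sum_wdiff tn tpu) (i := i)) => //; rewrite /wdiff; lia.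
exists (gen a + n - pim u)%MM; rewrite [(pim u + _)%MM]addmC submK //; split=> //.
  have := congr1 (wgt w6) (submK le); rewrite !wgtD wgt_gen wn w6_pim du; lia.
by have := congr1 (wgt tQ) (submK le); rewrite !wgtD tS_gen ta tn tpu addn0.
Qed.

(** A contributing torus weight needs a monomial of weight 6 and degree [s] in [T], but this degree
    alone weighs [6 * s]. *)
Lemma step_high : (1 < s)%N -> forall d G, I G -> G \is d.-homog -> ordge tQ s.+1 (Phi c G).
Proof.
move=> s1 d G IG hG n; rewrite ltnS leq_eqVlt => /orP[/eqP tn|]; last exact: hc.
case: (eqVneq (wgt w6 n) (6 * d)%N) => wn; last first.
  exact: (dhomog_nemf_coeff (mf := wgt w6) (Phi_homog c hG)).
rewrite (Phi_coeff IG hG tn) big_seq big1 // => u hu.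
case: eqP => tu; last by rewrite mulr0.
have du : mdeg u = d := dhomog_mf hG hu.
rewrite /lin big1 ?mulr0 // => a _.
case: (posnP (u a)) => [->|ua]; first by rewrite mul0r.
have ta : tS a = 0%N.
  by move/eqP: tu; rewrite sum_nat_eq0 => /forallP /(_ a); rewrite /= muln_eq0 gtn_eqF // => /eqP.
case: (eqVneq (th (wdiff n (pim u)) a) 0) => [->|]; first by rewrite mulr0.
move=> /(th_translation du tu ta tn wn)[m [_ wm tm]].
by move: wm; rewrite w6E tm; lia.
Qed.

End Step.

(** * Absorbing the translations, and identifying [Y] with the cone *)

Section Conclusion.

Context (r : nat) (K : closedFieldType).
Local Notation S := {mpoly K[39 + r]}.
Local Notation Q := {mpoly K[4 + r]}.
Local Notation MS := 'X_{1..39 + r}.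
Local Notation MQ := 'X_{1..4 + r}.
Implicit Types (u v h : MS) (m : MQ) (f g G H : S) (p q : Q) (c : 'I_39 -> 'I_r -> K).
Local Notation tS := (@tS r).
Local Notation tQ := (@tQ r).
Local Notation w6 := (@w6 r).
Local Notation gen := (@gen r).
Local Notation mono := (@mono r K).

Lemma mono_deriv G a m : (mono (G^`M(a)))@_m =
  \sum_(u <- msupp G) G@_u * ((u a)%:R * (pim (u - U_(a))%MM == m)%:R).
Proof.
have -> : mono (G^`M(a)) = \sum_(u <- msupp G) G@_u *: mono ('X_[u]^`M(a)).
  rewrite {1}[G]mpolyE (linear_sum (mderiv a)) (linear_sum mono); apply: eq_bigr => u _.
  rewrite -[LHS]/(mono (G@_u *: 'X_[u])^`M(a)) mderivZ; exact: monoZ.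
rewrite raddf_sum; apply: eq_bigr => u _.
by rewrite /= mcoeffZ mderivX monoZ mcoeffZ monoX mcoeffX.
Qed.

(** Taylor expansion along [ell c]: the linear term is a derivation over [mono], which gives the
    inductive step for products of monomials. *)
Lemma Phi_first_order c f :
  ordge tQ 2 (Phi c f - mono f - \sum_(a < 39) ell c (lshift r a) * mono (f^`M(lshift r a))).
Proof.
pose A1 f := \sum_(a < 39) ell c (lshift r a) * mono (f^`M(lshift r a)).
rewrite -/(A1 f); pose D f := Phi c f - mono f - A1 f; rewrite -/(D f).
have A1D a f1 f2 : A1 (a *: f1 + f2) = a *: A1 f1 + A1 f2.
  rewrite /A1 scaler_sumr -big_split; apply: eq_bigr => b _ /=.
  by rewrite mderivD mderivZ (rmorphD mono) /= monoZ mulrDr scalerAr.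
have A1_ord f1 : ordge tQ 1 (A1 f1).
  by apply: ordge_sum => a _; apply: ordgeMr; exact: ordge_ell.
have A10 : A1 0 = 0 by rewrite /A1 big1 // => a _; rewrite mderiv0 rmorph0 mulr0.
have DX u : ordge tQ 2 (D 'X_[u]).
  elim/mnm_ind: u => [|i|u v IHu IHv].
  - rewrite /D /A1 mpolyX0 !rmorph1 subrr sub0r big1 ?oppr0 => [|a _]; first exact: ordge_0.
    by rewrite -mpolyC1 mderivC rmorph0 mulr0.
  - rewrite /D /A1 PhiXU monoX pimU ['X_[_] + _]addrC addrK.
    rewrite (_ : \sum_(a < 39) _ = ell c i) ?subrr; first exact: ordge_0.
    under eq_bigr do rewrite mderivX mnm1E monoZ.
    case: (split_ordP i) => a ->.
      rewrite (bigD1 a) //= eqxx scale1r big1 ?addr0 => [|b hb].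
        have -> : (U_(lshift r a) - U_(lshift r a))%MM = 0%MM :> MS.
          by apply/mnmP => l; rewrite mnmBE subnn mnm0E.
        by rewrite mpolyX0 rmorph1 mulr1.
      by rewrite (inj_eq (@lshift_inj _ _)) eq_sym (negbTE hb) scale0r mulr0.
    rewrite big1 => [|b _]; last by rewrite eq_rlshift scale0r mulr0.
    by rewrite /ell split_rshift.
  have -> : D 'X_[u + v] = D 'X_[u] * mono 'X_[v] + (mono 'X_[u] + A1 'X_[u]) * D 'X_[v]
      + D 'X_[u] * (D 'X_[v] + A1 'X_[v]) + A1 'X_[u] * A1 'X_[v].
    have E : A1 'X_[u + v] = A1 'X_[u] * mono 'X_[v] + mono 'X_[u] * A1 'X_[v].
      rewrite /A1 mulr_suml mulr_sumr -big_split; apply: eq_bigr => a _ /=.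
      rewrite mpolyXD mderivM (rmorphD mono) !(rmorphM mono) /=.
      by rewrite mulrDr mulrA mulrCA.
    have alg (pu mu au pv mv av : Q) : pu * pv - mu * mv - (au * mv + mu * av) =
        (pu - mu - au) * mv + (mu + au) * (pv - mv - av) + (pu - mu - au) * (pv - mv - av + av) + au * av.
      by ring.
    rewrite /D E mpolyXD (rmorphM (Phi c)) (rmorphM mono); exact: alg.
  apply: ordgeD; last exact: (@ordgeM _ _ _ 1 1).
  by apply: ordgeD; [apply: ordgeD; [exact: ordgeMr|exact: ordgeMl]|exact: ordgeMr].
elim/mpolyind: f => [|a u f _ _ IH].
  by rewrite /D !rmorph0 A10 !subr0; apply: ordge_0.
have -> : D (a *: 'X_[u] + f) = a *: D 'X_[u] + D f.
  have e1 : Phi c (a *: 'X_[u] + f) = a *: Phi c 'X_[u] + Phi c f.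
    by rewrite -PhiZ; exact: (rmorphD (Phi c)).
  have e2 : mono (a *: 'X_[u] + f) = a *: mono 'X_[u] + mono f.
    by rewrite -monoZ; exact: (rmorphD mono).
  rewrite /D e1.
  rewrite e2.
  rewrite A1D.
  rewrite [X in _ = X + _]scalerBr.
  rewrite [X in _ = X - _ + _]scalerBr.
  have E (x1 x2 x3 y1 y2 y3 : Q) : x1 + y1 - (x2 + y2) - (x3 + y3) = x1 - x2 - x3 + (y1 - y2 - y3).
    by ring.
  exact: E.
exact: ordgeD (ordgeZ a (DX u)) IH.
Qed.

Context (I : S -> Prop) (hI : section_ideal I) (six0 : 6%:R != 0 :> K).

Let pI : hprime I := hI.

Lemma ordge_all c s : (forall d G, I G -> G \is d.-homog -> ordge tQ s (Phi c G)) ->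
  forall G, I G -> ordge tQ s (Phi c G).
Proof.
move=> h G IG; rewrite [G](@pihomog_partitionE _ _ mdeg (msize G)) // rmorph_sum.
by apply: ordge_sum => d _; apply: (h d); [exact: si_homog|exact: pihomogP].
Qed.

Context (n0 : nat).
Context (hn0 : forall u v, wgt tS u = 0%N -> pim u = pim v -> (n0 <= mdeg u)%N -> liftable I u v).

Lemma th_exists c s (hc : forall G, I G -> ordge tQ s (Phi c G)) :
  exists th : ('I_(4 + r) -> int) -> 'I_(39 + r) -> K,
    (forall w, \sum_j w (tq j) = s%:Z -> forall u v, wgt tS u = 0%N -> pim u = pim v ->
       cw I n0 c w u v = lin (th w) u - lin (th w) v) /\
    (forall w, \sum_j w (tq j) = s%:Z ->
       forall a i, tS a = 0%N -> (gen a i)%:Z + w i < 0 -> th w a = 0).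
Proof.
have h (w : 'I_(4 + r) -> int) : exists th : 'I_(39 + r) -> K, \sum_j w (tq j) = s%:Z ->
   (forall u v, wgt tS u = 0%N -> pim u = pim v -> cw I n0 c w u v = lin th u - lin th v) /\
   (forall a i, tS a = 0%N -> (gen a i)%:Z + w i < 0 -> th a = 0).
  case: (pselect (\sum_j w (tq j) = s%:Z)) => hw; last by exists (fun=> 0).
  by have [th hth] := theta_exists hI hn0 hc hw six0; exists th.
have [th hth] := choice h; exists th; split=> w hw; by have [] := hth w hw.
Qed.

Lemma step_one : exists c, forall d G, I G -> G \is d.-homog -> ordge tQ 2 (Phi c G).
Proof.
have hc G : I G -> ordge tQ 1 (Phi (fun _ _ => 0) G) by exact: (si_spec hI).
have [th [thE th_supp]] := th_exists hc.
(* The torus weight that carries the monomial of [y_a] to [T_k]. *)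
pose wt (k : 'I_r) (a : 'I_(39 + r)) (i : 'I_(4 + r)) : int :=
  ((U_(tq k)%MM : MQ) i)%:Z - (gen a i)%:Z.
(* The sign makes the linear term of [Phi_first_order] cancel the coefficient given by
   [Phi_coeff]. *)
pose c (a : 'I_39) (k : 'I_r) : K := - th (wt k (lshift r a)) (lshift r a).
exists c => d G IG hG n; rewrite ltnS leq_eqVlt => /orP[/eqP tn|]; last first.
  move=> lt; rewrite -(subrK (mono G) (Phi c G)) mcoeffD.
  by rewrite (Phi_ord1 c (@ordge0 _ _ _ G)) // (si_spec hI IG) ?addr0.
case: (eqVneq (wgt w6 n) (6 * d)%N) => wn; last first.
  exact: (dhomog_nemf_coeff (mf := wgt w6) (Phi_homog c hG)).
have [k hk] : exists k, (0 < n (tq k))%N.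
  apply: contrapT => /forallNP h; suff : wgt tQ n = 0%N by rewrite tn.
  by rewrite tQE big1 // => k _; apply/eqP; rewrite -leqn0 leqNgt; apply/negP.
have le : (U_(tq k) <= n)%MM by rewrite lep1mP -lt0n.
pose n' := (n - U_(tq k))%MM; have en : n = (n' + U_(tq k))%MM by rewrite submK.
have tn' : wgt tQ n' = 0%N by have := tn; rewrite en wgtD wgtU tQ_t addn1 => -[].
have nt' := tQ_eq0 tn'.
have := Phi_first_order c G; move/(_ n); rewrite tn => /(_ isT).
rewrite !mcoeffB -addrA -opprD => /eqP; rewrite subr_eq0 => /eqP ->.
rewrite [X in _ + X](raddf_sum (mcoeff n)) /=.
have ellE a : (ell c (lshift r a) * mono (G^`M(lshift r a)))@_n =
    \sum_(u <- msupp G) G@_u * (c a k * ((u (lshift r a))%:R * (pim (u - U_(lshift r a))%MM == n')%:R)).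
  rewrite /ell split_lshift mulr_suml raddf_sum (bigD1 k) //= big1 ?addr0 => [|j jk].
    rewrite -scalerAl mcoeffZ ['X_[_] * _]mulrC en addmC mcoeffMX.
    by rewrite mono_deriv big_distrr; apply: eq_bigr => u _ /=; rewrite mulrCA.
  rewrite -scalerAl mcoeffZ; apply/eqP; rewrite mulf_eq0; apply/orP; right; apply/negPn/negP.
  move=> /mcoeffM_neq0[m1 [m2 [e h1 _]]].
  have e1 : U_(tq j)%MM = m1.
    by move: h1; rewrite mcoeffX; case: (eqVneq (U_(tq j))%MM m1) => // _; rewrite eqxx.
  have := congr1 (fun m : MQ => m (tq j)) e; rewrite en -e1 !mnmDE !mnm1E nt' eqxx.
  by rewrite (inj_eq (@rshift_inj _ _)) eq_sym (negbTE jk).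
under [X in _ + X]eq_bigr do rewrite ellE.
rewrite exchange_big /=; have E0 : (mono G)@_n = _ := Phi_coeff hI hn0 hc thE IG hG tn; rewrite {}E0.
rewrite -big_split big_seq big1 // => u hu /=; rewrite -mulr_sumr -mulrDr.
have du : mdeg u = d := dhomog_mf hG hu.
apply/eqP; rewrite mulf_eq0; apply/orP; right; apply/eqP.
have shape (a : 'I_39) : (0 < u (lshift r a))%N ->
    (pim (u - U_(lshift r a)) == n')%MM = (gen (lshift r a) + n' == pim u)%MM.
  move=> ua; have {}ua : (U_(lshift r a) <= u)%MM by rewrite lep1mP -lt0n.
  by rewrite -[in RHS](submK ua) pimD pimU [(_ + gen _)%MM]addmC eqm_add2l eq_sym.
case: eqP => tu; last first.
  rewrite add0r big1 // => a _; case: (posnP (u (lshift r a))) => [->|ua]; first by rewrite mul0r mulr0.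
  rewrite shape //; case: eqP => [e|]; last by rewrite !mulr0.
  by case: tu; rewrite -tQ_pim -e wgtD tS_gen tS_y tn'.
rewrite /lin big_split_ord /= [X in _ + X + _]big1 ?addr0 => [|j _]; last first.
  move/eqP: tu; rewrite sum_nat_eq0 => /forallP /(_ (rshift 39 j)).
  by rewrite /= tS_t muln1 => /eqP ->; rewrite mul0r.
rewrite -big_split big1 // => a _ /=.
case: (posnP (u (lshift r a))) => [->|ua]; first by rewrite !mul0r mulr0 addr0.
rewrite shape //; case: eqP => [e|ne].
  have -> : wdiff n (pim u) = wt k (lshift r a).
    by apply/funext => i; rewrite /wdiff /wt -e en !mnmDE !PoszD; ring.
  by rewrite mulr1 /c mulNr mulrC subrr.
rewrite !mulr0 addr0; case: (eqVneq (th (wdiff n (pim u)) (lshift r a)) 0) => [->|]; first by rewrite mulr0.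
move=> /(th_translation th_supp du tu (tS_y r a) tn wn)[m [em wm tm]]; case: ne.
(* A single [T] uses up the weight 6, and comparison of exponents shows that it is [T_k]. *)
have em' : m = U_(tq k)%MM.
  have tpu : wgt tQ (pim u) = 0%N by rewrite tQ_pim.
  have gt := tQ_eq0 (etrans (tS_gen (lshift r a)) (tS_y r a)); have ut := tQ_eq0 tpu.
  apply: mnmQP => j.
    rewrite mnm1E /xq eq_rlshift; move: wm; rewrite w6E tm /=.
    by case: (ord4_case j) => ->; rewrite -?[lshift r _]/(xq r _); lia.
  by have := congr1 (fun m : MQ => m (tq j)) em; rewrite en !mnmDE nt' gt ut.
by move: em; rewrite en em' addmA => /addIm.
Qed.

(** From order 2 on nothing is left to absorb, so the same [c] serves at all orders. *)
Lemma Phi_kernel : exists c, forall G, I G -> Phi c G = 0.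
Proof.
have [c hc] := step_one; exists c => G IG.
have main s : forall G, I G -> ordge tQ s.+2 (Phi c G).
  elim: s => [|s IH]; first exact: (ordge_all hc).
  have [th [thE th_supp]] := th_exists IH; apply: ordge_all => d G' IG' hG'.
  exact: (step_high hI hn0 IH thE th_supp) hG'.
by apply/mpolyP => m; rewrite mcoeff0; apply: (main (wgt tQ m) G IG); rewrite ltnS leqnSn.
Qed.

(** Restriction to the first [j] coordinates; composed with [Phi c], it yields a flag of primes
    above the kernel of [Phi c]. *)
Definition kill (j : nat) : Q -> Q := comp_mpoly [tuple if (i < j)%N then 'X_i else 0 | i < 4 + r].
HB.instance Definition _ j := GRing.RMorphism.copy (kill j)
  (comp_mpoly [tuple if (i < j)%N then 'X_i else 0 | i < 4 + r]).

Lemma killXU j i : kill j 'X_i = if (i < j)%N then 'X_i else 0.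
Proof. by rewrite /kill comp_mpolyXU -tnth_nth tnth_mktuple. Qed.

Lemma killX j i e : kill j 'X_[U_(i) *+ e] = (if (i < j)%N then 'X_i else 0) ^+ e.
Proof. by rewrite -mpolyXn rmorphXn /= killXU. Qed.

Lemma kill_kill j l p : (j <= l)%N -> kill j (kill l p) = kill j p.
Proof.
move=> jl; elim/mpolyind: p => [|a u p _ _ IH]; first by rewrite !rmorph0.
rewrite !rmorphD /= IH; congr (_ + _).
have killZ i b q : kill i (b *: q) = b *: kill i q by exact: comp_mpolyZ.
rewrite !killZ; congr (_ *: _).
elim/mnm_ind: u => [|i|u v IHu IHv]; first by rewrite !mpolyX0 !rmorph1.
  rewrite !killXU; case: (ltnP i l) => il; first by rewrite killXU.
  by rewrite rmorph0 ltnNge (leq_trans jl il).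
by rewrite !mpolyXD !rmorphM /= IHu IHv.
Qed.

(** For [x_j], the variable of its pure power is corrected by the shear. These linear forms separate
    the primes of the flag. *)
Lemma Phi_pow c (i : 'I_(4 + r)) : exists F e,
  [/\ F \is 1.-homog, (0 < e)%N & Phi c F = 'X_[U_(i) *+ e]].
Proof.
case: (split_ordP i) => j ->; last first.
  exists 'X_(rshift 39 j), 1%N; split=> //; first by rewrite dhomogX /= mdeg1.
  by rewrite PhiXU /gen /ell split_rshift addr0.
have pv : gen (pvar r j) = (U_(xq r j) *+ (6 %/ w3111 j))%MM by rewrite pvarK.
have e0 : (0 < 6 %/ w3111 j)%N by rewrite /w3111; case: ifP.
have [a ea] : exists a, pvar r j = lshift r a.
  case: (split_ordP (pvar r j)) (tS_pvar r j) => [a ->|k ->]; first by exists a.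
  by rewrite tS_t.
exists ('X_(pvar r j) - \sum_k c a k *: 'X_(rshift 39 k)), (6 %/ w3111 j)%N; split=> //.
  apply: rpredB; first by rewrite dhomogX /= mdeg1.
  by apply: rpred_sum => k _; apply: rpredZ; rewrite dhomogX /= mdeg1.
have E : Phi c (\sum_k c a k *: 'X_(rshift 39 k)) = \sum_k c a k *: 'X_(tq k).
  rewrite (linear_sum (Phi c)); apply: eq_bigr => k _.
  by rewrite -[LHS]/(Phi c (c a k *: 'X_(rshift 39 k))) PhiZ PhiXU /gen /ell split_rshift addr0.
by rewrite (rmorphB (Phi c)) /= E PhiXU pv /ell ea split_lshift addrK.
Qed.

(* Otherwise [Y] would properly contain a cone of its own dimension. *)
Lemma kernel_sub c : (forall G, I G -> Phi c G = 0) ->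
  forall d G, G \is d.-homog -> Phi c G = 0 -> I G.
Proof.
move=> hc d G hG G0; apply: contrapT => nG.
have /fin_all_exists[F /fin_all_exists[e hF]] := Phi_pow c.
have d0 : (0 < d)%N.
  case: (posnP d) => // d0; case: nG; rewrite d0 in hG.
  have GE : G = (G@_0)%:MP.
    apply/mpolyP => m; rewrite mcoeffC; case: (eqVneq m 0%MM) => [->|m0]; first by rewrite mulr1.
    by rewrite mulr0; apply: dhomog_nemf_coeff hG _; rewrite mdeg_eq0.
  have := G0; rewrite GE /Phi comp_mpolyC => /eqP; rewrite mpolyC_eq0 => /eqP ->.
  by rewrite mpolyC0; apply: hprime0.
have [C hC] := hilbert_dim hI hn0.
(* The [4 + r] kernels followed by [I], with [G] separating the last two, form a chain longer than
   the growth in [hilbert_dim] permits. *)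
pose p i : S -> Prop := if i == (4 + r)%N then I else fun f => kill i.+1 (Phi c f) = 0.
pose FF i : S := if insub i is Some i' then F i' else G.
pose ee i := if (i < 4 + r)%N then 1%N else d.
have FFi i (lt : (i < 4 + r)%N) : FF i = F (Ordinal lt) by rewrite /FF insubT.
have FFn : FF (4 + r)%N = G by rewrite /FF insubF // ltnn.
have pn : p (4 + r)%N = I by rewrite /p eqxx.
have pi i : (i < 4 + r)%N -> p i = (fun f => kill i.+1 (Phi c f) = 0).
  by rewrite /p => lt; rewrite ltn_eqF.
suff : (4 + r <= 3 + r)%N by rewrite leq_add2r.
apply: (@chain_bound (39 + r) K (4 + r) (3 + r) C p FF ee).
- move=> i; rewrite leq_eqVlt => /orP[/eqP ->|lt]; first by rewrite pn.
  rewrite pi //; split.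
  + by rewrite !rmorph0.
  + by move=> f g h1 h2; rewrite (rmorphD (Phi c)) (rmorphD (kill i.+1)) /= h1 h2 addr0.
  + by move=> f g h; rewrite (rmorphM (Phi c)) (rmorphM (kill i.+1)) /= h mulr0.
  + move=> _ _ f g _ _; rewrite (rmorphM (Phi c)) (rmorphM (kill i.+1)) => /eqP; rewrite mulf_eq0.
    by case/orP => /eqP; [left|right].
- move=> i lt f; rewrite [p i]pi //; move: lt; rewrite leq_eqVlt => /orP[/eqP e1|lt].
    by rewrite e1 pn => /hc ->; rewrite rmorph0.
  rewrite pi // => h.
  by rewrite -(@kill_kill _ i.+2) // h rmorph0.
- move=> i; rewrite leq_eqVlt => /orP[/eqP ->|lt]; first by rewrite FFn /ee ltnn.
  by rewrite /ee lt FFi; have [] := hF (Ordinal lt).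
- by move=> i _; rewrite /ee; case: ifP.
- rewrite pi // (FFi 0%N isT).
  have [_ e0 ->] := hF (Ordinal (isT : (0 < 4 + r)%N)); rewrite killX /=.
  by apply/eqP; rewrite expf_neq0 // -msupp_eq0 msuppX.
- move=> i lt; rewrite pi //; move: (lt); rewrite leq_eqVlt => /orP[/eqP e1|lt'].
    by rewrite e1 FFn G0 rmorph0.
  rewrite FFi; have [_ e0 ->] := hF (Ordinal lt').
  by rewrite killX /= ltnn expr0n gtn_eqF.
move=> i lt; move: (lt); rewrite leq_eqVlt => /orP[/eqP e1|lt']; first by rewrite e1 pn FFn.
rewrite pi // FFi; have [_ e0 ->] := hF (Ordinal lt').
rewrite killX /= ltnSn; apply/eqP; rewrite expf_neq0 // -msupp_eq0 msuppX //.
rewrite pn; exact: hC.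
Qed.

End Conclusion.

(** * Projective sets *)

Section LinearSubstitution.

Context (K : closedFieldType).

Definition linsub n m (M : 'M[K]_(n, m)) (G : {mpoly K[m]}) : {mpoly K[n]} :=
  G \mPo [tuple \sum_(j < n) M j i *: 'X_j | i < m].

Lemma linsub_eval n m (M : 'M[K]_(n, m)) G (z : 'rV[K]_n) :
  (linsub M G).@[z 0] = G.@[(z *m M) 0].
Proof.
rewrite /linsub comp_mpoly_meval; apply: meval_eq => i.
rewrite tnth_mktuple mxE (raddf_sum (meval (z 0))) /=; apply: eq_bigr => j _.
by rewrite mevalZ mevalXU mulrC.
Qed.

Lemma linsub_homog n m (M : 'M[K]_(n, m)) d G : G \is d.-homog -> linsub M G \is d.-homog.
Proof.
move=> hG; rewrite /linsub comp_mpolyE big_seq; apply: rpred_sum => u hu; apply: rpredZ.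
have <- : mdeg u = d := dhomog_mf hG hu.
elim/mnm_ind: u {hu} => [|i|u v IHu IHv].
- by rewrite big1 ?mdeg0 ?dhomog1 // => i _; rewrite mnm0E expr0.
- rewrite (bigD1 i) //= mnm1E eqxx expr1 big1 ?mulr1 => [|j hj].
    by rewrite tnth_mktuple mdeg1; apply: rpred_sum => j _; apply: rpredZ; rewrite dhomogX /= mdeg1.
  by rewrite mnm1E eq_sym (negbTE hj) expr0.
- under eq_bigr do rewrite mnmDE exprD.
  by rewrite big_split mdegD; apply: dhomogM.
Qed.

Lemma exists_compl m n (A : 'M[K]_(m, m + n)) : row_free A ->
  exists C : 'M[K]_(n, m + n), col_mx A C \in unitmx.
Proof.
move=> fA; have e : \rank (A^C)%MS = n.
  by rewrite mxrank_compl (eqP fA) addKn.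
move: (row_base (A^C)%MS) (eq_row_base (A^C)%MS); rewrite e => C hC.
exists C; rewrite -row_full_unit -sub1mx -addsmxE.
by rewrite (adds_eqmx (eqmx_refl A) hC) sub1mx addsmx_compl_full.
Qed.

(** Setting the last [b] variables to zero gives a polynomial that vanishes everywhere, hence
    zero. *)
Lemma cut_fun0 a b (p : {mpoly K[a + b]}) :
  (forall v, (forall k, v (rshift a k) = 0) -> p.@[v] = 0) ->
  ordge (fun i => if split i is inr _ then 1%N else 0%N) 1 p.
Proof.
move=> hp; pose cut : {mpoly K[a + b]} -> {mpoly K[a + b]} :=
  comp_mpoly [tuple if split i is inl _ then 'X_i else 0 | i < a + b].
set w := fun i => _.
have cut0 : cut p = 0.
  apply: mpoly_fun0 => v; rewrite /cut comp_mpoly_meval.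
  rewrite -[RHS](hp (fun i => if split i is inl _ then v i else 0)); last first.
    by move=> k; rewrite split_rshift.
  apply: meval_eq => i; rewrite tnth_mktuple; case: split => _; rewrite ?mevalXU //.
  by rewrite raddf0.
have cutX u : cut 'X_[u] = if wgt w u == 0%N then 'X_[u] else 0.
  elim/mnm_ind: u => [|i|u v IHu IHv].
  - by rewrite wgt0 eqxx mpolyX0 /cut rmorph1.
  - rewrite wgtU /cut comp_mpolyXU -tnth_nth tnth_mktuple /w.
    by case: split.
  - rewrite mpolyXD {1}/cut rmorphM /= -/cut -/(cut _) -/(cut _) IHu IHv wgtD addn_eq0.
    by case: eqP => _; case: eqP => _; rewrite /= ?mul0r ?mulr0 // mpolyXD.
move=> m; rewrite ltnS leqn0 => /eqP hm; rewrite -[RHS](mcoeff0 K m) -cut0.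
have -> : cut p = \sum_(u <- msupp p) p@_u *: cut 'X_[u] by rewrite /cut comp_mpolyEX.
rewrite {1}[p]mpolyE !(raddf_sum (mcoeff m)) /=; apply: eq_bigr => u _.
rewrite cutX !mcoeffZ; congr (_ * _).
case: (eqVneq (wgt w u) 0%N) => // wu; rewrite mcoeff0 mcoeffX.
by case: (eqVneq u m) => // e; rewrite e hm eqxx in wu.
Qed.

Lemma root6 (b : K) : exists c, c ^+ 6 = b.
Proof.
have /closed_rootP[c] : size ('X^6 - b%:P) != 1%N by rewrite size_XnsubC.
by rewrite /root !hornerE subr_eq0 => /eqP <-; exists c.
Qed.

Lemma line_poly n (p : {mpoly K[n]}) (a b : 'I_n -> K) :
  exists f : {poly K}, forall t, f.[t] = p.@[fun i => a i + t * (b i - a i)].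
Proof.
exists (\sum_(m <- msupp p) p@_m *: \prod_i ((a i)%:P + 'X * (b i - a i)%:P) ^+ m i) => t.
rewrite mevalE horner_sum; apply: eq_bigr => m _; rewrite hornerZ horner_prod.
by congr (_ * _); apply: eq_bigr => i _; rewrite horner_exp !hornerE.
Qed.

End LinearSubstitution.

Section ProjectiveSets.

Context (K : closedFieldType) (N : nat).
Implicit Types (Z : set 'rV[K]_N.+1).

Lemma closed_neq0 Z p : proj_closed Z -> Z p -> p != 0.
Proof. by move=> [S _ ->] []. Qed.

Lemma closed_scale Z p c : proj_closed Z -> c != 0 -> Z p -> Z (c *: p).
Proof.
move=> [S hS ->] c0 [p0 hp]; split; first by rewrite scaler_eq0 negb_or c0.
by move=> F SF; have [d hd] := hS F SF; rewrite (meval_homogZ _ _ hd) hp // mulr0.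
Qed.

Context (B : 'M[K]_N.+1) (uB : B \in unitmx).

(** Points are written [z *m B] so that, for the right [B], the linear section becomes [t = 0]. *)
Definition ideal_of Z (G : {mpoly K[N.+1]}) : Prop :=
  forall z : 'rV[K]_N.+1, Z (z *m B) -> G.@[z 0] = 0.

Lemma ideal_of_prime Z : proj_closed Z -> proj_irreducible Z -> hprime (ideal_of Z).
Proof.
move=> cZ [_ irr]; split.
- by move=> z _; rewrite meval0.
- by move=> f g hf hg z Zz; rewrite mevalD hf // hg // addr0.
- by move=> f g hg z Zz; rewrite mevalM hg // mulr0.
move=> d e f g hf hg hfg.
pose V (h : {mpoly K[N.+1]}) := zero_locus [set F | F = linsub (invmx B) h]%classic.
have cV i h : h \is i.-homog -> proj_closed (V h).
  by move=> hh; exists [set F | F = linsub (invmx B) h]%classic => // F ->; exists i; apply: linsub_homog.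
have VE h : (Z `<=` V h)%classic -> ideal_of Z h.
  move=> sub z Zz; have [_ /(_ _ erefl)] := sub _ Zz.
  by rewrite linsub_eval -mulmxA mulmxV // mulmx1.
have cov : (Z `<=` V f `|` V g)%classic.
  move=> p Zp; have p0 := closed_neq0 cZ Zp.
  have := hfg (p *m invmx B); rewrite -mulmxA mulVmx // mulmx1 => /(_ Zp) /eqP.
  by rewrite mevalM mulf_eq0 => /orP[] /eqP h; [left|right]; split=> // F ->; rewrite linsub_eval.
by have [/VE|/VE] := irr _ _ (cV _ _ hf) (cV _ _ hg) cov; [left|right].
Qed.

Lemma ideal_of_homog Z d f : proj_closed Z -> ideal_of Z f -> ideal_of Z (pihomog mdeg d f).
Proof.
move=> cZ hf z Zz.
pose q : {poly K} := \poly_(i < msize f) (pihomog mdeg i f).@[z 0].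
(* Only nonzero [t] preserve [Z]; the factor ['X] takes care of [t = 0]. *)
have hq t : ('X * q).[t] = 0.
  rewrite hornerM hornerX; case: (eqVneq t 0) => [->|t0]; first by rewrite mul0r.
  have E : \sum_(i < msize f) (pihomog mdeg i f).@[(t *: z) 0] = 0.
    rewrite -(raddf_sum (meval ((t *: z) 0))) /= -pihomog_partitionE //.
    by apply: hf; rewrite -scalemxAl; apply: closed_scale.
  rewrite horner_poly; apply/eqP; rewrite mulf_eq0; apply/orP; right; apply/eqP.
  rewrite -[RHS]E; apply: eq_bigr => i _.
  by rewrite (meval_homogZ _ _ (pihomogP mdeg i f)) mulrC.
have /eqP := closed_poly_fun0 hq; rewrite mulf_eq0 polyX_eq0 => /eqP q0.
case: (ltnP d (msize f)) => hd.
  by have := congr1 (fun p : {poly K} => p`_d) q0; rewrite coef_poly hd coef0.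
rewrite (_ : pihomog mdeg d f = 0) ?meval0 //; apply/mpolyP => m.
rewrite mcoeff_pihomog mcoeff0; case: eqP => // dm; apply/memN_msupp_eq0.
by have e : mdeg m = d := dm; apply: msize_mdeg_ge; rewrite e.
Qed.

Lemma ideal_of_sub Z Z' f : (Z `<=` Z')%classic -> ideal_of Z' f -> ideal_of Z f.
Proof. by move=> sub hf z /sub; apply: hf. Qed.

Lemma ideal_of_separate Z Z' : proj_closed Z -> proj_irreducible Z -> proj_closed Z' ->
  (Z `<` Z')%classic ->
  exists F e, [/\ F \is e.-homog, (0 < e)%N, ideal_of Z F & ~ ideal_of Z' F].
Proof.
move=> [S hS ZE] [[p Zp] _] cZ' [_ nsub].
have [q Z'q nZq] : exists2 q, Z' q & ~ Z q.
  by apply: contrapT => h; apply: nsub => q Z'q; apply: contrapT => nq; apply: h; exists q.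
have [F SF Fq] : exists2 F, S F & F.@[q 0] != 0.
  apply: contrapT => h; apply: nZq; rewrite ZE; split; first exact: closed_neq0 Z'q.
  by move=> F SF; apply: contrapT => /eqP Fq; apply: h; exists F.
have FZ p' : Z p' -> F.@[p' 0] = 0 by rewrite ZE => -[_]; apply.
have [e he] := hS F SF; exists (linsub B F), e; split.
- exact: linsub_homog.
(* A form of degree 0 vanishing at a point of [Z] vanishes at [q] as well. *)
- case: (posnP e) => // e0; rewrite e0 in he; case/eqP: Fq.
  have := meval_homogZ 0 q he; rewrite expr0 mul1r => <-.
  by have := meval_homogZ 0 p he; rewrite expr0 mul1r FZ // !scale0r.
- by move=> z Zz; rewrite linsub_eval FZ.
- move=> /(_ (q *m invmx B)); rewrite linsub_eval -mulmxA mulVmx // mulmx1 => /(_ Z'q).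
  by apply/eqP.
Qed.

Lemma ideal_of_coord Z : proj_closed Z -> proj_irreducible Z -> exists2 F, F \is 1.-homog & ~ ideal_of Z F.
Proof.
move=> cZ [[p Zp] _].
have [z zB] : exists z, z *m B = p.
  by exists (p *m invmx B); rewrite -mulmxA mulVmx // mulmx1.
have [j zj] : exists j, z 0 j != 0.
  apply: contrapT => /forallNP h; have /eqP := closed_neq0 cZ Zp; apply.
  rewrite -zB (_ : z = 0) ?mul0mx //; apply/rowP => j; rewrite mxE.
  by apply/eqP/negPn/negP; exact: h.
exists 'X_j; first by rewrite dhomogX /= mdeg1.
by move=> /(_ z); rewrite zB => /(_ Zp) /eqP; rewrite mevalXU (negbTE zj).
Qed.

End ProjectiveSets.

Section Dimension.

Context (K : closedFieldType) (N : nat).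
Implicit Types (Z : set 'rV[K]_N.+1).

(** The ideals of the [Z i] form a chain of primes for [chain_bound]. A list that spans modulo the
    ideal of [Y] spans modulo that of [Z D], which contains it. *)
Lemma chain_dim (B : 'M[K]_N.+1) (Y : set 'rV[K]_N.+1) D (Z : nat -> set 'rV[K]_N.+1) : B \in unitmx -> irr_chain Y D Z ->
  forall q C : nat, (forall n, exists2 Bs : seq {mpoly K[N.+1]}, (size Bs <= C * n.+1 ^ q)%N &
     forall f, f \is n.-homog -> spans (ideal_of B Y) Bs f) -> (D <= q)%N.
Proof.
move=> uB [hZ hlt] q C hC.
pose p i := ideal_of B (Z i).
have /choice[Fe hFe] (i : nat) : exists Fe : {mpoly K[N.+1]} * nat, (i <= D)%N ->
    [/\ Fe.1 \is Fe.2.-homog, (0 < Fe.2)%N, ~ p i Fe.1 & if i is j.+1 then p j Fe.1 else True].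
  case: (ltnP D i) => Di; first by exists (0, 0%N).
  case: i Di => [|i] Di.
    have [cZ iZ _] := hZ 0%N Di; have [F h1 h2] := ideal_of_coord uB cZ iZ.
    by exists (F, 1%N).
  have [cZ iZ _] := hZ i (ltnW Di); have [cZ' _ _] := hZ i.+1 Di.
  have [F [e [h1 h2 h3 h4]]] := ideal_of_separate uB cZ iZ cZ' (hlt i Di).
  by exists (F, e).
apply: (@chain_bound N.+1 K D q C p (fun i => (Fe i).1) (fun i => (Fe i).2)).
- by move=> i hi; have [cZ iZ _] := hZ i hi; apply: ideal_of_prime.
- by move=> i hi f; apply: ideal_of_sub; have [] := hlt i hi.
- by move=> i hi; have [] := hFe i hi.
- by move=> i hi; have [] := hFe i hi.
- by have [] := hFe 0%N (leq0n _).
- by move=> i hi; have [] := hFe i.+1 hi.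
- by move=> i hi; have [] := hFe i.+1 hi.
move=> n; have [Bs sB hB] := hC n; exists Bs => // f /hB[a ha]; exists a.
by have [_ _ sub] := hZ D (leqnn D); apply: ideal_of_sub sub ha.
Qed.

(** Parameters where [F] and [G] do not vanish are joined by a line in [W]; at some point of it
    both, and a coordinate of [psi], are nonzero. *)
Lemma param_irreducible n (P : 'I_N.+1 -> {mpoly K[n]}) (W : set 'rV[K]_n) Z :
  let psi (x : 'rV[K]_n) : 'rV[K]_N.+1 := \row_i (P i).@[x 0] in
  (forall a b t, W a -> W b -> W (a + t *: (b - a))) ->
  (exists y, Z y) -> (forall y, Z y -> y != 0) ->
  (forall y, Z y -> exists x c, W x /\ y = c *: psi x) ->
  (forall x, W x -> psi x != 0 -> Z (psi x)) -> proj_irreducible Z.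
Proof.
move=> psi hW nZ Z0 hZ1 hZ2; split=> // Z1 Z2 [S1 hS1 ->] [S2 hS2 ->] hcov.
apply: contrapT => /not_orP[/existsNP[p /not_implyP[Zp np]] /existsNP[q /not_implyP[Zq nq]]].
have pick S z : Z z -> (forall F, S F -> exists d : nat, F \is d.-homog) -> ~ zero_locus S z ->
    exists F a, [/\ S F, W a, psi a != 0 & F.@[psi a 0] != 0].
  move=> Zz hS nz; have z0 := Z0 z Zz; have [a [c [Wa za]]] := hZ1 z Zz.
  have [F /not_implyP[SF Fz]] : exists F, ~ (S F -> F.@[z 0] = 0).
    by apply/existsNP => h; apply: nz; split.
  exists F, a; split=> //; first by apply: contraNneq z0; rewrite za => ->; rewrite scaler0.
  apply: contra_notN Fz => /eqP Fa.
  by have [d hd] := hS _ SF; rewrite za (meval_homogZ _ _ hd) Fa mulr0.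
have [F [a [SF Wa pa Fa]]] := pick _ _ Zp hS1 np.
have [G [b [SG Wb pb Gb]]] := pick _ _ Zq hS2 nq.
have [j aj] : exists j, psi a 0 j != 0.
  apply: contrapT => /forallNP h; move/eqP: pa; apply; apply/rowP => j.
  by rewrite [RHS]mxE; apply/eqP/negPn/negP; exact: h.
pose comp (H : {mpoly K[N.+1]}) : {mpoly K[n]} := H \mPo [tuple P i | i < N.+1].
have compE H (x : 'rV[K]_n) : (comp H).@[x 0] = H.@[psi x 0].
  by rewrite /comp comp_mpoly_meval; apply: meval_eq => i; rewrite tnth_mktuple mxE.
pose x t := a + t *: (b - a).
have xE t : (fun i => a 0 i + t * (b 0 i - a 0 i)) =1 x t 0 by move=> i; rewrite !mxE.
have x0 : x 0 = a by rewrite /x scale0r addr0.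
have x1 : x 1 = b by rewrite /x scale1r addrC subrK.
have [f hf] := line_poly (comp F) (a 0) (b 0).
have [g hg] := line_poly (comp G) (a 0) (b 0).
have [l hl] := line_poly (P j) (a 0) (b 0).
have {}hf t : f.[t] = F.@[psi (x t) 0] by rewrite hf (meval_eq _ (xE t)) compE.
have {}hg t : g.[t] = G.@[psi (x t) 0] by rewrite hg (meval_eq _ (xE t)) compE.
have {}hl t : l.[t] = psi (x t) 0 j by rewrite hl (meval_eq _ (xE t)) mxE.
have f0 : f != 0 by apply: contraNneq Fa => f0; rewrite -x0 -hf f0 horner0.
have g0 : g != 0 by apply: contraNneq Gb => g0; rewrite -x1 -hg g0 horner0.
have l0 : l != 0 by apply: contraNneq aj => l0; rewrite -x0 -hl l0 horner0.
have /closed_nonrootP[t] : l * f * g != 0 by rewrite !mulf_neq0.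
rewrite /root !hornerM !mulf_eq0 !negb_or hf hg hl => /andP[/andP[lt ft] gt].
have Zt : Z (psi (x t)).
  apply: hZ2; first exact: hW.
  by apply: contraNneq lt => ->; rewrite mxE.
case: (hcov _ Zt) => -[_ h].
  by move/eqP: ft; apply; apply: (h F).
by move/eqP: gt; apply; apply: (h G).
Qed.

End Dimension.

(** * Points and dimension of the anticanonical image *)

Section Anticanonical.

Context (K : closedFieldType).
Local Notation X := (anticanonical_P3111 K).
Local Notation phi := (@monomial_map K 3 38 wmon6).

Lemma phiE x a : phi x 0 a = \prod_i x 0 i ^+ tnth wmon6 a i.
Proof. by rewrite mxE mevalX. Qed.

Lemma phi0 : phi 0 = 0.
Proof.
apply/rowP => a; rewrite phiE [RHS]mxE.
have [i hi] : exists i, (0 < tnth wmon6 a i)%N.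
  apply: contrapT => /forallNP h; have := wdeg_wmon6 a; rewrite /wdeg big1 // => i _.
  by apply/eqP; rewrite muln_eq0 -leqn0 leqNgt; apply/orP; left; apply/negP; exact: h.
by rewrite (bigD1 i) //= mxE expr0n gtn_eqF // mul0r.
Qed.

Lemma phi_in_X x : phi x != 0 -> pv_set X (phi x).
Proof.
move=> h; split=> //; exists x, 1; rewrite scale1r; split=> //.
by apply: contraNneq h => ->; rewrite phi0.
Qed.

(** A sixth root of [c] acts by weighted scaling; so the affine cone over [X] is just the image of
    [phi]. *)
Lemma phi_scale x c : exists x', c *: phi x = phi x'.
Proof.
have [t <-] := root6 c; exists (wscale w3111 t x).
by rewrite (monomial_map_wscale (w := w3111) (d := 6)) // => i; exact: wdeg_wmon6.
Qed.

Lemma X_phi y : pv_set X y -> exists x, y = phi x.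
Proof.
move=> [_ [x [c [_ ->]]]]; have [x' e] := phi_scale x c; by exists x'.
Qed.

Lemma pure_power i : exists a, tnth wmon6 a = (U_(i) *+ (6 %/ w3111 i))%MM.
Proof.
have /tnthP[a ->] : (U_(i) *+ (6 %/ w3111 i))%MM \in wmon6; last by exists a.
rewrite mem_wmonomials /wdeg (bigD1 i) //= big1 => [|j hj].
  by rewrite addn0 mulmnE mnm1E eqxx /w3111; case: ifP.
by rewrite mulmnE mnm1E eq_sym (negbTE hj).
Qed.

(** Written by equations, the image of the subspace where [x_i = 0] for [i > j]; the four strata
    bound the dimension of [X] from below. *)
Let stratum (j : nat) : set 'rV[K]_39 := fun y => pv_set X y /\
  forall a, (exists2 i : 'I_4, (j < i)%N & (0 < tnth wmon6 a i)%N) -> y 0 a = 0.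

Let stratumP j y : stratum j y <-> y != 0 /\
  exists2 x : 'rV[K]_4, (forall i : 'I_4, (j < i)%N -> x 0 i = 0) & y = phi x.
Proof.
split=> [[Xy hy]|[+ [x hx e]]]; last rewrite {}e => y0.
  split; first exact: closed_neq0 (pv_closed X) Xy.
  have [x ex] := X_phi Xy; exists x => // i ji.
  have [a ea] := pure_power i.
  have e0 : (0 < 6 %/ w3111 i)%N by rewrite /w3111; case: ifP.
  have : y 0 a = 0.
    by apply: hy; exists i => //; rewrite ea mulmnE mnm1E eqxx mul1n.
  rewrite ex phiE ea (bigD1 i) //= big1 => [|l hl]; last first.
    by rewrite mulmnE mnm1E eq_sym (negbTE hl) expr0.
  by rewrite mulmnE mnm1E eqxx mul1n mulr1 => /eqP; rewrite expf_eq0 e0 => /eqP.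
split; first exact: phi_in_X.
move=> a [i ji ai]; rewrite phiE (bigD1 i) //= hx // expr0n gtn_eqF //.
by rewrite mul0r.
Qed.

Let point_coord (i : 'I_4) : exists2 a, (0 < tnth wmon6 a i)%N & phi (delta_mx 0 i) 0 a = 1.
Proof.
have [a ea] := pure_power i; exists a.
  by rewrite ea mulmnE mnm1E eqxx mul1n /w3111; case: ifP.
rewrite phiE ea big1 // => l _.
rewrite mxE eqxx /= mulmnE mnm1E [l == i]eq_sym.
by case: eqP => _; rewrite ?expr1n // mul0n expr0.
Qed.

Let stratum_point (i : 'I_4) j : (i <= j)%N -> stratum j (phi (delta_mx 0 i)).
Proof.
move=> ij; apply/stratumP; split; last first.
  exists (delta_mx 0 i) => // l jl; rewrite mxE eqxx /=.
  by case: eqP => // e; rewrite e ltnNge ij in jl.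
have [a _ ea] := point_coord i; apply/eqP => /rowP /(_ a); rewrite ea mxE => /eqP.
by rewrite oner_eq0.
Qed.

Lemma dim_X d : has_dim X d -> (3 <= d)%N.
Proof.
(* If [d < 3], the strata [0], ..., [d.+1] are a chain of length [d.+1]. *)
move=> [_ hd]; rewrite leqNgt; apply/negP => d3; apply: hd; exists stratum.
have [SX hSX XE] := pv_closed X.
have sub j : (stratum j `<=` pv_set X)%classic by move=> y [].
split=> [j hj|j hj]; last first.
  split=> [y [Xy hy]|hsub].
    by split=> // a [i ji ai]; apply: hy; exists i => //; apply: ltnW.
  have j4 : (j.+1 < 4)%N by lia.
  have [_ h] := hsub _ (@stratum_point (Ordinal j4) j.+1 (leqnn _)).
  have [a ai ea] := point_coord (Ordinal j4).
  have /eqP : phi (delta_mx 0 (Ordinal j4)) 0 a = 0 by apply: h; exists (Ordinal j4).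
  by rewrite ea oner_eq0.
split=> //.
  exists (SX `|` [set F | exists a, (exists2 i : 'I_4, (j < i)%N & (0 < tnth wmon6 a i)%N) /\ F = 'X_a])%classic.
    by move=> F [/hSX //|[a [_ ->]]]; exists 1%N; rewrite dhomogX /= mdeg1.
  apply/predeqP => y; split=> [[Xy hy]|[y0 hy]].
    split; first exact: closed_neq0 (pv_closed X) Xy.
    move=> F [SF|[a [ha ->]]]; last by rewrite mevalXU hy.
    by move: Xy; rewrite XE => -[_]; apply.
  split; first by rewrite XE; split=> // F SF; apply: hy; left.
  by move=> a ha; have := hy 'X_a; rewrite mevalXU; apply; right; exists a.
apply: (@param_irreducible K 38 4 (fun a => 'X_[tnth wmon6 a])
  [set x : 'rV[K]_4 | forall i : 'I_4, (j < i)%N -> x 0 i = 0]%classic).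
- by move=> a b t ha hb i ji; rewrite !mxE ha // hb // subr0 mulr0 addr0.
- have j4 : (j < 4)%N by lia.
  by exists (phi (delta_mx 0 (Ordinal j4))); apply: stratum_point.
- by move=> y /stratumP[].
- by move=> y /stratumP[_ [x hx ->]]; exists x, 1; rewrite scale1r.
- by move=> x hx y0; apply/stratumP; split=> //; exists x.
Qed.

End Anticanonical.

(** * From an extension of [X] to a section ideal, and back to a cone *)

Section Section3111.

Context (K : closedFieldType) (r : nat).
Local Notation X := (anticanonical_P3111 K).
Local Notation phi := (@monomial_map K 3 38 wmon6).
Local Notation S := {mpoly K[39 + r]}.
Implicit Types (G H : S) (c : 'I_39 -> 'I_r -> K).

Lemma Phi_eval c G (x : 'rV[K]_4) (t : 'rV[K]_r) :
  (Phi c G).@[(row_mx x t) 0] =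
  G.@[(row_mx (phi x + t *m \matrix_(k, a) c a k) t) 0].
Proof.
rewrite /Phi comp_mpoly_meval; apply: meval_eq => i; rewrite tnth_mktuple /gen /ell.
case: (split_ordP i) => [a ->|k ->]; rewrite mevalD; last first.
  by rewrite row_mxEr meval0 addr0 mevalXU row_mxEr.
rewrite row_mxEl mevalX big_split_ord /= [X in _ * X]big1 ?mulr1 => [|k _]; last first.
  by rewrite lift4_t expr0.
rewrite [in RHS]mxE phiE (raddf_sum (meval ((row_mx x t) 0))) /=; congr (_ + _).
  by apply: eq_bigr => j _; rewrite row_mxEl lift4_x.
rewrite mxE; apply: eq_bigr => k _; by rewrite mevalZ mevalXU row_mxEr mxE mulrC.
Qed.

Context (Y : projVariety K (38 + r)) (A : 'M[K]_(39, 39 + r)) (C : 'M[K]_(r, 39 + r)).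
Context (fA : row_free A) (uB : col_mx A C \in unitmx).
Context (secA : saturation (linear_pullback (A : 'M[K]_(38.+1, (38 + r).+1)) @` vanishing_ideal Y)%classic
  = vanishing_ideal X).
Local Notation B := (col_mx A C : 'M[K]_((38 + r).+1)).
Local Notation I := (ideal_of B Y : S -> Prop).

Lemma X_sub_Y y : pv_set X y -> pv_set Y (y *m A).
Proof.
move=> Xy; have [SY hSY YE] := pv_closed Y; rewrite YE; split.
  have := closed_neq0 (pv_closed X) Xy; apply: contraNneq => h.
  by apply/eqP; apply: (row_free_inj fA); rewrite mul0mx.
move=> F SF; rewrite -(linsub_eval A F).
have : vanishing_ideal X (linsub A F); last by apply.
(* In the saturation, exponent 0 suffices, since 1 is the only monomial of degree 0. *)
rewrite -secA; exists 0%N => m /eqP; rewrite mdeg_eq0 => /eqP ->.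
rewrite mpolyX0 mul1r; exists F => // p; rewrite YE => -[_]; exact.
Qed.

Let Iprime : hprime I.
Proof. exact: (@ideal_of_prime K (38 + r) B uB Y (pv_closed Y) (pv_irreducible Y)). Qed.

Let Ihomog d G : I G -> I (pihomog mdeg d G).
Proof. exact: (@ideal_of_homog K (38 + r) B Y d G (pv_closed Y)). Qed.

(** The origin is not a point of [Y]. Components of positive degree vanish there, and the constant
    one vanishes because it does so on [Y]. *)
Let I_eval0 G : I G -> G.@[(0 : 'rV[K]_(39 + r)) 0] = 0.
Proof.
move=> IG; have [[p Yp] _] := pv_irreducible Y.
pose z : 'rV[K]_(39 + r) := p *m invmx B.
have zB : z *m B = p by rewrite /z -mulmxA mulVmx // mulmx1.
rewrite -(scale0r z) [G](@pihomog_partitionE _ _ mdeg (msize G)) //.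
rewrite (raddf_sum (meval ((0 *: z) 0))) big1 //= => d _.
rewrite (meval_homogZ (N := 38 + r) _ _ (pihomogP mdeg d G)).
case: (nat_of_ord d) => [|e]; last by rewrite expr0n mul0r.
by rewrite mul1r; apply: Ihomog => //; rewrite zB.
Qed.

Let I_Xpoint G y : I G -> pv_set X y \/ y = 0 -> G.@[(row_mx y (0 : 'rV[K]_r)) 0] = 0.
Proof.
move=> IG [Xy|->]; last by rewrite row_mx0; exact: I_eval0.
apply: IG; suff : pv_set Y (row_mx y 0 *m col_mx A C) by [].
by rewrite mul_row_col mul0mx addr0; apply: X_sub_Y.
Qed.

Lemma section_idealP d : has_dim X d -> has_dim Y (d + r) -> section_ideal I.
Proof.
move=> dX [[Z hZ] _]; split.
- exact: Iprime.
- exact: Ihomog.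
- move=> G IG; apply: cut_fun0 => v hv.
  pose x : 'rV[K]_4 := \row_i v (lshift r i).
  have vE : v =1 (row_mx x 0 : 'rV[K]_(4 + r)) 0.
    by move=> i; case: (split_ordP i) => j ->; rewrite ?row_mxEl ?row_mxEr mxE.
  rewrite (meval_eq _ vE) Phi_eval mul0mx addr0; apply: I_Xpoint => //.
  by case: (eqVneq (phi x) 0) => [->|/phi_in_X h]; [right|left].
- move=> u v tu e.
  have tv : wgt (@tS r) v = 0%N by rewrite -(pim_tS e).
  pose res (m : 'X_{1..39 + r}) : 'X_{1..39} := [multinom m (lshift r a) | a < 39].
  have tres (m : 'X_{1..39 + r}) j : wgt (@tS r) m = 0%N -> m (rshift 39 j) = 0%N.
    move/eqP; rewrite sum_nat_eq0 => /forallP /(_ (rshift 39 j)) /=.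
    by rewrite tS_t muln1 => /eqP.
  have resE (m : 'X_{1..39 + r}) (y : 'rV[K]_39) : wgt (@tS r) m = 0%N ->
      'X_[m].@[(row_mx y (0 : 'rV[K]_r)) 0] = 'X_[res m].@[y 0].
    move=> tm; rewrite !mevalX big_split_ord /= [X in _ * X]big1 ?mulr1 => [|j _]; last first.
      by rewrite tres.
    by apply: eq_bigr => a _; rewrite row_mxEl mnmE.
  have pimE m x : 'X_[m].@[(row_mx (phi x) (0 : 'rV[K]_r)) 0] = 'X_[pim m].@[(row_mx x 0) 0].
    by rewrite -monoX Phi_eval mul0mx addr0.
  (* The binomial vanishes on [X], hence lies in the saturation, which supplies the degree [n]. *)
  have : vanishing_ideal X ('X_[res u] - 'X_[res v]).
    by move=> y /X_phi[x ->]; rewrite mevalB -!resE // !pimE e subrr.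
  rewrite -secA => -[n hn]; exists n => k tk dk.
  have [|F YF EF] := hn (res k).
    rewrite -dk !mdegE big_split_ord /= [X in (_ + X)%N]big1 ?addn0 => [|j _]; last exact: tres.
    by apply: eq_bigr => a _; rewrite mnmE.
  exists (linsub B F); first by move=> z Yz; rewrite linsub_eval; apply: YF.
  apply: cut_fun0 => w hw.
  pose y : 'rV[K]_39 := \row_a w (lshift r a).
  have wE : w =1 (row_mx y 0 : 'rV[K]_(39 + r)) 0.
    by move=> i; case: (split_ordP i) => j ->; rewrite ?row_mxEl ?row_mxEr mxE.
  rewrite (meval_eq _ wE) mevalB linsub_eval mul_row_col mul0mx addr0 mevalM mevalB !resE //.
  have := congr1 (meval (y 0)) EF; rewrite -[linear_pullback _ _]/(linsub A F) linsub_eval => ->.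
  by rewrite mevalM mevalB subrr.
- move=> q n hq; have := @chain_dim K (38 + r) B Y (d + r)%N Z uB hZ q n hq.
  by apply: leq_trans; rewrite leq_add2r; apply: dim_X dX.
Qed.

Lemma section_is_cone d : 6%:R != 0 :> K -> has_dim X d -> has_dim Y (d + r) -> (0 < r)%N -> is_cone Y.
Proof.
move=> six0 dX dY r0; have hI := section_idealP dX dY.
have [n0 hn0] := lift_large hI.
have [c hc] := Phi_kernel hI six0 hn0.
pose M : 'M[K]_(r, 39) := \matrix_(k, a) c a k.
pose pt (x : 'rV[K]_4) (t : 'rV[K]_r) : 'rV[K]_(39 + r) := row_mx (phi x + t *m M) t.
have inY x t : pt x t != 0 -> pv_set Y (pt x t *m B).
  move=> pt0; have [SY hSY YE] := pv_closed Y; rewrite YE; split.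
    by apply: contraNneq pt0 => h; rewrite -(mulmxK uB (pt x t)) h mul0mx.
  move=> F SF; rewrite -linsub_eval -Phi_eval hc ?meval0 //.
  move=> z; rewrite linsub_eval YE => -[_]; exact.
have ofY (z : 'rV[K]_(39 + r)) : pv_set Y (z *m col_mx A C) -> exists x, z = pt x (rsubmx z).
  move=> Yz; pose y := lsubmx z - rsubmx z *m M.
  suff [x ex] : exists x, y = phi x.
    by exists x; rewrite /pt -ex subrK hsubmxK.
  case: (eqVneq y 0) => [->|y0]; first by exists 0; rewrite phi0.
  apply: X_phi; have [SX hSX XE] := pv_closed X; rewrite XE; split=> // f Sf.
  have [e hf] := hSX f Sf.
  have fX p : pv_set X p -> f.@[p 0] = 0 by rewrite XE => -[_]; apply.
  (* Projection from the vertex of the cone to [t = 0]. Equations of [X] composed with it vanish on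
     the cone, so [kernel_sub] puts them in [I]. *)
  pose T : 'M[K]_(39 + r, 39) := col_mx 1%:M (- M).
  have IT : I (linsub T f).
    apply: (kernel_sub hI hn0 hc (linsub_homog T hf)); apply: mpoly_fun0 => v.
    pose x : 'rV[K]_4 := \row_i v (lshift r i); pose t : 'rV[K]_r := \row_k v (rshift 4 k).
    have vE : v =1 (row_mx x t) 0.
      by move=> i; case: (split_ordP i) => j ->; rewrite ?row_mxEl ?row_mxEr mxE.
    rewrite (meval_eq _ vE) Phi_eval linsub_eval mul_row_col mulmx1 mulmxN addrK.
    case: (eqVneq (phi x) 0) => [->|/phi_in_X]; last exact: fX.
    have [[p Xp] _] := pv_irreducible X.
    by rewrite -(scale0r p) (meval_homogZ _ _ hf) fX ?mulr0.
  have <- : z *m T = y by rewrite -{1}(hsubmxK z) mul_row_col mulmx1 mulmxN.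
  by rewrite -linsub_eval; apply: (IT z Yz).
(* The point with [x = 0] and parameter [t0] serves as vertex; [0 < r] makes [t0] nonzero. *)
pose t0 : 'rV[K]_r := const_mx 1.
have t00 : t0 != 0.
  by apply/eqP => /rowP /(_ (Ordinal r0)); rewrite !mxE => /eqP; rewrite oner_eq0.
exists (pt 0 t0 *m B).
  by apply: inY; apply: contraNneq t00 => /eqP; rewrite /pt row_mx_eq0 => /andP[_ ->].
move=> y Yy a b nz.
pose z : 'rV[K]_(39 + r) := y *m invmx B.
have zB : z *m B = y by rewrite /z -mulmxA mulVmx // mulmx1.
rewrite -zB in Yy; have [x ex] := ofY z Yy.
(* Weighted scaling of [x] absorbs [b], so a point of the joining line is again of the form [pt]. *)
have [x' ex'] := phi_scale x b.
have E : a *: pt 0 t0 + b *: z = pt x' (a *: t0 + b *: rsubmx z).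
  rewrite [in LHS]ex /pt !scale_row_mx add_row_mx phi0 add0r -ex'; congr row_mx.
  by rewrite mulmxDl -!scalemxAl scalerDr addrCA.
have EB : a *: (pt 0 t0 *m B) + b *: y = pt x' (a *: t0 + b *: rsubmx z) *m B.
  by rewrite -E mulmxDl -!scalemxAl zB.
rewrite EB in nz *; apply: inY; apply: contraNneq nz => ->; by rewrite mul0mx.
Qed.

End Section3111.

Theorem mainTheorem4 (R : realType) :
  ~ extendable (anticanonical_P3111 R[i]).
Proof.
move=> [r [Y [A [r1 ncone [fA secA] [d [dX dY]]]]]]; apply: ncone.
(* Completing the rows of [A] to a basis turns the section into [t = 0]. *)
have [C uB] := @exists_compl _ 39 r A fA.
apply: (section_is_cone fA uB secA _ dX dY r1).
by rewrite Num.Theory.pnatr_eq0.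
Qed.
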